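(* There is a constant $\delta_{\rm M}>0$ such that $$\mathcal E(u)\ge\delta_{\rm M}\sum_{j\in\mathbb Z}u_j^3\qquad(u\in\ell^3(\mathbb Z),\ u_j\ge0),$$ with $\mathcal E$ defined in the context. Moreover, there is an integer $R_0$ with the following property. For every integer $R\ge R_0$ and every finitely supported nonnegative sequence $u=(u_j)_{j\ge0}$, put $$y_u^{[R]}=\sum_{j\ge0}(R2^j)^{-1/6}u_jp_{R2^j},\qquad x_n=n^{-3/2}y_u^{[R]}(n)\quad(n\ge1).$$ Then $$AE_3-\frac12\mathcal C(x)=\mathfrak D(y_u^{[R]})\ge\frac{\delta_{\rm M}}2\sum_{j\ge0}u_j^3.$$ The conclusion also holds for an infinite nonnegative sequence $u=(u_j)_{j\ge0}$ whenever the resulting $A$ and $E_3$ are finite.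
   Context: For a nonnegative sequence $x=(x_n)_{n\ge1}$, $$A=\sum_{n\ge1}x_n,\quad E_3=\sum_{n\ge1}n^3x_n^2,\quad \mathcal C(x)=\sum_{a,b\ge1}(a+b)(a^2+ab+b^2)x_ax_bx_{a+b}.$$ For an integer $J\ge1$, $p_J(n)=\mathbf 1_{\{1\le n\le J\}}$. For a nonnegative sequence $y$, $$\mathfrak D(y)=\Bigl(\sum_{n\ge1}n^{-3/2}y_n\Bigr)\Bigl(\sum_{n\ge1}y_n^2\Bigr)-\frac12\sum_{a,b\ge1}K_{a,b}y_ay_by_{a+b},\qquad K_{a,b}=\frac{(a+b)(a^2+ab+b^2)}{[ab(a+b)]^{3/2}}.$$ Definition of $\mathcal E$. Put $q=2^{-1/6}$, $d_0=\pi-2$, $I=4-\pi$, $s(t)=\sqrt{1+t^2}$, and for $t>0$ \begin{align*} A_*(t)&=2t-2s(t)-2\arctan t+\frac{2t}{s(t)+1},\\ B_*(t)&=-2t+2s(t)+\log\frac{t}{s(t)+1}-\frac1{s(t)+1},\\ C_*(t)&=-t^2+ts(t)+\operatorname{arsinh}t-\frac{2t}{s(t)+1}. \end{align*} For $r>1$ let $t_1=(r-1)^{-1/2}$, $t_2=r^{-1/2}$ and $$U(r)=2\{\sqrt r[A_*(t_1)+2]-B_*(t_1)\},\qquad V(r)=2\{\sqrt r\,C_*(t_2)-B_*(t_2)\},$$ $$G_\infty(r)=10-\frac2{\sqrt r}+\frac4{\sqrt r+\sqrt{r-1}}-2I-U(r)-V(r),$$ $$G_{\rm rep}(r)=12-\frac4{\sqrt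 r}+\frac8{\sqrt r+\sqrt{r-1}}-2(4-\pi)-2U(r).$$ Let $g_0=4\{\pi+\sqrt2-\log(1+\sqrt2)-2\}$ and, for integers $a\ge1$, $g_a=G_\infty(2^a)$, $h_a=G_{\rm rep}(2^a)$. For a nonnegative $u\in\ell^3(\mathbb Z)$ define, by absolutely convergent series, \begin{align*} \mathcal E(u)={}&d_0\sum_iu_i^3+\frac{g_0}2\sum_{i<k}q^{k-i}u_i^2u_k+\frac12\sum_{i<j}h_{j-i}q^{2(j-i)}u_iu_j^2\\ &+\sum_{i<j<k}g_{j-i}q^{(j-i)+(k-i)}u_iu_ju_k, \end{align*} all indices ranging over $\mathbb Z$. *)

(* Defs.v *)
From HB Require Import structures.
From mathcomp Require Import all_boot all_order all_algebra.
From mathcomp Require Import all_classical all_reals all_analysis.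

Set Implicit Arguments.
Unset Strict Implicit.
Unset Printing Implicit Defensive.

Import Order.TTheory GRing.Theory Num.Theory.
Import numFieldNormedType.Exports.

Local Open Scope classical_set_scope.
Local Open Scope ring_scope.

Section nonnegative_sequences.
Variable R : realType.

(* Nonnegative sequences indexed by n >= 1 are maps nat -> \bar R whose value
   at 0 is never used; their sums live in \bar R, so that a divergent series
   is +oo rather than a default value. *)

Definition pos_pairs : set (nat * nat) := [set p | (0 < p.1)%N /\ (0 < p.2)%N].

Definition totalA (x : nat -> \bar R) : \bar R :=
  (\sum_(1 <= n <oo) x n)%E.

Definition momentE3 (x : nat -> \bar R) : \bar R :=
  (\sum_(1 <= n <oo) (n ^ 3)%:R%:E * x n ^+ 2)%E.

Definition cubicC (x : nat -> \bar R) : \bar R :=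
  (\esum_(p in pos_pairs)
     (((p.1 + p.2) * (p.1 ^ 2 + p.1 * p.2 + p.2 ^ 2))%N%:R%:E
        * x p.1 * x p.2 * x (p.1 + p.2)%N))%E.

Definition kernelK (a b : nat) : R :=
  ((a + b) * (a ^ 2 + a * b + b ^ 2))%N%:R
    / ((a * b * (a + b))%N%:R `^ (3 / 2)).

Definition deficitD (y : nat -> \bar R) : \bar R :=
  ((\sum_(1 <= n <oo) (n%:R `^ (- (3 / 2)))%:E * y n)
     * (\sum_(1 <= n <oo) y n ^+ 2)
   - (1 / 2)%:E * \esum_(p in pos_pairs)
       ((kernelK p.1 p.2)%:E * y p.1 * y p.2 * y (p.1 + p.2)%N))%E.

Definition plateau (J n : nat) : R := (1 <= n <= J)%N%:R.

Definition yseq (N : nat) (u : nat -> R) (n : nat) : \bar R :=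
  (\sum_(0 <= j <oo)
     ((N * 2 ^ j)%N%:R `^ (- (1 / 6)) * u j * plateau (N * 2 ^ j) n)%:E)%E.

Definition xseq (N : nat) (u : nat -> R) (n : nat) : \bar R :=
  ((n%:R `^ (- (3 / 2)))%:E * yseq N u n)%E.

End nonnegative_sequences.

Section dyadic_form.
Variable R : realType.
Implicit Types (t r : R) (a : int) (u : int -> R).

(* Sum of an absolutely convergent family of reals; only meaningful when
   [summable D (EFin \o f)] holds. *)
Definition abs_sum (T : choiceType) (D : set T) (f : T -> R) : \bar R :=
  (\esum_(i in D) (f^\+ i)%:E - \esum_(i in D) (f^\- i)%:E)%E.

Definition q : R := 2 `^ (- (1 / 6)).
Definition d0 : R := pi - 2.
Definition I0 : R := 4 - pi.

Definition s t : R := Num.sqrt (1 + t ^+ 2).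
Definition arsinh t : R := ln (t + Num.sqrt (1 + t ^+ 2)).

Definition Astar t : R := 2 * t - 2 * s t - 2 * atan t + 2 * t / (s t + 1).
Definition Bstar t : R := - 2 * t + 2 * s t + ln (t / (s t + 1)) - 1 / (s t + 1).
Definition Cstar t : R := - t ^+ 2 + t * s t + arsinh t - 2 * t / (s t + 1).

Definition t1 r : R := (r - 1) `^ (- (1 / 2)).
Definition t2 r : R := r `^ (- (1 / 2)).

Definition U r : R := 2 * (Num.sqrt r * (Astar (t1 r) + 2) - Bstar (t1 r)).
Definition V r : R := 2 * (Num.sqrt r * Cstar (t2 r) - Bstar (t2 r)).

Definition Ginfty r : R :=
  10 - 2 / Num.sqrt r + 4 / (Num.sqrt r + Num.sqrt (r - 1))
  - 2 * I0 - U r - V r.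
Definition Grep r : R :=
  12 - 4 / Num.sqrt r + 8 / (Num.sqrt r + Num.sqrt (r - 1))
  - 2 * (4 - pi) - 2 * U r.

Definition g0 : R := 4 * (pi + Num.sqrt 2 - ln (1 + Num.sqrt 2) - 2).
(* used for a >= 1 only *)
Definition g a : R := Ginfty (2 ^ a).
Definition h a : R := Grep (2 ^ a).

Definition lt_pairs : set (int * int) := [set p | p.1 < p.2].
Definition lt_triples : set (int * int * int) :=
  [set p | p.1.1 < p.1.2 /\ p.1.2 < p.2].

Definition term_iik u (p : int * int) : R :=
  let: (i, k) := p in q ^ (k - i) * u i ^+ 2 * u k.
Definition term_ijj u (p : int * int) : R :=
  let: (i, j) := p in h (j - i) * q ^ (2 * (j - i)) * u i * u j ^+ 2.
Definition term_ijk u (p : int * int * int) : R :=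
  let: (i, j, k) := p in
  g (j - i) * q ^ ((j - i) + (k - i)) * u i * u j * u k.

Definition cubic_energy u : \bar R :=
  (d0%:E * abs_sum setT (fun i => u i ^+ 3)%R
   + (g0 / 2)%:E * abs_sum lt_pairs (term_iik u)
   + (1 / 2)%:E * abs_sum lt_pairs (term_ijj u)
   + abs_sum lt_triples (term_ijk u))%E.

Definition cubic_energy_abs_cvg u : Prop :=
  [/\ summable setT (fun i => (u i ^+ 3)%:E),
      summable lt_pairs (EFin \o term_iik u),
      summable lt_pairs (EFin \o term_ijj u) &
      summable lt_triples (EFin \o term_ijk u)].

Definition in_ell3 u : Prop := summable setT (fun i => (`|u i| ^+ 3)%:E).

End dyadic_form.

(* Main.v *)
(* Both inequalities come from one inequality for finite chains.  The
   coefficients of E satisfy d0 >= 1.11, g0/2 >= 3.29,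
   h_a/2 >= 4.63 - a log 2 - 3.51 q^(3a) and g_a >= 7.31 - 2a log 2 - 3.16 q^(3a),
   so that E, restricted to a finite window and sorted by the middle index j, is
   at least a sum over j of cubic polynomials in u_j and in geometrically weighted
   sums of u over the past and the future of j.  These sums obey first-order
   recursions in j; a cubic polynomial in them, found by semidefinite programming,
   serves as a telescoping potential and gives the lower bound (1/20) sum u_j^3.

   For the ladder sequence y, write K_{a,b} = a^(-3/2) + b^(-3/2) + remainder.  The
   two edge terms combine with the product of sums, the remainder is nonnegative
   and bounded by explicit power sums, and the coefficient of u_i u_j u_k
   (i <= j <= k) in the deficit is at least the one above diminished by
   2 q^(3(k-j)) on the terms u_j^2 u_k and by 4 q^(3(k-i)) on the terms with
   i < j < k.  The potential has enough slack for this loss, so the same chain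
   inequality applies at every level at once.  Infinite families are reached by
   exhaustion. *)

(* Two obstacles shape the proof. The lower bounds for [h] and [g] decrease linearly in the gap and
   turn negative from a gap of 6 or 7 on, so positivity term by term is out of reach. The decrease
   comes from the kernel remainder on a box with sides I <= J: the row at b > I contributes about
   sqrt I / b, hence a harmonic sum between two levels. In the chain it appears as the moment M,
   which no multiple of L controls. The potential is therefore corrected by a multiple of X^2 M,
   chosen so that M cancels exactly; only then is one step a polynomial inequality in finitely many
   bounded-ratio variables. For the ladder, the product of sums and the edge sums each have
   coefficients growing linearly with the levels, while their difference grows only like the square
   root of the smallest level I. They are subtracted exactly, by counting, before anything is
   estimated. All coefficients are then multiples of sqrt I up to additive constants. The weights (R
   2^j)^(-1/6) cancel sqrt I, so every level looks the same, and R only has to be so large that a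
   small multiple of sqrt R absorbs the additive constants. *)
Require Import Defs.
From HB Require Import structures.
From mathcomp Require Import all_boot all_order all_algebra.
From mathcomp Require Import all_classical all_reals all_analysis.
From mathcomp Require Import ring lra zify.

Import Order.TTheory GRing.Theory Num.Theory.
Import numFieldNormedType.Exports.

Local Open Scope classical_set_scope.
Local Open Scope ring_scope.

(** * The chain inequality *)

(* The coefficients come from a semidefinite program.  At the index j, X and Z are
   the sums of q^(k-j) u_k and q^(4(k-j)) u_k over k >= j, while L, M, N below are
   the sums of q^(2(j-i)) u_i, (j-i) q^(2(j-i)) u_i and q^(5(j-i)) u_i over i < j. *)
Definition potential {R : realFieldType} (X Z L N : R) : R :=
  43 / 100 * X ^+ 3 + 271 / 100 * X ^+ 2 * L - 178 / 100 * X ^+ 2 * N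
  - 16 / 100 * X * Z * L - 257 / 100 * X * L ^+ 2
  + 294 / 100 * X * L * N - 248 / 100 * X * N ^+ 2
  + 21 / 10 * Z * L * N + 31 / 100 * Z ^+ 2 * L.

(* W and Y are X - u and Z - u at the same index; 61/88 is an upper bound for log 2. *)
Definition density {R : realFieldType} (u W Y L M N : R) : R :=
  111 / 100 * u ^+ 3 + u ^+ 2 * (329 / 100 * W - 2 * Y)
  + u ^+ 2 * (463 / 100 * L - 61 / 88 * M - 351 / 100 * N)
  + u * (W * (731 / 100 * L - 61 / 44 * M - 316 / 100 * N) - 4 * Y * N).

(* Applied with s = 2 q^3 = sqrt 2.  The second group on the right is the potential
   at the next index, in terms of W and Y.  With s bounded by its enclosure and
   W = 239/169 Y + w, L = 239/169 N + l, the difference of the two sides is a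
   combination with nonnegative coefficients of the squares Q0 to Q9 and of monomials. *)
Lemma potential_step {R : realFieldType} (s u W Y L N : R) :
  239 / 169 <= s <= 577 / 408 ->
  0 <= u -> 0 <= Y -> 0 <= N -> s * Y <= W -> s * N <= L ->
  1 / 20 * u ^+ 3 + potential (u + W) (u + Y) L N
    + 61 / 88 * W ^+ 2 * (L + u)
  <= density u W Y L 0 N
     + (43 / 100 * s * W ^+ 3 + 271 / 100 * W ^+ 2 * (L + u)
        - 178 / 100 * (s / 2) * W ^+ 2 * (N + u)
        - 16 / 100 * s * W * Y * (L + u)
        - 257 / 100 * (s / 2) * W * (L + u) ^+ 2
        + 294 / 100 / 2 * W * (L + u) * (N + u)
        - 248 / 100 * (s / 4) * W * (N + u) ^+ 2
        + 21 / 10 * (s / 2) * Y * (L + u) * (N + u)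
        + 31 / 100 * 2 * Y ^+ 2 * (L + u)).
Proof.
move=> /andP[slo shi] u0 Y0 N0 WY LN.
have w0 : 0 <= W - 239 / 169 * Y.
  by rewrite subr_ge0; apply: le_trans WY; apply: ler_wpM2r.
have l0 : 0 <= L - 239 / 169 * N.
  by rewrite subr_ge0; apply: le_trans LN; apply: ler_wpM2r.
have [w ew] : exists w, W = 239 / 169 * Y + w
  by exists (W - 239 / 169 * Y); ring.
have [l el] : exists l, L = 239 / 169 * N + l
  by exists (L - 239 / 169 * N); ring.
have cst_ge0 (i j : nat) : 0 <= i%:R / j%:R :> R by rewrite divr_ge0 ?ler0n.
have lin_s (a m : R) : 0 <= m -> a <= 0 -> 577 / 408 * a * m <= s * a * m.
  by move=> m0 a0; rewrite ler_wpM2r// ler_wnM2r.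
have lin_s' (a m : R) : 0 <= m -> 0 <= a -> 239 / 169 * a * m <= s * a * m.
  by move=> m0 a0; rewrite ler_wpM2r// ler_wpM2r.
have w'0 : 0 <= w by move: w0; rewrite ew addrC addKr.
have l'0 : 0 <= l by move: l0; rewrite el addrC addKr.
have W0 : 0 <= W by rewrite ew; exact: addr_ge0 (mulr_ge0 (cst_ge0 239 169) Y0) w'0.
have L0 : 0 <= L by rewrite el; exact: addr_ge0 (mulr_ge0 (cst_ge0 239 169) N0) l'0.
have Lu0 : 0 <= L + u by rewrite addr_ge0.
have Nu0 : 0 <= N + u by rewrite addr_ge0.
(* The six terms in which s survives. A positive coefficient takes the lower bound of s, a negative
   one the upper bound; 89/100, 257/200, 62/100 and 105/100 are the coefficients after the divisions
   by 2 and 4. *)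
have S1 : 239 / 169 * (43 / 100) * W ^+ 3 <= s * (43 / 100) * W ^+ 3.
  by apply: lin_s'; [rewrite exprn_ge0|by rewrite ?mulNr ?oppr_le0 cst_ge0].
have S2 : 577 / 408 * (- 89 / 100) * (W ^+ 2 * (N + u))
          <= s * (- 89 / 100) * (W ^+ 2 * (N + u)).
  by apply: lin_s; [rewrite mulr_ge0// exprn_ge0|by rewrite ?mulNr ?oppr_le0 cst_ge0].
have S3 : 577 / 408 * (- 16 / 100) * (W * Y * (L + u))
          <= s * (- 16 / 100) * (W * Y * (L + u)).
  by apply: lin_s; [rewrite !mulr_ge0|by rewrite ?mulNr ?oppr_le0 cst_ge0].
have S4 : 577 / 408 * (- 257 / 200) * (W * (L + u) ^+ 2)
          <= s * (- 257 / 200) * (W * (L + u) ^+ 2).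
  by apply: lin_s; [rewrite mulr_ge0// exprn_ge0|by rewrite ?mulNr ?oppr_le0 cst_ge0].
have S5 : 577 / 408 * (- 62 / 100) * (W * (N + u) ^+ 2)
          <= s * (- 62 / 100) * (W * (N + u) ^+ 2).
  by apply: lin_s; [rewrite mulr_ge0// exprn_ge0|by rewrite ?mulNr ?oppr_le0 cst_ge0].
have S6 : 239 / 169 * (105 / 100) * (Y * (L + u) * (N + u))
          <= s * (105 / 100) * (Y * (L + u) * (N + u)).
  by apply: lin_s'; [rewrite !mulr_ge0|by rewrite ?mulNr ?oppr_le0 cst_ge0].
have sqM (a b c : R) : 0 <= a -> 0 <= b -> 0 <= a * b * c ^+ 2.
  by move=> a0 b0; rewrite mulr_ge0 ?sqr_ge0// mulr_ge0.
have Q0 : 0 <= 2567 / 1000 * u * (83 / 250 * u - 409 / 1000 * w - 369 / 1000 * Y + l + 217 / 500 * N) ^+ 2 by rewrite sqM// cst_ge0.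
have Q1 : 0 <= 69 / 200 * u * (u + 21 / 200 * w - 399 / 500 * Y + 7 / 250 * N) ^+ 2 by rewrite sqM// cst_ge0.
have Q2 : 0 <= 2 / 200 * u * (- 79 / 500 * w + Y - 841 / 1000 * N) ^+ 2 by rewrite sqM// cst_ge0.
have Q3 : 0 <= 349 / 250 * w * (u - 173 / 500 * w - 249 / 500 * Y + 733 / 1000 * l + 303 / 1000 * N) ^+ 2 by rewrite sqM// cst_ge0.
have Q4 : 0 <= 899 / 1000 * w * (- 19 / 200 * w - 21 / 50 * Y + 1 / 50 * l + N) ^+ 2 by rewrite sqM// cst_ge0.
have Q5 : 0 <= 1759 / 1000 * Y * (u - 3 / 10 * w - 191 / 500 * Y + 367 / 500 * l - 71 / 1000 * N) ^+ 2 by rewrite sqM// cst_ge0.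
have Q6 : 0 <= 113 / 1000 * Y * (- 297 / 500 * w - 131 / 100 * Y + l + 1097 / 500 * N) ^+ 2 by rewrite sqM// cst_ge0.
have Q7 : 0 <= 3 / 100 * Y * (243 / 1000 * w - 1291 / 1000 * Y + N) ^+ 2 by rewrite sqM// cst_ge0.
have Q8 : 0 <= 14 / 125 * l * (761 / 1000 * u - 191 / 500 * w + Y) ^+ 2 by rewrite sqM// cst_ge0.
have Q9 : 0 <= 9 / 500 * N * (- 857 / 1000 * u - 8 / 25 * w + Y) ^+ 2 by rewrite sqM// cst_ge0.
have mynn : 0 <= Y * N * N by rewrite !mulr_ge0.
have myln : 0 <= Y * l * N by rewrite !mulr_ge0.
have myll : 0 <= Y * l * l by rewrite !mulr_ge0.
have myyn : 0 <= Y * Y * N by rewrite !mulr_ge0.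
have myyl : 0 <= Y * Y * l by rewrite !mulr_ge0.
have myyy : 0 <= Y * Y * Y by rewrite !mulr_ge0.
have mwnn : 0 <= w * N * N by rewrite !mulr_ge0.
have mwln : 0 <= w * l * N by rewrite !mulr_ge0.
have mwll : 0 <= w * l * l by rewrite !mulr_ge0.
have mwyn : 0 <= w * Y * N by rewrite !mulr_ge0.
have mwyl : 0 <= w * Y * l by rewrite !mulr_ge0.
have mwyy : 0 <= w * Y * Y by rewrite !mulr_ge0.
have mwwn : 0 <= w * w * N by rewrite !mulr_ge0.
have mwwl : 0 <= w * w * l by rewrite !mulr_ge0.
have mwwy : 0 <= w * w * Y by rewrite !mulr_ge0.
have mwww : 0 <= w * w * w by rewrite !mulr_ge0.
have munn : 0 <= u * N * N by rewrite !mulr_ge0.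
have muln : 0 <= u * l * N by rewrite !mulr_ge0.
have mull : 0 <= u * l * l by rewrite !mulr_ge0.
have muyn : 0 <= u * Y * N by rewrite !mulr_ge0.
have muyl : 0 <= u * Y * l by rewrite !mulr_ge0.
have muyy : 0 <= u * Y * Y by rewrite !mulr_ge0.
have muwn : 0 <= u * w * N by rewrite !mulr_ge0.
have muwl : 0 <= u * w * l by rewrite !mulr_ge0.
have muwy : 0 <= u * w * Y by rewrite !mulr_ge0.
have muww : 0 <= u * w * w by rewrite !mulr_ge0.
have muun : 0 <= u * u * N by rewrite !mulr_ge0.
have muul : 0 <= u * u * l by rewrite !mulr_ge0.
have muuy : 0 <= u * u * Y by rewrite !mulr_ge0.
have muuw : 0 <= u * u * w by rewrite !mulr_ge0.
have muuu : 0 <= u * u * u by rewrite !mulr_ge0.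
rewrite /density /potential; subst W L.
move: S1 S2 S3 S4 S5 S6; clear - Q0 Q1 Q2 Q3 Q4 Q5 Q6 Q7 Q8 Q9
  mynn myln myll myyn myyl myyy mwnn mwln mwll mwyn mwyl mwyy mwwn mwwl mwwy mwww
  munn muln mull muyn muyl muyy muwn muwl muwy muww muun muul muuy muuw muuu.
lra.
Qed.

(** In terms of [W], [Y], [l], [k] the four arguments carry the powers -1, -4, 2, 5 of q, all
    congruent to 2 mod 3. Every cubic monomial thus rescales by a power of q^3, and q^6 = 1/2
    reduces it to a rational number or a rational multiple of s. This is why sqrt 2 is the only
    irrationality in the step. *)
Lemma potential_rescale {R : realFieldType} (q x z l k : R) : q ^+ 6 = 1 / 2 ->
  let s := 2 * q ^+ 3 in let W := q * x in let Y := q ^+ 4 * z in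
  potential x z (q ^+ 2 * l) (q ^+ 5 * k) =
       43 / 100 * s * W ^+ 3 + 271 / 100 * W ^+ 2 * l
        - 178 / 100 * (s / 2) * W ^+ 2 * k
        - 16 / 100 * s * W * Y * l
        - 257 / 100 * (s / 2) * W * l ^+ 2
        + 294 / 100 / 2 * W * l * k
        - 248 / 100 * (s / 4) * W * k ^+ 2
        + 21 / 10 * (s / 2) * Y * l * k
        + 31 / 100 * 2 * Y ^+ 2 * l.
Proof.
move=> q6 s W Y; rewrite /s /W /Y /potential.
apply/eqP; rewrite -subr_eq0.
rewrite (_ : _ - _ = (1 / 2 - q ^+ 6) * (86 / 100 * x ^+ 3
    - 32 / 100 * q ^+ 2 * x * z * l - 294 / 100 * q * x * l * k
    + 248 / 100 * q ^+ 4 * x * k ^+ 2 + 62 / 100 * q ^+ 2 * z ^+ 2 * l)).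
  by rewrite q6 subrr mul0r.
by field.
Qed.

Definition future {R : realFieldType} (q : R) (u : nat -> R) (n j : nat) : R :=
  \sum_(j <= k < n) q ^+ (k - j) * u k.

Definition past {R : realFieldType} (q : R) (w : nat -> R) (u : nat -> R)
    (j : nat) : R :=
  \sum_(0 <= i < j) w (j - i)%N * q ^+ (j - i) * u i.

Lemma futureS {R : realFieldType} (q : R) u n j : (j < n)%N ->
  future q u n j = u j + q * future q u n j.+1.
Proof.
move=> jn; rewrite /future big_ltn// subnn expr0 mul1r mulr_sumr; congr (_ + _).
apply: eq_big_nat => k /andP[jk _].
by rewrite mulrA -exprS subnS prednK// subn_gt0.
Qed.

Lemma past0 {R : realFieldType} (q : R) w u : past q w u 0 = 0.
Proof. by rewrite /past big_geq. Qed.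

Lemma pastS {R : realFieldType} (q : R) u j :
  past q (fun=> 1) u j.+1 = q * (past q (fun=> 1) u j + u j).
Proof.
rewrite /past big_nat_recr//= subSnn expr1 mul1r mulrDr; congr (_ + _).
rewrite mulr_sumr; apply: eq_big_nat => i /andP[_ ij].
by rewrite !mul1r subSn 1?ltnW// exprS mulrA.
Qed.

Lemma past_linS {R : realFieldType} (q : R) u j :
  past q (fun a => a%:R) u j.+1 =
  q * (past q (fun a => a%:R) u j + past q (fun=> 1) u j + u j).
Proof.
rewrite /past big_nat_recr//= subSnn expr1 mul1r !mulrDr; congr (_ + _).
rewrite !mulr_sumr -big_split/=; apply: eq_big_nat => i /andP[_ ij].
by rewrite subSn 1?ltnW// exprS -[(j - i).+1]addn1 natrD; ring.
Qed.

Lemma future_ge0 {R : realFieldType} (q : R) u n j : 0 <= q ->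
  (forall i, 0 <= u i) -> 0 <= future q u n j.
Proof. by move=> q0 u0; apply: sumr_ge0 => k _; rewrite mulr_ge0// exprn_ge0. Qed.

Lemma past_ge0 {R : realFieldType} (q : R) w u j : 0 <= q ->
  (forall a, 0 <= w a) -> (forall i, 0 <= u i) -> 0 <= past q w u j.
Proof.
by move=> q0 w0 u0; apply: sumr_ge0 => k _; rewrite !mulr_ge0// exprn_ge0.
Qed.

(** The endpoints are consecutive continued-fraction convergents of sqrt 2. *)
Lemma sqrt2_enclosure {R : realFieldType} (s : R) : 0 <= s -> s ^+ 2 = 2 ->
  239 / 169 <= s <= 577 / 408.
Proof.
move=> s0; rewrite expr2 => s2; rewrite !leNgt; apply/andP; split; apply/negP => h.
  have : s * s < 239 / 169 * (239 / 169) by rewrite ltr_pM.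
  by rewrite s2; lra.
have c0 : 0 <= 577 / 408 :> R by rewrite divr_ge0 ?ler0n.
have : 577 / 408 * (577 / 408) < s * s by exact: (ltr_pM c0 c0 h h).
by rewrite s2; lra.
Qed.

Definition chain_density {R : realFieldType} (q : R) u n j :=
  density (u j) (q * future q u n j.+1) (q ^+ 4 * future (q ^+ 4) u n j.+1)
    (past (q ^+ 2) (fun=> 1) u j) (past (q ^+ 2) (fun a => a%:R) u j)
    (past (q ^+ 5) (fun=> 1) u j).

Lemma chain_density_ge {R : realFieldType} (q : R) (u : nat -> R) n :
  0 < q -> q ^+ 6 = 1 / 2 -> (forall i, 0 <= u i) ->
  1 / 20 * \sum_(0 <= j < n) u j ^+ 3 <= \sum_(0 <= j < n) chain_density q u n j.
Proof.
move=> q0 q6 u0.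
have q00 := ltW q0.
pose s := 2 * q ^+ 3.
have senc : 239 / 169 <= s <= 577 / 408.
  apply: sqrt2_enclosure; first by rewrite mulr_ge0// exprn_ge0.
  by rewrite exprMn -exprM q6; field.
have q31 : q ^+ 3 <= 1 by move: senc => /andP[_]; rewrite /s; lra.
pose L := past (q ^+ 2) (fun=> 1) u.
pose M := past (q ^+ 2) (fun a => a%:R) u.
pose N := past (q ^+ 5) (fun=> 1) u.
pose X := future q u n; pose Z := future (q ^+ 4) u n.
(* The X^2 M term removes M: q^2 M' = q^2 q^2 (M + L + u) for the next moment M' matches X'^2 = W^2
   / q^2, so its increment reproduces the M terms of [density] and leaves 61/88 W^2 (L + u), the
   extra term on the left of [potential_step]. *)
pose full j := potential (X j) (Z j) (L j) (N j) - 61 / 88 * (X j ^+ 2 * M j).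
have step j : (j < n)%N ->
    full j - full j.+1 <= chain_density q u n j - 1 / 20 * u j ^+ 3.
  move=> jn; rewrite /full.
  have Xj : X j = u j + q * X j.+1 by exact: futureS.
  have Zj : Z j = u j + q ^+ 4 * Z j.+1 by exact: futureS.
  have Z0 : 0 <= Z j.+1 by apply: future_ge0 => //; exact: exprn_ge0.
  have ZX : Z j.+1 <= X j.+1.
    apply: ler_sum_nat => k _; rewrite ler_wpM2r//.
    rewrite lerXn2r ?nnegrE ?exprn_ge0//.
    by rewrite exprS ler_piMr.
  have N0 : 0 <= N j by apply: past_ge0 => //; rewrite exprn_ge0.
  (* Past sums start at distance 1, and s q^3 = 2 q^6 = 1, so s q^(5a) <= q^(2a) for a >= 1. *)
  have LN : s * N j <= L j.
    rewrite /L /N /past mulr_sumr; apply: ler_sum_nat => i /andP[_ ij].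
    rewrite !mul1r mulrA ler_wpM2r// (exprD q 3 2) exprMn.
    rewrite mulrA ler_piMl ?exprn_ge0//.
    rewrite -(@prednK (j - i)%N) ?subn_gt0// exprS mulrA.
    have -> : s * q ^+ 3 = 1 by rewrite /s -mulrA -exprD q6; field.
    by rewrite mul1r exprn_ile1// exprn_ge0.
  have sY : s * (q ^+ 4 * Z j.+1) <= q * X j.+1.
    rewrite (_ : s * _ = q * ((2 * q ^+ 6) * Z j.+1)); last by rewrite /s; ring.
    rewrite q6 (_ : 2 * (1 / 2) = 1 :> R); last by field.
    by rewrite mul1r ler_wpM2l.
  have := @potential_step R s (u j) (q * X j.+1) (q ^+ 4 * Z j.+1) (L j) (N j)
            senc (u0 j) (mulr_ge0 (exprn_ge0 4 q00) Z0) N0 sY LN.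
  rewrite -(potential_rescale q) // -Xj -Zj.
  rewrite /L pastS -/L /M past_linS -/L -/M /N pastS -/N.
  rewrite /chain_density -/(X j.+1) -/(Z j.+1) -/(L j) -/(M j) -/(N j).
  rewrite Xj /density; move: (potential _ _ _ _) (potential _ _ _ _).
  move: (u j) (X j.+1) (Z j.+1) (L j) (M j) (N j) => v x z l m k p1 p2 H.
  nra.
(* At index 0 the past is empty and only 43/100 X^3 survives; at index n the future is empty and
   everything vanishes. The telescoped sum is therefore nonnegative. *)
have full0 : 0 <= full 0%N.
  have X0 : 0 <= X 0%N ^+ 3 by rewrite exprn_ge0//; exact: future_ge0.
  rewrite /full /L /M /N !past0 /potential; move: X0.
  by clear; nra.
have fulln : full n = 0.
  rewrite /full /X /Z /future !big_geq// /potential.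
  by rewrite !expr0n/= !(mul0r, mulr0) !(addr0, subr0).
rewrite -subr_ge0 mulr_sumr -sumrB.
apply: le_trans (ler_sum_nat _); last by move=> j /andP[_ jn]; exact: step.
under eq_bigr do rewrite -opprB.
by rewrite sumrN telescope_sumr// fulln sub0r opprK.
Qed.

(** * Power sums and the kernel remainder *)

Section root_sums.
Context {R : rcfType}.

Definition rt (n : nat) : R := Num.sqrt n%:R.

Lemma rt_sqr n : rt n ^+ 2 = n%:R. Proof. by rewrite sqr_sqrtr. Qed.
Lemma rt_ge0 n : 0 <= rt n. Proof. exact: sqrtr_ge0. Qed.
Lemma rt_gt0 n : (0 < n)%N -> 0 < rt n. Proof. by rewrite sqrtr_gt0 ltr0n. Qed.
Lemma rt0 : rt 0 = 0. Proof. exact: sqrtr0. Qed.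
Lemma rtM a b : rt (a * b) = rt a * rt b. Proof. by rewrite /rt natrM sqrtrM. Qed.
Lemma rt1 : rt 1 = 1. Proof. exact: sqrtr1. Qed.
Lemma ler_rt m n : (m <= n)%N -> rt m <= rt n.
Proof. by move=> mn; rewrite ler_wsqrtr// ler_nat. Qed.
Lemma rt_ge1 n : (0 < n)%N -> 1 <= rt n.
Proof. by move=> n0; rewrite -rt1 ler_rt. Qed.
Lemma rtS_gt0 n : 0 < rt n.+1. Proof. exact: rt_gt0. Qed.
Lemma rtS n : rt n.+1 ^+ 2 = rt n ^+ 2 + 1.
Proof. by rewrite !rt_sqr -natr1. Qed.

(** With x and y the roots of consecutive integers, y - x = 1 / (x + y) lies between 1 / (2 y) and 1
    / (2 x). Most step lemmas below rest on this; they compare a power of an integer with an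
    increment of its antiderivative, in place of integrals. *)
Lemma root_step (x y : R) : 0 <= x -> 0 < y -> y ^+ 2 = x ^+ 2 + 1 ->
  [/\ x <= y, (y - x) * (y + x) = 1, 2 * (y - x) * x <= 1 & 1 <= 2 * (y - x) * y].
Proof.
move=> x0 y0 xy.
have h : (y - x) * (y + x) = 1 by rewrite -subr_sqr xy addrAC subrr add0r.
split=> //.
- suff : x ^+ 2 <= y ^+ 2 by rewrite ler_pXn2r ?nnegrE ?(ltW y0).
  by rewrite xy lerDl.
- by have := sqr_ge0 (y - x); lra.
- by have := sqr_ge0 (y - x); lra.
Qed.

Lemma stepV_ge (x y : R) : 0 < x -> 0 < y -> y ^+ 2 = x ^+ 2 + 1 ->
  2 * (y - x) <= x^-1.
Proof.
by move=> x0 y0 xy; have [_ _ h _] := root_step x y (ltW x0) y0 xy;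
  rewrite -div1r ler_pdivlMr.
Qed.

Lemma stepV_le (x y : R) : 0 <= x -> 0 < y -> y ^+ 2 = x ^+ 2 + 1 ->
  y^-1 <= 2 * (y - x).
Proof.
by move=> x0 y0 xy; have [_ _ _ h] := root_step x y x0 y0 xy;
  rewrite -div1r ler_pdivrMr.
Qed.

Lemma stepV3_ge (x y : R) : 0 < x -> 0 < y -> y ^+ 2 = x ^+ 2 + 1 ->
  2 / x - 2 / y <= x ^- 3.
Proof.
move=> x0 y0 xy; have [xy' _ h _] := root_step x y (ltW x0) y0 xy.
rewrite -subr_ge0 (_ : _ - _ = (x * (1 - 2 * (y - x) * x) + (y - x)) / (x ^+ 3 * y)).
  apply: divr_ge0; last by rewrite mulr_ge0 ?exprn_ge0 ?(ltW x0) ?(ltW y0).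
  by apply: addr_ge0; rewrite ?mulr_ge0 ?subr_ge0 ?(ltW x0) ?(ltW y0).
by field; rewrite !gt_eqF.
Qed.

Lemma stepV3_le (x y : R) : 0 < x -> 0 < y -> y ^+ 2 = x ^+ 2 + 1 ->
  y ^- 3 <= 2 / x - 2 / y.
Proof.
move=> x0 y0 xy; have [xy' _ _ h] := root_step x y (ltW x0) y0 xy.
rewrite -subr_ge0 (_ : _ - _ = (y * (2 * (y - x) * y - 1) + (y - x)) / (y ^+ 3 * x)).
  apply: divr_ge0; last by rewrite mulr_ge0 ?exprn_ge0 ?(ltW x0) ?(ltW y0).
  by apply: addr_ge0; rewrite ?mulr_ge0 ?subr_ge0 ?(ltW x0) ?(ltW y0).
by field; rewrite !gt_eqF.
Qed.

Lemma stepV4_le (x y : R) : 0 < x -> 0 < y -> y ^+ 2 = x ^+ 2 + 1 ->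
  y ^- 4 <= x ^- 2 - y ^- 2.
Proof.
move=> x0 y0 xy.
rewrite -subr_ge0 (_ : _ - _ = (y ^+ 2 * (y ^+ 2 - x ^+ 2) - x ^+ 2) / (x ^+ 2 * y ^+ 4)).
  rewrite divr_ge0 ?mulr_ge0 ?exprn_ge0 ?(ltW x0) ?(ltW y0)//.
  by rewrite xy; lra.
by field; rewrite !gt_eqF.
Qed.

Lemma stepV5_ge (x y : R) : 0 < x -> 0 < y -> y ^+ 2 = x ^+ 2 + 1 ->
  2 / 3 * (x ^- 3 - y ^- 3) <= x ^- 5.
Proof.
move=> x0 y0 xy; have [xy' _ h _] := root_step x y (ltW x0) y0 xy.
rewrite -subr_ge0 (_ : _ - _ =
  (y ^+ 2 * x * (1 - 2 * (y - x) * x) + 2 / 3 * (y - x) ^+ 2 * (2 * y + x) * x ^+ 2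
   + y ^+ 2 * (y - x)) / (x ^+ 5 * y ^+ 3)); last by field; rewrite !gt_eqF.
have yx : 0 <= y - x by rewrite subr_ge0.
have P0 : 0 <= 2 * y + x by rewrite addr_ge0 ?mulr_ge0 ?(ltW x0) ?(ltW y0).
apply: divr_ge0; last by rewrite mulr_ge0 ?exprn_ge0 ?(ltW x0) ?(ltW y0).
have k0 : 0 <= 1 - 2 * (y - x) * x by rewrite subr_ge0.
by rewrite !addr_ge0 ?mulr_ge0 ?exprn_ge0 ?(ltW x0) ?(ltW y0) ?invr_ge0.
Qed.

Lemma step_root (x y : R) : 0 <= x -> 0 < y -> y ^+ 2 = x ^+ 2 + 1 ->
  x <= 2 / 3 * (y ^+ 3 - x ^+ 3).
Proof.
move=> x0 y0 xy; have [xy' h _ _] := root_step x y x0 y0 xy.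
rewrite -subr_ge0 (_ : _ - _ = x * ((y - x) * (y + x) - 1)
  + (y - x) ^+ 2 * (2 * y + x) / 3); last by field.
have P0 : 0 <= 2 * y + x by rewrite addr_ge0 ?mulr_ge0 ?x0 ?(ltW y0).
by rewrite h subrr mulr0 add0r divr_ge0 ?mulr_ge0 ?exprn_ge0 ?subr_ge0.
Qed.

Lemma sum_telescope_le (f g : nat -> R) m k : (m <= k)%N ->
  (forall b, (m <= b < k)%N -> f b <= g b.+1 - g b) ->
  \sum_(m <= b < k) f b <= g k - g m.
Proof. by move=> mk fg; rewrite -telescope_sumr//; exact: ler_sum_nat. Qed.

Lemma sum_telescope_ge (f g : nat -> R) m k : (m <= k)%N ->
  (forall b, (m <= b < k)%N -> g b.+1 - g b <= f b) ->
  g k - g m <= \sum_(m <= b < k) f b.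
Proof. by move=> mk fg; rewrite -telescope_sumr//; exact: ler_sum_nat. Qed.

Lemma sum_rtV_le m k : (m <= k)%N ->
  \sum_(m.+1 <= b < k.+1) (rt b)^-1 <= 2 * rt k - 2 * rt m.
Proof.
move=> mk; rewrite big_add1; apply: (sum_telescope_le (fun b => (rt b.+1)^-1)
  (fun b => 2 * rt b)) => // b _.
by rewrite -mulrBr; apply: stepV_le; rewrite ?rt_ge0 ?rtS_gt0// rtS.
Qed.

Lemma sum_rtV_ge k : 2 * rt k - 2 <= \sum_(1 <= b < k.+1) (rt b)^-1.
Proof.
apply: (@le_trans _ _ (2 * rt k.+1 - 2 * rt 1)).
  by have := ler_rt _ _ (leqnSn k); rewrite rt1; lra.
apply: (sum_telescope_ge (fun b => (rt b)^-1) (fun b => 2 * rt b)) => // b /andP[b1 _].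
by rewrite -mulrBr; apply: stepV_ge; rewrite ?rt_gt0// rtS.
Qed.

Lemma sum_rtV3_le k : \sum_(1 <= b < k.+1) (rt b) ^- 3 <= 3.
Proof.
case: k => [|k]; first by rewrite big_geq.
rewrite big_ltn// rt1 expr1n invr1 big_add1/=.
have : \sum_(1 <= b < k.+1) rt b.+1 ^- 3 <= - (2 / rt k.+1) - - (2 / rt 1).
  apply: (sum_telescope_le (fun b => rt b.+1 ^- 3) (fun b => - (2 / rt b))) => // b /andP[b1 _].
  by rewrite opprK addrC; apply: stepV3_le; rewrite ?rt_gt0// rtS.
have : 0 <= 2 / rt k.+1 by rewrite divr_ge0 ?rt_ge0.
by rewrite rt1; lra.
Qed.

Lemma sum_rtV3_ge m k : (m <= k)%N ->
  2 / rt m.+1 - 2 / rt k.+1 <= \sum_(m.+1 <= b < k.+1) (rt b) ^- 3.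
Proof.
move=> mk; rewrite -[X in X - _]opprK addrC.
apply: (sum_telescope_ge (fun b => rt b ^- 3) (fun b => - (2 / rt b))) => // b /andP[b1 _].
have b0 : (0 < b)%N by apply: leq_trans b1.
by rewrite opprK addrC; apply: stepV3_ge; rewrite ?rt_gt0// rtS.
Qed.

(** Trades the endpoints m + 1 and k + 1 for m and k, at the cost of m^(-3/2), so that later bounds
    are rational in [rt m] and [rt k] alone. *)
Lemma sum_rtV3_ge' m k : (0 < m)%N -> (m <= k)%N ->
  2 / rt m - rt m ^- 3 - 2 / rt k <= \sum_(m.+1 <= b < k.+1) (rt b) ^- 3.
Proof.
move=> m0 mk; apply: le_trans (sum_rtV3_ge _ _ mk).
have := stepV3_ge (rt m) (rt m.+1) (rt_gt0 _ m0) (rtS_gt0 _) (rtS _).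
have : (rt k.+1)^-1 <= (rt k)^-1.
  by rewrite lef_pV2 ?posrE ?rt_gt0 ?ler_rt// (leq_trans m0).
lra.
Qed.

Lemma sum_rtV4_le m k : (0 < m)%N -> (m <= k)%N ->
  \sum_(m.+1 <= b < k.+1) (rt b) ^- 4 <= rt m ^- 2 - rt k ^- 2.
Proof.
move=> m0 mk; rewrite big_add1 addrC -[X in _ + X]opprK.
apply: (sum_telescope_le (fun b => rt b.+1 ^- 4) (fun b => - rt b ^- 2)) => // b /andP[mb _].
have b0 : (0 < b)%N by apply: leq_trans mb.
by rewrite opprK addrC; apply: stepV4_le; rewrite ?rt_gt0// rtS.
Qed.

Lemma sum_rtV5_ge m k : (0 < m)%N -> (m <= k)%N ->
  2 / 3 * (rt m ^- 3 - rt k ^- 3) - rt m ^- 5 <= \sum_(m.+1 <= b < k.+1) (rt b) ^- 5.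
Proof.
move=> m0 mk.
have h1 := stepV5_ge (rt m) (rt m.+1) (rt_gt0 _ m0) (rtS_gt0 _) (rtS _).
have h2 : rt k.+1 ^- 3 <= rt k ^- 3.
  have k0 : (0 < k)%N by exact: leq_trans mk.
  have r : rt k <= rt k.+1 by exact: ler_rt.
  by rewrite lef_pV2 ?posrE ?exprn_gt0 ?rt_gt0// lerXn2r ?nnegrE ?rt_ge0.
have : - (2 / 3 * rt k.+1 ^- 3) - - (2 / 3 * rt m.+1 ^- 3)
    <= \sum_(m.+1 <= b < k.+1) (rt b) ^- 5.
  apply: (sum_telescope_ge (fun b => rt b ^- 5) (fun b => - (2 / 3 * rt b ^- 3))) => // b /andP[mb _].
  have b0 : (0 < b)%N by apply: leq_trans mb.
  by rewrite opprK addrC -mulrBr; apply: stepV5_ge; rewrite ?rt_gt0// rtS.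
by move: h1 h2; clear; lra.
Qed.

Lemma sum_rt_le m : \sum_(1 <= a < m.+1) rt a <= 2 / 3 * rt m ^+ 3 + rt m.
Proof.
elim: m => [|m IH]; first by rewrite /rt sqrtr0 expr0n mulr0 addr0 big_geq.
rewrite big_nat_recr//=.
have := step_root (rt m) (rt m.+1) (rt_ge0 _) (rtS_gt0 _) (rtS _).
by move: IH; lra.
Qed.

Lemma sum_nat_ge m : 1 / 2 * rt m ^+ 4 <= \sum_(1 <= a < m.+1) rt a ^+ 2.
Proof.
elim: m => [|m IH]; first by rewrite /rt sqrtr0 expr0n mulr0 big_geq.
rewrite big_nat_recr//=; move: IH; rewrite (exprM (rt m) 2 2) (exprM (rt m.+1) 2 2) !rtS.
have : 0 <= rt m ^+ 2 by rewrite exprn_ge0 ?rt_ge0.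
by move: (rt m ^+ 2) (\sum_(_ <= _ < _) _) => x y; nra.
Qed.
End root_sums.

(** * Two-sided bounds for the kernel remainder *)

Section kernel_bounds.
Context {R : realFieldType}.
Implicit Types al be ga : R.

(* What remains of the squared inequality behind [rest_le] after division by z^4. *)
Lemma profile_poly_ge0 (z : R) : 0 <= z <= 1 ->
  0 <= 14 / 100 - 644 / 1000 * z + 1085 / 1000 * z ^+ 2 - 966 / 1000 * z ^+ 3
    + 838 / 1000 * z ^+ 4 - 931 / 1000 * z ^+ 5 + 996 / 1000 * z ^+ 6
    - 609 / 1000 * z ^+ 7 + 103 / 1000 * z ^+ 8.
Proof.
move=> /andP[z0 z1].
(* Positivity certificate on [0, 1]: squares, and z (1 - z) times squares. *)
have Q1 := sqr_ge0 (z - 356 / 1000 - 679 / 1000 * z ^+ 2 + 132 / 1000 * z ^+ 3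
                    - 115 / 1000 * z ^+ 4).
have Q2 := sqr_ge0 (z ^+ 3 + 25 / 1000 - 464 / 1000 * z ^+ 2 - 561 / 1000 * z ^+ 4).
have Q3 := sqr_ge0 (z ^+ 2 - 23 / 100 - 794 / 1000 * z ^+ 4).
have Q4 := sqr_ge0 (z ^+ 4 - 92 / 1000).
have zz : 0 <= z * (1 - z) by rewrite mulr_ge0// subr_ge0.
have Q5 := mulr_ge0 zz (sqr_ge0 (z ^+ 3 + 58 / 1000 - 321 / 1000 * z - 16 / 100 * z ^+ 2)).
have Q6 := mulr_ge0 zz (sqr_ge0 (z ^+ 2 - 71 / 1000 - 42 / 100 * z)).
have Q7 := mulr_ge0 zz (sqr_ge0 (z - 55 / 100)).
have zn n : 0 <= z ^+ n <= 1 by rewrite exprn_ge0//= exprn_ile1.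
have := (zn 2%N, zn 3%N, zn 4%N, zn 5%N, zn 6%N, zn 7%N, zn 8%N).
move=> [[[[[[z2 z3] z4] z5] z6] z7] z8].
move: z0 z1 Q1 Q2 Q3 Q4 Q5 Q6 Q7 z2 z3 z4 z5 z6 z7 z8; clear; lra.
Qed.

(* The kernel minus its two edge singularities, in the square roots of a, b, a + b. *)
Definition rest al be ga : R :=
  (al ^+ 4 + al ^+ 2 * be ^+ 2 + be ^+ 4) / (al ^+ 3 * be ^+ 3 * ga)
  - al ^- 3 - be ^- 3.

(** Both a^4 + a^2 b^2 + b^4 and a^3 + b^3 (for the roots) contain the factor c^2 - a b. The
    cofactor c^2 + a b - (a + b) c is multiplied by its conjugate, and c^2 = a^2 + b^2 turns the
    product into (a b)^2. The edge singularities are gone and positivity is visible. *)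
Lemma restE al be ga : 0 < al -> 0 < be -> 0 < ga ->
  ga ^+ 2 = al ^+ 2 + be ^+ 2 ->
  rest al be ga = (ga ^+ 2 - al * be)
    / (al * be * ga * (ga ^+ 2 + al * be + (al + be) * ga)).
Proof.
move=> a0 b0 c0 cE.
have D0 : 0 < ga ^+ 2 + al * be + (al + be) * ga by nra.
have -> : rest al be ga = (ga ^+ 2 - al * be) * (ga ^+ 2 + al * be - (al + be) * ga)
    / ((al * be) ^+ 3 * ga).
  by rewrite /rest cE; field; rewrite !gt_eqF.
have -> : ga ^+ 2 + al * be - (al + be) * ga
    = (al * be) ^+ 2 / (ga ^+ 2 + al * be + (al + be) * ga).
  apply: (@mulIf _ (ga ^+ 2 + al * be + (al + be) * ga)); first by rewrite gt_eqF.
  rewrite divfK ?gt_eqF//.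
  transitivity ((ga ^+ 2 + al * be) ^+ 2 - (al + be) ^+ 2 * ga ^+ 2); first by ring.
  by rewrite cE; ring.
by field; rewrite !gt_eqF.
Qed.

(** The extremal case is [al] = [be], with ratio 6 - 4 sqrt 2 = 0.34314...; both inequalities used,
    2 a b <= c^2 and a + b <= sqrt 2 c, are equalities there. *)
Lemma rest_ge al be ga : 0 < al -> 0 < be -> 0 < ga ->
  ga ^+ 2 = al ^+ 2 + be ^+ 2 -> 343 / 1000 * ga ^- 3 <= rest al be ga.
Proof.
move=> a0 b0 c0 cE; rewrite restE//.
have D0 : 0 < ga ^+ 2 + al * be + (al + be) * ga by nra.
rewrite ler_pdivlMr ?mulr_gt0//.
have P1 : 2 * (al * be) <= ga ^+ 2 by rewrite cE; have := sqr_ge0 (al - be); lra.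
have s1 : al + be <= 1415 / 1000 * ga.
  rewrite leNgt; apply/negP => h; have d2 := sqr_ge0 (al - be).
  have : (1415 / 1000 * ga) * (1415 / 1000 * ga) < (al + be) * (al + be).
    have c0' := ltW c0; have k0 : 0 <= 1415 / 1000 * ga by lra.
    exact: ltr_pM.
  have : 0 < ga ^+ 2 by rewrite exprn_gt0.
  by move: d2; rewrite !expr2 in cE *; clear -cE; lra.
rewrite (_ : 343 / 1000 * _ * _ = (343 / 1000 * (al * be) * (ga ^+ 2 + al * be + (al + be) * ga)) / ga ^+ 2); last by field; rewrite gt_eqF.
rewrite ler_pdivrMr ?exprn_gt0//.
have g0 : 0 < ga ^+ 2 by rewrite exprn_gt0.
have P0 : 0 < al * be by rewrite mulr_gt0.
have : (al + be) * ga <= 1415 / 1000 * ga ^+ 2 by rewrite expr2 mulrA ler_wpM2r// ltW.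
move: P1 g0 P0; move: (ga ^+ 2) (al * be) ((al + be) * ga) => G P T.
by clear; nra.
Qed.

(** With z = [al / be] the claim reads (1 + z^2 + z^4) / sqrt (1 + z^2) <= t(z). The terms 1 + z^2 /
    2 of t are the Taylor expansion; the z^4 and z^5 coefficients are fitted to be nearly tight up
    to z = 1. *)
Lemma rest_le al be ga : 0 < al -> al <= be -> 0 < ga ->
  ga ^+ 2 = al ^+ 2 + be ^+ 2 ->
  rest al be ga <= 1 / 2 * al^-1 / be ^+ 2 - be ^- 3
    + 945 / 1000 * al / be ^+ 4 - 322 / 1000 * al ^+ 2 / be ^+ 5.
Proof.
move=> a0 ab c0 cE.
have b0 : 0 < be by exact: lt_le_trans ab.
pose z := al / be; pose g := ga / be.
have z0 : 0 < z by rewrite divr_gt0.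
have z1 : z <= 1 by rewrite ler_pdivrMr// mul1r.
have g0 : 0 < g by rewrite divr_gt0.
have gE : g ^+ 2 = 1 + z ^+ 2.
  by rewrite !expr_div_n cE mulrDl divff ?gt_eqF ?exprn_gt0// addrC.
have zE : al = z * be by rewrite divfK// gt_eqF.
have gaE : ga = g * be by rewrite divfK// gt_eqF.
clearbody z g; rewrite /rest zE gaE.
pose t := 1 + 1 / 2 * z ^+ 2 + 945 / 1000 * z ^+ 4 - 322 / 1000 * z ^+ 5.
have t0 : 0 <= t.
  have : z ^+ 5 <= z ^+ 4 by rewrite exprS ler_piMl// exprn_ge0// ltW.
  have : 0 <= z ^+ 4 by rewrite exprn_ge0 ?ltW.
  have : 0 <= z ^+ 2 by rewrite exprn_ge0 ?ltW.
  by rewrite /t; clear; lra.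
have key : 1 + z ^+ 2 + z ^+ 4 <= g * t.
  have zn n : 0 <= z ^+ n by rewrite exprn_ge0 ?ltW.
  have q0 : 0 <= 1 + z ^+ 2 + z ^+ 4 by rewrite !addr_ge0.
  have gt0 := mulr_ge0 (ltW g0) t0.
  suff : (1 + z ^+ 2 + z ^+ 4) ^+ 2 <= (g * t) ^+ 2 by rewrite ler_pXn2r.
  rewrite exprMn gE -subr_ge0.
  have z01 : 0 <= z <= 1 by rewrite ltW.
  have := mulr_ge0 (exprn_ge0 4 (ltW z0)) (profile_poly_ge0 _ z01).
  (* The coefficients in [profile_poly_ge0] are rounded down to three decimals; after the factor z^4
     the rounding errors sit at z^8 to z^12. *)
  have := (zn 8%N, zn 9%N, zn 10%N, zn 11%N, zn 12%N) => -[[[[h8 h9] h10] h11] h12].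
  rewrite /t; move: h8 h9 h10 h11 h12; clear; lra.
rewrite -subr_ge0 (_ : _ - _ = (g * t - (1 + z ^+ 2 + z ^+ 4)) / (z ^+ 3 * g * be ^+ 3)).
  rewrite divr_ge0 ?subr_ge0// ltW// !mulr_gt0 ?exprn_gt0//.
by rewrite /t; field; rewrite !gt_eqF.
Qed.

End kernel_bounds.

(** * Row, box and corner sums of the remainder *)

Section remainder.
Context {R : rcfType}.
Local Notation rt := (@rt R).

Definition res (a b : nat) : R := rest (rt a) (rt b) (rt (a + b)).

Lemma rtD a b : rt (a + b) ^+ 2 = rt a ^+ 2 + rt b ^+ 2.
Proof. by rewrite !rt_sqr natrD. Qed.

Lemma res_ge a b : (0 < a)%N -> (0 < b)%N ->
  343 / 1000 * rt (a + b) ^- 3 <= res a b.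
Proof. by move=> a0 b0; apply: rest_ge; rewrite ?rt_gt0 ?addn_gt0 ?a0// rtD. Qed.

Lemma res_ge0 a b : (0 < a)%N -> (0 < b)%N -> 0 <= res a b.
Proof.
move=> a0 b0; apply: le_trans (res_ge a b a0 b0).
by rewrite mulr_ge0 ?divr_ge0 ?ler0n ?invr_ge0 ?exprn_ge0 ?rt_ge0.
Qed.

Lemma resC a b : res a b = res b a.
Proof.
rewrite /res /rest [(b + a)%N]addnC addrAC; congr (_ / _ - _ - _); ring.
Qed.

Lemma res_le a b : (0 < a)%N -> (a <= b)%N ->
  res a b <= 1 / 2 / rt b ^+ 2 * (rt a)^-1 - rt b ^- 3
    + 945 / 1000 / rt b ^+ 4 * rt a - 322 / 1000 / rt b ^+ 5 * rt a ^+ 2.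
Proof.
move=> a0 ab; have b0 : (0 < b)%N by exact: leq_trans ab.
apply: le_trans (rest_le _ _ _ _ _ _ _) _; rewrite ?rt_gt0 ?addn_gt0 ?a0 ?ler_rt ?rtD//.
by rewrite le_eqVlt; apply/orP; left; apply/eqP; field; rewrite !gt_eqF ?rt_gt0.
Qed.

(** [res_le] summed over a. The leading term sqrt m / b is the one whose sum over b is harmonic and
    produces the logarithm. *)
Lemma row_le m b : (0 < m)%N -> (m <= b)%N ->
  \sum_(1 <= a < m.+1) res a b <=
    rt m / rt b ^+ 2 - rt m ^+ 2 / rt b ^+ 3 + 63 / 100 * rt m ^+ 3 / rt b ^+ 4
    - 161 / 1000 * rt m ^+ 4 / rt b ^+ 5 + 945 / 1000 * rt m / rt b ^+ 4.
Proof.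
move=> m0 mb; have b0 : 0 < rt b by rewrite rt_gt0// (leq_trans m0).
apply: (@le_trans _ _ (\sum_(1 <= a < m.+1) (1 / 2 / rt b ^+ 2 * (rt a)^-1 - rt b ^- 3
    + 945 / 1000 / rt b ^+ 4 * rt a - 322 / 1000 / rt b ^+ 5 * rt a ^+ 2))).
  apply: ler_sum_nat => a /andP[a1 am]; apply: res_le => //.
  by apply: leq_trans mb.
rewrite sumrB big_split/= sumrB -!mulr_sumr sumr_const_nat subn1/= -(mulr_natr (rt b ^- 3) m) -(rt_sqr m).
have V := @sum_rtV_le R 0 m (leq0n _).
have W := @sum_rt_le R m.
have X := @sum_nat_ge R m.
have k2 : 0 <= 1 / 2 / rt b ^+ 2 by rewrite !divr_ge0 ?exprn_ge0 ?(ltW b0).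
have k4 : 0 <= 945 / 1000 / rt b ^+ 4 by rewrite !divr_ge0 ?exprn_ge0 ?(ltW b0) ?ler0n.
have k5 : 0 <= 322 / 1000 / rt b ^+ 5 by rewrite !divr_ge0 ?exprn_ge0 ?(ltW b0) ?ler0n.
have := lerB (lerD (ler_wpM2l k2 V) (ler_wpM2l k4 W)) (ler_wpM2l k5 X).
rewrite rt0.
rewrite mulr0 subr0; move=> H.
rewrite -subr_ge0; move: H; rewrite -subr_ge0.
set SV := \sum_(_ <= _ < _) (rt _)^-1; set SW := \sum_(_ <= _ < _) rt _.
set SX := \sum_(_ <= _ < _) rt _ ^+ 2 => H.
apply: le_trans H _; rewrite le_eqVlt; apply/orP; left; apply/eqP.
by field; rewrite gt_eqF.
Qed.

Definition box_sum I J : R :=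
  \sum_(1 <= b < J.+1) \sum_(1 <= a < I.+1) res a b.

(** Each enlargement adds a row and a column, equal by symmetry; counting their common entry twice
    only increases the bound. At b = m the row bound has leading coefficient 1 - 1 + 63/100 -
    161/1000 = 469/1000, and 1876/1000 is four times that. *)
Lemma box_sum_diag I : (0 < I)%N ->
  box_sum I I <= 1876 / 1000 * rt I + 567 / 100.
Proof.
move=> I0.
have step n : box_sum n.+1 n.+1 <= box_sum n n + 2 * \sum_(1 <= a < n.+2) res a n.+1.
  rewrite /box_sum big_nat_recr//= addrC.
  have -> : \sum_(1 <= b < n.+1) \sum_(1 <= a < n.+2) res a b
      = box_sum n n + \sum_(1 <= a < n.+1) res a n.+1.
    rewrite /box_sum -big_split/=; apply: eq_bigr => b _.
    by rewrite big_nat_recr//= resC.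
  rewrite [X in _ <= _ + 2 * X]big_nat_recr//= [X in X + _ <= _]big_nat_recr//=.
  have := res_ge0 n.+1 n.+1 isT isT.
  by rewrite /box_sum; lra.
have h : box_sum I I <= 2 * \sum_(1 <= b < I.+1) (469 / 1000 / rt b + 945 / 1000 * rt b ^- 3).
  elim: I {I0} => [|n IH]; first by rewrite /box_sum !big_geq// mulr0.
  apply: le_trans (step n) _; rewrite [X in _ <= 2 * X]big_nat_recr//= [X in _ <= X]mulrDr; apply: lerD => //.
  rewrite ler_wpM2l//; apply: le_trans (row_le n.+1 n.+1 _ _) _ => //.
  rewrite le_eqVlt; apply/orP; left; apply/eqP; field.
  by rewrite gt_eqF ?rtS_gt0.
apply: le_trans h _; rewrite big_split/= -!mulr_sumr.
have := @sum_rtV_le R 0 I (leq0n _).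
rewrite rt0.
by have := @sum_rtV3_le R I; lra.
Qed.

(** Rows up to I are the diagonal box; later rows use [row_le]. The sum of 1/b stays unevaluated, to
    become the logarithm later. The constant is 1876/1000 - 2 + 63/100 - (2/3) 161/1000 =
    598/1500. *)
Lemma box_sum_le I J : (0 < I)%N -> (I <= J)%N ->
  box_sum I J <= rt I * (598 / 1500 + \sum_(I.+1 <= b < J.+1) rt b ^- 2
    + 2 * (rt I / rt J) - 63 / 100 * (rt I / rt J) ^+ 2
    + 161 / 1500 * (rt I / rt J) ^+ 3) + 8.
Proof.
move=> I0 IJ; have J0 : (0 < J)%N by exact: leq_trans IJ.
rewrite /box_sum (@big_cat_nat _ _ _ I.+1)//=.
have D := box_sum_diag I I0; rewrite /box_sum in D.
have x0 := @rt_gt0 R I I0; have y0 := @rt_gt0 R J J0.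
have x1 := @rt_ge1 R I I0.
have E : \sum_(I.+1 <= b < J.+1) \sum_(1 <= a < I.+1) res a b <=
  rt I * \sum_(I.+1 <= b < J.+1) rt b ^- 2
  - rt I ^+ 2 * \sum_(I.+1 <= b < J.+1) rt b ^- 3
  + 63 / 100 * rt I ^+ 3 * \sum_(I.+1 <= b < J.+1) rt b ^- 4
  - 161 / 1000 * rt I ^+ 4 * \sum_(I.+1 <= b < J.+1) rt b ^- 5
  + 945 / 1000 * rt I * \sum_(I.+1 <= b < J.+1) rt b ^- 4.
  rewrite !mulr_sumr -!sumrB -!big_split/= -!sumrB -!big_split/=.
  by apply: ler_sum_nat => b /andP[Ib _]; apply: row_le => //; exact: ltnW.
have V3 := @sum_rtV3_ge' R I J I0 IJ.
have V4 := @sum_rtV4_le R I J I0 IJ.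
have V5 := @sum_rtV5_ge R I J I0 IJ.
have k1 : 0 <= rt I ^+ 2 by rewrite exprn_ge0 ?(ltW x0).
have k2 : 0 <= 63 / 100 * rt I ^+ 3 by rewrite mulr_ge0 ?divr_ge0 ?exprn_ge0 ?(ltW x0) ?ler0n.
have k3 : 0 <= 161 / 1000 * rt I ^+ 4 by rewrite mulr_ge0 ?divr_ge0 ?exprn_ge0 ?(ltW x0) ?ler0n.
have k4 : 0 <= 945 / 1000 * rt I by rewrite mulr_ge0 ?divr_ge0 ?(ltW x0) ?ler0n.
have := lerD (lerB (lerD (lerB (lexx (rt I * \sum_(I.+1 <= b < J.+1) rt b ^- 2))
  (ler_wpM2l k1 V3)) (ler_wpM2l k2 V4)) (ler_wpM2l k3 V5)) (ler_wpM2l k4 V4).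
move=> /(le_trans E)/(lerD D) H.
apply: le_trans H _; rewrite -subr_ge0.
set S2 := \sum_(_ <= _ < _) _.
have xV : (rt I)^-1 <= 1 by rewrite invf_le1.
have k5 : 0 <= 945 / 1000 * rt I / rt J ^+ 2.
  by rewrite divr_ge0 ?exprn_ge0 ?(ltW y0).
rewrite (_ : _ - _ = 233 / 100 - (1 + 161 / 1000 + 945 / 1000) * (rt I)^-1
  + 945 / 1000 * rt I / rt J ^+ 2); last by field; rewrite !gt_eqF.
by move: xV k5; clear; lra.
Qed.

Definition corner_sum I : R :=
  \sum_(1 <= b < I.+1) \sum_((I - b).+1 <= a < I.+1) res a b.

(** Summing 343/1000 (a + b)^(-3/2) over the corner gives about 343/1000 (6 - 4 sqrt 2) sqrt I; with
    99/70 for sqrt 2 the factor is exactly 147/1250. *)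
Lemma corner_sum_ge I : (0 < I)%N -> 147 / 1250 * rt I - 3 <= corner_sum I.
Proof.
move=> I0; have x0 := @rt_gt0 R I I0; have y0 := @rtS_gt0 R I.
have row b : (1 <= b < I.+1)%N ->
    343 / 1000 * (2 / rt I.+1 - 2 / rt (I + b).+1) <=
    \sum_((I - b).+1 <= a < I.+1) res a b.
  move=> /andP[b0 bI].
  apply: (@le_trans _ _ (\sum_((I - b).+1 <= a < I.+1) 343 / 1000 * rt (a + b) ^- 3)).
    rewrite -mulr_sumr ler_wpM2l ?divr_ge0 ?ler0n//.
    have -> : 2 / rt I.+1 - 2 / rt (I + b).+1
      = - (2 / rt (I.+1 + b)) - - (2 / rt ((I - b).+1 + b)).
      by rewrite opprK addrC !addSn subnK.
    apply: (@sum_telescope_ge R (fun a => rt (a + b) ^- 3) (fun a => - (2 / rt (a + b)))).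
      by rewrite ltnS leq_subr.
    move=> a _; rewrite opprK addrC addSn.
    by apply: stepV3_ge; rewrite ?rt_gt0 ?addn_gt0 ?b0 ?orbT// rtS.
  apply: ler_sum_nat => a /andP[a1 aI]; apply: res_ge => //.
  exact: leq_trans a1.
apply: le_trans (ler_sum_nat row).
rewrite -mulr_sumr sumrB sumr_const_nat subn1/= -(mulr_natr (2 / rt I.+1) I) -(rt_sqr I).
have h : \sum_(1 <= b < I.+1) 2 / rt (I + b).+1 <= 4 * rt (I + I).+1 - 4 * rt I.+1.
  rewrite (_ : 4 * rt I.+1 = 4 * rt (I + 0).+1); last by rewrite addn0.
  rewrite big_add1/=.
  apply: (@sum_telescope_le R (fun b => 2 / rt (I + b.+1).+1) (fun b => 4 * rt (I + b).+1)) => // b _.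
  have := @stepV_le R (rt (I + b).+1) (rt (I + b.+1).+1) (rt_ge0 _) (rtS_gt0 _).
  by rewrite addnS rtS => /(_ erefl); lra.
have a1 : rt I.+1 <= rt I + 1.
  have : rt I.+1 ^+ 2 <= (rt I + 1) ^+ 2 by rewrite rtS; nra.
  by rewrite ler_pXn2r ?nnegrE ?addr_ge0 ?rt_ge0.
have a2 : rt (I + I).+1 <= 99 / 70 * rt I + 1.
  have q0 : 0 <= 99 / 70 * rt I by rewrite mulr_ge0 ?divr_ge0 ?rt_ge0 ?ler0n.
  have : rt (I + I).+1 ^+ 2 <= (99 / 70 * rt I + 1) ^+ 2.
    by rewrite rtS rtD; have := sqr_ge0 (rt I); move: (rt I) q0 => x; clear; nra.
  by rewrite ler_pXn2r ?nnegrE ?addr_ge0 ?rt_ge0 ?q0.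
have a3 : rt I - 1 <= rt I ^+ 2 / rt I.+1.
  have x1 : 0 <= rt I - 1 by rewrite subr_ge0 rt_ge1.
  have x2 : 0 <= rt I + 1 - rt I.+1 by rewrite subr_ge0.
  by rewrite ler_pdivlMr//; have := mulr_ge0 x1 x2; lra.
have a4 : rt I <= rt I.+1 by rewrite ler_rt.
rewrite (_ : 2 / rt I.+1 * rt I ^+ 2 = 2 * (rt I ^+ 2 / rt I.+1)); last first.
  by rewrite mulrAC mulrA.
move: h a1 a2 a3 a4.
set T := rt I ^+ 2 / _; set S2 := \sum_(_ <= _ < _) _ => h a1 a2 a3 a4.
by move: h a1 a2 a3 a4; clear; lra.
Qed.
End remainder.

(** * Coefficients of the trilinear deficit *)

Section coefficients.
Context {R : rcfType}.
Local Notation rt := (@rt R).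
Local Notation res := (@res R).

(* #{b <= min(be, ga)} - #{b <= be, a + b <= ga}: the multiplicity of a^(-3/2) once
   an edge term of the kernel is subtracted from the product of the two sums. *)
Definition weight (a be ga : nat) : nat := (minn be ga - (ga - a))%N.

Definition edge (al be ga : nat) : R :=
  \sum_(1 <= a < al.+1) rt a ^- 3 * (weight a be ga)%:R.

Lemma edge_ge0 al be ga : 0 <= edge al be ga.
Proof. by apply: sumr_ge0 => a _; rewrite mulr_ge0 ?invr_ge0 ?exprn_ge0 ?rt_ge0 ?ler0n. Qed.

Lemma rtV3M a : (0 < a)%N -> rt a ^- 3 * a%:R = (rt a)^-1.
Proof. by move=> a0; rewrite -(rt_sqr a); field; rewrite gt_eqF ?rt_gt0. Qed.

Lemma edge_small al be ga : (al <= ga)%N -> (ga <= be)%N ->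
  edge al be ga = \sum_(1 <= a < al.+1) (rt a)^-1.
Proof.
move=> ag gb; apply: eq_big_nat => a /andP[a1 al_a].
by rewrite (_ : weight a be ga = a) ?rtV3M//; rewrite /weight; lia.
Qed.

Lemma edge_large al be ga : (ga <= be)%N -> (ga <= al)%N ->
  edge al be ga = \sum_(1 <= a < ga.+1) (rt a)^-1
    + ga%:R * \sum_(ga.+1 <= a < al.+1) rt a ^- 3.
Proof.
move=> gb ga_al; rewrite /edge (@big_cat_nat _ _ _ ga.+1)//=; congr (_ + _).
  apply: eq_big_nat => a /andP[a1 al_a].
  by rewrite (_ : weight a be ga = a) ?rtV3M//; rewrite /weight; lia.
rewrite mulr_sumr; apply: eq_big_nat => a /andP[a1 al_a].
by rewrite (_ : weight a be ga = ga) 1?mulrC//; rewrite /weight; lia.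
Qed.

(** For a <= ga the weight is positive only when a = (ga - be) + t with t >= 1, and then it equals
    t. Bounding a^(-3/2) below by ga^(-3/2) leaves the sum of t up to be, at least be^2 / 2. This
    yields the cubic term of the profiles below. *)
Lemma edge_mid al be ga : (0 < be)%N -> (be <= ga)%N -> (ga <= al)%N ->
  1 / 2 * rt be ^+ 4 / rt ga ^+ 3 + be%:R * \sum_(ga.+1 <= a < al.+1) rt a ^- 3
  <= edge al be ga.
Proof.
move=> be0 bg ga_al; rewrite /edge [X in _ <= X](@big_cat_nat _ _ _ ga.+1)//=.
have ga0 : (0 < ga)%N by exact: leq_trans bg.
apply: lerD; last first.
  rewrite mulr_sumr; apply: ler_sum_nat => a /andP[a1 al_a].
  by rewrite (_ : weight a be ga = be) 1?mulrC//; rewrite /weight; lia.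
have cut : (ga - be < ga.+1)%N by lia.
rewrite [X in _ <= X](@big_cat_nat _ _ _ (ga - be).+1)//=.
rewrite -[X in X <= _]add0r; apply: lerD.
  by apply: sumr_ge0 => a _; rewrite mulr_ge0 ?invr_ge0 ?exprn_ge0 ?rt_ge0 ?ler0n.
apply: (@le_trans _ _ (\sum_(1 <= t < be.+1) rt ga ^- 3 * rt t ^+ 2)).
  by rewrite -mulr_sumr mulrC ler_wpM2l ?invr_ge0 ?exprn_ge0 ?rt_ge0// sum_nat_ge.
have -> : ((ga - be).+1 = 1 + (ga - be))%N by lia.
have -> : (ga.+1 = be.+1 + (ga - be))%N by lia.
rewrite big_addn addnK; apply: ler_sum_nat => t /andP[t1 tb].
have -> : weight (t + (ga - be)) be ga = t by rewrite /weight; lia.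
rewrite rt_sqr ler_wpM2r// lef_pV2 ?posrE ?exprn_gt0 ?rt_gt0//; last by lia.
by rewrite lerXn2r ?nnegrE ?rt_ge0// ler_rt//; lia.
Qed.

(* The remainder summed over a + b <= I. *)
Definition tri I : R := box_sum I I - corner_sum I.

Lemma tri_le I : (0 < I)%N -> tri I <= 1099 / 625 * rt I + 9.
Proof.
move=> I0; have := @box_sum_diag R I I0; have := @corner_sum_ge R I I0.
by rewrite /tri; lra.
Qed.

(** Replaces the cubic in z = sqrt (I / J) by the linear form used in the chain. The difference is
    minimal near z = 13/43 and almost zero there, hence the square. The surplus 3/1000 is reserved
    for additive constants. *)
Lemma triple_profile (z : R) : 0 <= z ->
  731 / 100 + 3 / 1000 - 316 / 100 * z <=
  10 - 1099 / 625 - 4 * z + 1 / 2 * z ^+ 3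
  - 2 * (598 / 1500 - 63 / 100 * z ^+ 2 + 161 / 1500 * z ^+ 3).
Proof.
move=> z0; have h1 := sqr_ge0 (z - 13 / 43).
by have h2 := mulr_ge0 z0 h1; move: z0 h1 h2; clear; lra.
Qed.

Lemma double_profile (z : R) : 0 <= z ->
  463 / 100 + 3 / 1000 - 351 / 100 * z <=
  6 - 1099 / 1250 - 4 * z + 1 / 2 * z ^+ 3
  - (598 / 1500 - 63 / 100 * z ^+ 2 + 161 / 1500 * z ^+ 3).
Proof.
move=> z0; have h1 := sqr_ge0 (z - 304 / 1000).
by have h2 := mulr_ge0 z0 h1; move: z0 h1 h2; clear; lra.
Qed.

Lemma coef_iii I : (0 < I)%N -> 40 <= 3 / 1000 * rt I ->
  111 / 100 * rt I <= edge I I I - 1 / 2 * tri I.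
Proof.
move=> I0 xl; rewrite edge_small//.
by have := @sum_rtV_ge R I; have := tri_le I I0; lra.
Qed.

(** The loss 2 sqrt (I / K) is the part of the tail of a^(-3/2) beyond the level K, which
    [edge K I I] does not contain. *)
Lemma coef_iik I K : (0 < I)%N -> (I <= K)%N -> 40 <= 3 / 1000 * rt I ->
  rt I * (329 / 100 - 2 * (rt I / rt K)) <=
  edge I K I + edge K I I - tri I - 1 / 2 * box_sum I I.
Proof.
move=> I0 IK xl; rewrite edge_small// edge_large//.
have x0 := @rt_gt0 R I I0.
have k0 : 0 < rt K by rewrite rt_gt0// (leq_trans I0).
have H := @sum_rtV_ge R I; have T := tri_le I I0.
have B := @box_sum_diag R I I0.
have Zi := ler_wpM2l (ler0n R I) (@sum_rtV3_ge' R I K I0 IK).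
have x1 : (rt I)^-1 <= 1 by rewrite invf_le1// rt_ge1.
move: Zi; rewrite -{1}(rt_sqr I).
rewrite (_ : rt I ^+ 2 * _ = 2 * rt I - (rt I)^-1 - 2 * rt I * (rt I / rt K)); last first.
  by field; rewrite !gt_eqF.
move: (I%:R * _) (\sum_(_ <= _ < _) (rt _)^-1) (rt I / rt K) H => s1 s2 z H Zi.
by move: H T B x1 xl Zi; clear; lra.
Qed.

Lemma coef_ijj I J (lam : R) : (0 < I)%N -> (I <= J)%N -> 40 <= 3 / 1000 * rt I ->
  \sum_(I.+1 <= b < J.+1) rt b ^- 2 <= lam ->
  rt I * (463 / 100 - lam - 351 / 100 * (rt I / rt J)) <=
  edge I J J + edge J J I + edge J I J - 1 / 2 * tri I - box_sum I J.
Proof.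
move=> I0 IJ xl hlam; rewrite edge_small// edge_large//.
have x0 := @rt_gt0 R I I0.
have y0 : 0 < rt J by rewrite rt_gt0// (leq_trans I0).
have H := @sum_rtV_ge R I; have T := tri_le I I0.
have B := @box_sum_le R I J I0 IJ.
have Zi := ler_wpM2l (ler0n R I) (@sum_rtV3_ge' R I J I0 IJ).
have M := @edge_mid J I J I0 IJ (leqnn J).
have x1 : (rt I)^-1 <= 1 by rewrite invf_le1// rt_ge1.
have z0 : 0 <= rt I / rt J by rewrite divr_ge0 ?ltW.
have P := ler_wpM2l (ltW x0) (double_profile _ z0).
have L := ler_wpM2l (ltW x0) hlam.
move: Zi; rewrite -{1}(rt_sqr I).
rewrite (_ : rt I ^+ 2 * _ = 2 * rt I - (rt I)^-1 - 2 * rt I * (rt I / rt J)); last first.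
  by field; rewrite !gt_eqF.
move: M; rewrite [X in _ + _ * X]big_geq// mulr0 addr0.
rewrite (_ : 1 / 2 * _ / _ = 1 / 2 * rt I * (rt I / rt J) ^+ 3); last first.
  by field; rewrite gt_eqF.
move: B P L; set S2 := \sum_(_ <= _ < _) rt _ ^- 2.
move: (I%:R * _) (\sum_(_ <= _ < _) (rt _)^-1) (rt I / rt J) H => s1 s2 z H B P L M Zi.
by move: H T B x1 xl Zi P L M; clear; lra.
Qed.

Lemma coef_ijk I J K (lam : R) : (0 < I)%N -> (I <= J)%N -> (J <= K)%N ->
  40 <= 3 / 1000 * rt I ->
  \sum_(I.+1 <= b < J.+1) rt b ^- 2 <= lam ->
  rt I * (731 / 100 - 2 * lam - 316 / 100 * (rt I / rt J) - 4 * (rt I / rt K)) <=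
  edge I K J + edge J K I + edge K J I + edge K I J - tri I - 2 * box_sum I J.
Proof.
move=> I0 IJ JK xl hlam; have IK := leq_trans IJ JK.
rewrite edge_small// (@edge_large J K I)// (@edge_large K J I)//.
have x0 := @rt_gt0 R I I0.
have y0 : 0 < rt J by rewrite rt_gt0// (leq_trans I0).
have k0 : 0 < rt K by rewrite rt_gt0// (leq_trans I0).
have H := @sum_rtV_ge R I; have T := tri_le I I0.
have B := @box_sum_le R I J I0 IJ.
have Zi := ler_wpM2l (ler0n R I) (@sum_rtV3_ge' R I K I0 IK).
have M := @edge_mid K I J I0 IJ JK.
have x1 : (rt I)^-1 <= 1 by rewrite invf_le1// rt_ge1.
have z0 : 0 <= rt I / rt J by rewrite divr_ge0 ?ltW.
have P := ler_wpM2l (ltW x0) (triple_profile _ z0).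
have L := ler_wpM2l (ltW x0) hlam.
(* The stretch from I to J in [edge J K I] and the one from J to K in [edge K I J] join into a
   second full sum from I to K. Two such sums account for the loss 4 sqrt (I / K). *)
have cat : I%:R * \sum_(I.+1 <= a < K.+1) rt a ^- 3 =
  I%:R * \sum_(I.+1 <= a < J.+1) rt a ^- 3
  + I%:R * \sum_(J.+1 <= a < K.+1) rt a ^- 3 :> R.
  by rewrite -mulrDr (@big_cat_nat _ _ _ J.+1).
rewrite cat in Zi *.
move: Zi; rewrite -{1}(rt_sqr I).
rewrite (_ : rt I ^+ 2 * _ = 2 * rt I - (rt I)^-1 - 2 * rt I * (rt I / rt K)); last first.
  by field; rewrite !gt_eqF.
move: M; rewrite (_ : 1 / 2 * _ / _ = 1 / 2 * rt I * (rt I / rt J) ^+ 3); last first.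
  by field; rewrite gt_eqF.
move: B P L; set S2 := \sum_(_ <= _ < _) rt _ ^- 2.
move: (rt I / rt K) (I%:R * _) (I%:R * _) (\sum_(_ <= _ < _) (rt _)^-1) (rt I / rt J) H.
move=> z' s0 s1 s2 z H B P L M Zi.
by move: H T B x1 xl Zi P L M; clear; lra.
Qed.
End coefficients.

(** * The deficit of a finite ladder *)

Section symmetrization.
Context {R : comPzRingType}.

Lemma sum2_triangle (H : nat -> nat -> R) n :
  \sum_(0 <= i < n) \sum_(0 <= j < n) H i j =
  \sum_(0 <= j < n) (H j j + \sum_(0 <= i < j) (H i j + H j i)).
Proof.
elim: n => [|n IH]; first by rewrite !big_geq.
rewrite [LHS]big_nat_recr//= [RHS]big_nat_recr//= -IH.
under eq_bigr do rewrite big_nat_recr//=.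
rewrite big_split/= [\sum_(0 <= j < n.+1) H n j]big_nat_recr//= big_split/=.
by ring.
Qed.

Lemma sum2_recr (G : nat -> nat -> R) n :
  \sum_(0 <= i < n.+1) \sum_(0 <= j < n.+1) G i j =
  \sum_(0 <= i < n) \sum_(0 <= j < n) G i j
  + \sum_(0 <= i < n) (G i n + G n i) + G n n.
Proof.
rewrite big_nat_recr//= (eq_bigr (fun i => \sum_(0 <= j < n) G i j + G i n)).
  by rewrite !big_split/= [\sum_(0 <= j < n.+1) G n j]big_nat_recr//= !addrA.
by move=> i _; rewrite big_nat_recr.
Qed.

(** Sorting by the middle index matches the chain density. The induction peels off the triples that
    contain the largest index. *)
Lemma sum3_chains (F : nat -> nat -> nat -> R) n :
  \sum_(0 <= i < n) \sum_(0 <= j < n) \sum_(0 <= k < n) F i j k =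
  \sum_(0 <= j < n) (F j j j
    + \sum_(j.+1 <= k < n) (F j j k + F j k j + F k j j)
    + \sum_(0 <= i < j) (F i j j + F j i j + F j j i)
    + \sum_(0 <= i < j) \sum_(j.+1 <= k < n)
        (F i j k + F i k j + F j i k + F j k i + F k i j + F k j i)).
Proof.
elim: n => [|n IH]; first by rewrite !big_geq.
have split3 : \sum_(0 <= i < n.+1) \sum_(0 <= j < n.+1) \sum_(0 <= k < n.+1) F i j k
  = \sum_(0 <= i < n) \sum_(0 <= j < n) \sum_(0 <= k < n) F i j k
    + \sum_(0 <= i < n) \sum_(0 <= j < n) (F i j n + F i n j + F n i j)
    + \sum_(0 <= i < n) (F i n n + F n i n + F n n i) + F n n n.
  rewrite big_nat_recr//= sum2_recr (eq_bigr _ (fun i _ => sum2_recr (F i) n)).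
  rewrite !big_split/= (eq_bigr _ (fun i _ => big_split _ _ _ _ _)) big_split/=.
  rewrite [in RHS](eq_bigr _ (fun i _ => big_split _ _ _ _ _)) big_split/=.
  rewrite [in RHS](eq_bigr _ (fun i _ => big_split _ _ _ _ _)) big_split/=.
  by ring.
rewrite split3 IH sum2_triangle [RHS]big_nat_recr//=.
rewrite [\sum_(n.+1 <= k < n.+1) _]big_geq// addr0.
rewrite [\sum_(0 <= i < n) \sum_(n.+1 <= k < n.+1) _]big1 ?addr0; last first.
  by move=> i _; rewrite big_geq.
rewrite -[X in X + _ + _ = _]big_split/= -[LHS]addrA [_ + F n n n]addrC.
congr (_ + _); apply: eq_big_nat => j /andP[_ jn].
rewrite !(@big_nat_recr _ _ _ n j.+1)//=.
rewrite [in RHS](eq_bigr _ (fun i _ => @big_nat_recr _ _ _ n j.+1 _ _))//=.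
rewrite [X in _ = _ + X]big_split/=.
have -> : \sum_(0 <= i < j) (F i j n + F i n j + F n i j + (F j i n + F j n i + F n j i))
  = \sum_(0 <= i < j) (F i j n + F i n j + F j i n + F j n i + F n i j + F n j i).
  by apply: eq_bigr => i _; ring.
by ring.
Qed.
End symmetrization.

Definition ladder {R : pzRingType} (v : nat -> R) (lev : nat -> nat) n m : R :=
  \sum_(0 <= i < n) v i * (m <= lev i)%N%:R.

Section trilinear.
Context {R : rcfType}.
Local Notation rt := (@rt R).
Local Notation res := (@res R).
Local Notation edge := (@edge R).
Variables (v : nat -> R) (lev : nat -> nat) (n M : nat).
Hypothesis levM : forall i, (i < n)%N -> (lev i <= M)%N.

Local Notation y := (ladder v lev n).

Lemma cut_sum (f : nat -> R) d : (d <= M)%N ->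
  \sum_(1 <= a < M.+1) f a * (a <= d)%N%:R = \sum_(1 <= a < d.+1) f a.
Proof.
move=> dM; rewrite (@big_cat_nat _ _ _ d.+1)//= [X in _ + X]big1_seq ?addr0; last first.
  by move=> a; rewrite mem_index_iota => /andP[_ /andP[da _]]; rewrite leqNgt da mulr0.
by apply: eq_big_nat => a /andP[_ ad]; rewrite -ltnS ad mulr1.
Qed.

Lemma sum_level d : (d <= M)%N -> \sum_(1 <= b < M.+1) (b <= d)%N%:R = d%:R :> R.
Proof.
move=> dM; under eq_bigr do rewrite -[_%:R]mul1r.
by rewrite cut_sum// big_const_nat subn1/= iter_addr_0.
Qed.

Lemma weightE a be ga : (be <= M)%N ->
  \sum_(1 <= b < M.+1) (b <= be)%N%:R * (b <= ga)%N%:R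
  - \sum_(1 <= b < M.+1) (b <= be)%N%:R * (a + b <= ga)%N%:R
  = (weight a be ga)%:R :> R.
Proof.
move=> bM.
have -> : \sum_(1 <= b < M.+1) (b <= be)%N%:R * (b <= ga)%N%:R = (minn be ga)%:R :> R.
  rewrite -(sum_level (minn be ga)); last by lia.
  by apply: eq_bigr => b _; rewrite -natrM; congr (_%:R); lia.
have -> : \sum_(1 <= b < M.+1) (b <= be)%N%:R * (a + b <= ga)%N%:R
    = (minn be (ga - a))%:R :> R.
  rewrite -(sum_level (minn be (ga - a))); last by lia.
  by apply: eq_big_nat => b /andP[b1 _]; rewrite -natrM; congr (_%:R); lia.
by rewrite -natrB; [congr (_%:R); rewrite /weight; lia | lia].
Qed.

Definition rest_sum al be ga : R :=
  \sum_(1 <= b < M.+1) \sum_(1 <= a < M.+1)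
    res a b * ((a <= al)%N%:R * (b <= be)%N%:R * (a + b <= ga)%N%:R).

Lemma rest_sum_le_box al be ga I J : (I <= M)%N -> (J <= M)%N ->
  (forall a b, (0 < a)%N -> (0 < b)%N -> (a <= al)%N -> (b <= be)%N -> (a + b <= ga)%N ->
     (a <= I)%N /\ (b <= J)%N) ->
  rest_sum al be ga <= box_sum I J.
Proof.
move=> IM JM sub; rewrite /box_sum -(cut_sum _ J JM).
apply: ler_sum_nat => b /andP[b1 _]; rewrite -(cut_sum _ I IM) mulr_suml.
apply: ler_sum_nat => a /andP[a1 _]; rewrite -[X in _ <= X]mulrA ler_wpM2l ?res_ge0// -!natrM ler_nat.
by have := sub a b a1 b1; do 3 case: (leqP _ _) => ? //; move=> []; lia.
Qed.

(** Meant for triples whose smallest level is the last one: it then constrains a + b, so only the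
    triangle is charged and the corner is saved. *)
Lemma rest_sum_le_tri al be ga I : (I <= M)%N ->
  (forall a b, (0 < a)%N -> (0 < b)%N -> (a <= al)%N -> (b <= be)%N -> (a + b <= ga)%N ->
     (a + b <= I)%N) ->
  rest_sum al be ga <= tri I.
Proof.
move=> IM sub; rewrite /tri /box_sum /corner_sum -sumrB -(cut_sum _ I IM).
apply: ler_sum_nat => b /andP[b1 _].
case: (leqP b I) => bI; last first.
  rewrite mulr0 big1_seq// => a; rewrite mem_index_iota => /andP[_ /andP[a1 _]].
  apply/eqP; rewrite mulf_eq0 -!natrM pnatr_eq0 -leqn0; apply/orP; right.
  by have := sub a b a1 b1; do 3 case: (leqP _ _) => ? //; lia.
have cut : (I - b <= I)%N by lia.
rewrite mulr1 (@big_cat_nat _ _ _ (I - b).+1 1 I.+1)//= addrK.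
rewrite -(cut_sum _ (I - b)%N); last by lia.
apply: ler_sum_nat => a /andP[a1 _]; rewrite ler_wpM2l ?res_ge0// -!natrM ler_nat.
by have := sub a b a1 b1; do 3 case: (leqP _ _) => ? //; lia.
Qed.

Let product_sum (x : R) a b c : x * (y a * y b * y c) =
  \sum_(0 <= i < n) \sum_(0 <= j < n) \sum_(0 <= k < n) v i * v j * v k *
    (x * ((a <= lev i)%N%:R * (b <= lev j)%N%:R * (c <= lev k)%N%:R)).
Proof.
rewrite -(mulrA (y a)) [y a]/ladder mulr_suml mulr_sumr; apply: eq_bigr => i _.
rewrite [y b]/ladder mulr_suml !mulr_sumr; apply: eq_bigr => j _.
by rewrite [y c]/ladder !mulr_sumr; apply: eq_bigr => k _; ring.
Qed.

Lemma trilinear_sum (w : nat -> nat -> R) (c : nat -> nat -> nat) :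
  \sum_(1 <= b < M.+1) \sum_(1 <= a < M.+1) w a b * (y a * y b * y (c a b)) =
  \sum_(0 <= i < n) \sum_(0 <= j < n) \sum_(0 <= k < n) v i * v j * v k *
    \sum_(1 <= b < M.+1) \sum_(1 <= a < M.+1)
      w a b * ((a <= lev i)%N%:R * (b <= lev j)%N%:R * (c a b <= lev k)%N%:R).
Proof.
rewrite (eq_bigr _ (fun b _ => eq_bigr _ (fun a _ => product_sum _ _ _ _))).
rewrite (eq_bigr _ (fun b _ => exchange_big _ _ _ _ _ _))/= exchange_big/=.
apply: eq_bigr => i _.
rewrite (eq_bigr _ (fun b _ => exchange_big _ _ _ _ _ _))/= exchange_big/=.
apply: eq_bigr => j _.
rewrite (eq_bigr _ (fun b _ => exchange_big _ _ _ _ _ _))/= exchange_big/=.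
apply: eq_bigr => k _; rewrite mulr_sumr; apply: eq_bigr => b _.
by rewrite mulr_sumr.
Qed.

(** By the symmetry of a and b the two edge sums coincide and cancel the factor 1/2. What remains,
    apart from the remainder, is the sum of a^(-3/2) y_a y_b (y_b - y_(a+b)), whose coefficients
    [weight] counts. *)
Lemma deficit_trilinear :
  (\sum_(1 <= a < M.+1) rt a ^- 3 * y a) * (\sum_(1 <= b < M.+1) y b ^+ 2)
  - 1 / 2 * \sum_(1 <= b < M.+1) \sum_(1 <= a < M.+1)
      (rt a ^- 3 + rt b ^- 3 + res a b) * (y a * y b * y (a + b)%N)
  = \sum_(0 <= i < n) \sum_(0 <= j < n) \sum_(0 <= k < n) v i * v j * v k *
      (edge (lev i) (lev j) (lev k) - 1 / 2 * rest_sum (lev i) (lev j) (lev k)).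
Proof.
have -> : (\sum_(1 <= a < M.+1) rt a ^- 3 * y a) * (\sum_(1 <= b < M.+1) y b ^+ 2)
    = \sum_(1 <= b < M.+1) \sum_(1 <= a < M.+1) rt a ^- 3 * (y a * y b * y b).
  rewrite mulr_sumr; apply: eq_bigr => b _; rewrite mulr_suml.
  by apply: eq_bigr => a _; ring.
have -> : \sum_(1 <= b < M.+1) \sum_(1 <= a < M.+1)
      (rt a ^- 3 + rt b ^- 3 + res a b) * (y a * y b * y (a + b)%N)
  = 2 * (\sum_(1 <= b < M.+1) \sum_(1 <= a < M.+1) rt a ^- 3 * (y a * y b * y (a + b)%N))
    + \sum_(1 <= b < M.+1) \sum_(1 <= a < M.+1) res a b * (y a * y b * y (a + b)%N).
  have dist (x z t w : R) : (x + z + t) * w = x * w + z * w + t * w by rewrite !mulrDl.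
  under eq_bigr do under eq_bigr do rewrite dist.
  under eq_bigr do rewrite !big_split/=.
  rewrite !big_split/= mulrDl mul1r; congr (_ + _ + _).
  rewrite exchange_big/=; apply: eq_bigr => b _; apply: eq_bigr => a _.
  by rewrite addnC [y b * _]mulrC.
rewrite mulrDr mulrA divfK ?pnatr_eq0// mul1r.
rewrite !trilinear_sum mulr_sumr -big_split -sumrB/=; apply: eq_big_nat => i /andP[_ ni].
rewrite mulr_sumr -big_split -sumrB/=; apply: eq_big_nat => j /andP[_ nj].
rewrite mulr_sumr -big_split -sumrB/=; apply: eq_big_nat => k /andP[_ nk].
rewrite /rest_sum.
have -> : edge (lev i) (lev j) (lev k) =
  \sum_(1 <= b < M.+1) \sum_(1 <= a < M.+1) rt a ^- 3 *
     ((a <= lev i)%N%:R * (b <= lev j)%N%:R * (b <= lev k)%N%:R)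
  - \sum_(1 <= b < M.+1) \sum_(1 <= a < M.+1) rt a ^- 3 *
     ((a <= lev i)%N%:R * (b <= lev j)%N%:R * (a + b <= lev k)%N%:R).
  rewrite /edge -(cut_sum _ (lev i)) ?levM// exchange_big [X in _ = _ - X]exchange_big/=.
  rewrite -sumrB; apply: eq_bigr => a _.
  rewrite -(weightE a (lev j) (lev k)) ?levM// mulrAC mulrBr !mulr_sumr.
  by congr (_ - _); apply: eq_bigr => b _; ring.
by ring.
Qed.

End trilinear.

(** The factor q^(3d) turns the weights q^d and q^(2d) into q^(4d) and q^(5d), which is where these
    exponents come from. Since q^(3(k-i)) splits at j, the last loss is the product of a future and
    a past sum. *)
Lemma chain_densityE {R : realFieldType} (q : R) u n j :
  chain_density q u n j =
  111 / 100 * u j ^+ 3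
  + \sum_(j.+1 <= k < n) (329 / 100 - 2 * q ^+ (3 * (k - j))) * q ^+ (k - j)
      * (u j ^+ 2 * u k)
  + \sum_(0 <= i < j) (463 / 100 - (j - i)%:R * (61 / 88) - 351 / 100 * q ^+ (3 * (j - i)))
      * q ^+ (2 * (j - i)) * (u i * u j ^+ 2)
  + \sum_(0 <= i < j) \sum_(j.+1 <= k < n)
      (731 / 100 - 2 * ((j - i)%:R * (61 / 88)) - 316 / 100 * q ^+ (3 * (j - i))
        - 4 * q ^+ (3 * (k - i))) * q ^+ (2 * (j - i) + (k - j)) * (u i * u j * u k).
Proof.
have fut p : p * future p u n j.+1 = \sum_(j.+1 <= k < n) p ^+ (k - j) * u k.
  rewrite /future mulr_sumr; apply: eq_big_nat => k /andP[jk _].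
  by rewrite mulrA -exprS subnS prednK// subn_gt0.
rewrite /chain_density /density !fut /past.
set W := \sum_(j.+1 <= k < n) q ^+ (k - j) * _.
set Y := \sum_(j.+1 <= k < n) (q ^+ 4) ^+ (k - j) * _.
have -> : \sum_(j.+1 <= k < n) (329 / 100 - 2 * q ^+ (3 * (k - j))) * q ^+ (k - j)
      * (u j ^+ 2 * u k) = u j ^+ 2 * (329 / 100 * W - 2 * Y).
  rewrite /W /Y !mulr_sumr -sumrB mulr_sumr; apply: eq_bigr => k _.
  by rewrite -exprM (mulnDl 3 1) mul1n exprD; ring.
set L := \sum_(0 <= i < j) 1 * (q ^+ 2) ^+ _ * _.
set K := \sum_(0 <= i < j) _%:R * _ * _.
set N := \sum_(0 <= i < j) 1 * (q ^+ 5) ^+ _ * _.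
have -> : \sum_(0 <= i < j) (463 / 100 - (j - i)%:R * (61 / 88) - 351 / 100 * q ^+ (3 * (j - i)))
      * q ^+ (2 * (j - i)) * (u i * u j ^+ 2)
  = u j ^+ 2 * (463 / 100 * L - 61 / 88 * K - 351 / 100 * N).
  rewrite /L /K /N !mulr_sumr -!sumrB mulr_sumr; apply: eq_bigr => i _.
  by rewrite -!exprM (mulnDl 3 2) exprD; field.
congr (_ + _).
have -> : u j * (W * (731 / 100 * L - 61 / 44 * K - 316 / 100 * N) - 4 * Y * N) =
  \sum_(0 <= i < j) (u j * (W * (731 / 100 * q ^+ (2 * (j - i)) * u i
    - 61 / 44 * (j - i)%:R * q ^+ (2 * (j - i)) * u i - 316 / 100 * q ^+ (5 * (j - i)) * u i)
    - 4 * Y * (q ^+ (5 * (j - i)) * u i))).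
  rewrite -mulr_sumr sumrB -!mulr_sumr !sumrB /L /K /N !mulr_sumr.
  congr (u j * (W * (_ - _ - _) - _)).
  - by apply: eq_bigr => i _; rewrite -exprM; ring.
  - by apply: eq_bigr => i _; rewrite -exprM; ring.
  - by apply: eq_bigr => i _; rewrite -exprM; ring.
  - by apply: eq_bigr => i _; rewrite -exprM; ring.
apply: eq_big_nat => i /andP[_ ij]; rewrite /W /Y !mulr_sumr !mulr_suml -sumrB mulr_sumr.
apply: eq_big_nat => k /andP[jk _].
rewrite (_ : q ^+ (3 * (k - i)) = q ^+ (3 * (k - j)) * q ^+ (3 * (j - i))); last first.
  by rewrite -exprD; congr (_ ^+ _); lia.
rewrite -!exprM (mulnDl 3 2) (mulnDl 3 1) mul1n !exprD.
by field.
Qed.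

(** In this and the next two lemmas t bounds the orderings with the smallest level last, b the other
    ones; edge terms absent from the left side are dropped by nonnegativity. *)
Lemma halves_iik {R : realFieldType} (e0 e1 e2 r0 r1 r2 t b : R) :
  0 <= e0 -> r0 <= b -> r1 <= t -> r2 <= t ->
  e1 + e2 - t - 1 / 2 * b <= e0 + e1 + e2 - 1 / 2 * (r0 + r1 + r2).
Proof. by lra. Qed.

Lemma halves_ijj {R : realFieldType} (e0 e1 e2 r0 r1 r2 t b : R) :
  r0 <= b -> r1 <= b -> r2 <= t ->
  e0 + e1 + e2 - 1 / 2 * t - b <= e0 + e2 + e1 - 1 / 2 * (r0 + r1 + r2).
Proof. by lra. Qed.

Lemma halves_ijk {R : realFieldType} (e0 e1 e2 e3 e4 e5 r0 r1 r2 r3 r4 r5 t b : R) :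
  0 <= e0 -> 0 <= e1 -> r0 <= b -> r1 <= b -> r2 <= b -> r3 <= b -> r4 <= t -> r5 <= t ->
  e2 + e4 + e5 + e3 - t - 2 * b <=
  e0 + e1 + e2 + e3 + e4 + e5 - 1 / 2 * (r0 + r1 + r2 + r3 + r4 + r5).
Proof. by lra. Qed.

Lemma addn_gap i j k : (i < j)%N -> (j < k)%N ->
  ((j - i) + (k - i) = 2 * (j - i) + (k - j))%N.
Proof. by lia. Qed.

(** * Dyadic levels: the deficit against the chain density *)

Section dyadic_levels.
Context {R : rcfType}.
Variables (q w0 : R) (u : nat -> R) (N n : nat).
Hypotheses (q0 : 0 < q) (q6 : q ^+ 6 = 1 / 2) (w00 : 0 <= w0) (N0 : (0 < N)%N).
Hypothesis w03 : w0 ^+ 3 * rt N = 1.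
Hypothesis u0 : forall i, 0 <= u i.
Hypothesis N_large : 40 <= 3 / 1000 * @rt R N.
(** The only trace of the logarithm: the argument runs over any real closed field, and 61/88 stands
    in for log 2. *)
Hypothesis harmonic : forall m, (0 < m)%N ->
  \sum_(m.+1 <= b < (2 * m).+1) @rt R b ^- 2 <= 61 / 88.
Local Notation rt := (@rt R).
Local Notation rest_sum := (@rest_sum R).
Local Notation edge := (@edge R).
Local Notation tri := (@tri R).

Let lev i := (N * 2 ^ i)%N.
Let w i : R := w0 * q ^+ i.
Let v i : R := w i * u i.
Let M := (N * 2 ^ n)%N.

Let lev_gt0 i : (0 < lev i)%N.
Proof. by rewrite muln_gt0 N0 expn_gt0. Qed.

Let lev_mono i j : (i <= j)%N -> (lev i <= lev j)%N.
Proof. by move=> ij; rewrite leq_mul2l leq_pexp2l ?orbT. Qed.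

Let levS i : lev i.+1 = (2 * lev i)%N.
Proof. by rewrite /lev expnS mulnCA. Qed.

Let lev_lt i j : (i < j)%N -> (2 * lev i <= lev j)%N.
Proof. by move=> ij; rewrite -levS lev_mono. Qed.

Let rt_lev i : rt (lev i) * q ^+ (3 * i) = rt N.
Proof.
elim: i => [|i IH]; first by rewrite muln0 expr0 mulr1 /lev expn0 muln1.
rewrite -IH (mulnS 3 i) exprD.
have : rt (lev i.+1) = rt (lev i) * rt 2.
  by rewrite levS mulnC rtM.
move=> ->.
suff e : q ^+ 3 * rt 2 = 1 by rewrite -[RHS]mul1r -e; ring.
apply/eqP; rewrite -(@eqrXn2 _ 2)// ?mulr_ge0 ?exprn_ge0 ?rt_ge0 ?(ltW q0)//.
by rewrite exprMn -exprM q6 rt_sqr expr1n; apply/eqP; field.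
Qed.

Let rt_ratio i j : (i <= j)%N -> rt (lev i) / rt (lev j) = q ^+ (3 * (j - i)).
Proof.
move=> ij; have rj := @rt_gt0 R _ (lev_gt0 j).
apply: (@mulIf _ (rt (lev j))); first by rewrite gt_eqF.
rewrite divfK ?gt_eqF//; apply: (@mulIf _ (q ^+ (3 * i))).
  by rewrite gt_eqF ?exprn_gt0.
by rewrite rt_lev mulrAC -exprD -mulnDr subnK// mulrC rt_lev.
Qed.

(** Here the exponent -1/6 does its work: three weights times the square root of the smallest level
    lose all dependence on [N] and on the absolute position of i, since sqrt (N 2^i) = sqrt N /
    q^(3i). *)
Let weights i j k : (i <= j)%N -> (i <= k)%N ->
  w i * w j * w k * rt (lev i) = q ^+ ((j - i) + (k - i)).
Proof.
move=> ij ik; apply: (@mulIf _ (q ^+ (3 * i))).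
  by rewrite gt_eqF ?exprn_gt0.
rewrite -[LHS]mulrA rt_lev -exprD.
have -> : ((j - i) + (k - i) + 3 * i = i + j + k)%N by lia.
by rewrite !exprD -[RHS]mul1r -w03 /w; ring.
Qed.

Let harmonic_lev i d : \sum_((lev i).+1 <= b < (lev (i + d)).+1) rt b ^- 2
  <= d%:R * (61 / 88).
Proof.
elim: d => [|d IH]; first by rewrite addn0 big_geq// mul0r.
rewrite (@big_cat_nat _ _ _ (lev (i + d)).+1)//=; last first.
- by rewrite ltnS lev_mono// leq_add2l.
- by rewrite ltnS lev_mono// leq_addr.
by rewrite -natr1 mulrDl mul1r lerD// addnS levS harmonic.
Qed.

Let large i : 40 <= 3 / 1000 * rt (lev i).
Proof.
apply: le_trans N_large _; rewrite ler_wpM2l ?divr_ge0 ?ler0n// ler_rt//.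
by rewrite leq_pmulr// expn_gt0.
Qed.

Let lev_le i : (i < n)%N -> (lev i <= M)%N.
Proof. by move=> ni; rewrite lev_mono// ltnW. Qed.

Let F i j k := v i * v j * v k *
  (edge (lev i) (lev j) (lev k) - 1 / 2 * rest_sum M (lev i) (lev j) (lev k)).

Let v0 i : 0 <= v i.
Proof. by rewrite !mulr_ge0// exprn_ge0// ltW. Qed.

Let vvv i j k : 0 <= v i * v j * v k.
Proof. exact: mulr_ge0 (mulr_ge0 (v0 i) (v0 j)) (v0 k). Qed.

Let F_iii i : (i < n)%N -> 111 / 100 * u i ^+ 3 <= F i i i.
Proof.
move=> ni.
have R3 : rest_sum M (lev i) (lev i) (lev i) <= tri (lev i).
  by apply: rest_sum_le_tri => //; exact: lev_le.
have := @coef_iii R (lev i) (lev_gt0 i) (large i).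
have := weights i i i (leqnn i) (leqnn i); rewrite subnn expr0 => e.
have -> : 111 / 100 * u i ^+ 3 = v i * v i * v i * (111 / 100 * rt (lev i)).
  by rewrite -[LHS]mul1r -e /v; ring.
move=> h; rewrite /F; apply: ler_wpM2l; first exact: vvv.
apply: le_trans h _.
by rewrite lerB// ler_wpM2l// divr_ge0.
Qed.

Let F_iik i k : (i < k)%N -> (k < n)%N ->
  (329 / 100 - 2 * q ^+ (3 * (k - i))) * q ^+ (k - i) * (u i ^+ 2 * u k)
  <= F i i k + F i k i + F k i i.
Proof.
move=> ik kn; have ni := ltn_trans ik kn.
have li := lev_le _ ni; have lk := lev_le _ kn; have i2k := lev_lt _ _ ik.
have R1 : rest_sum M (lev i) (lev k) (lev i) <= tri (lev i).
  by apply: rest_sum_le_tri.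
have R2 : rest_sum M (lev k) (lev i) (lev i) <= tri (lev i).
  by apply: rest_sum_le_tri.
have R3 : rest_sum M (lev i) (lev i) (lev k) <= box_sum (lev i) (lev i).
  by apply: rest_sum_le_box.
have E := @edge_ge0 R (lev i) (lev i) (lev k).
have := @coef_iik R (lev i) (lev k) (lev_gt0 i) (lev_mono _ _ (ltnW ik)) (large i).
rewrite rt_ratio 1?ltnW//.
have := weights i i k (leqnn i) (ltnW ik); rewrite subnn add0n => e.
set Z := 329 / 100 - _ => h.
have -> : Z * q ^+ (k - i) * (u i ^+ 2 * u k) = v i * v i * v k * (rt (lev i) * Z).
  by rewrite -e /v; ring.
have -> : F i i k + F i k i + F k i i = v i * v i * v k *
  (edge (lev i) (lev i) (lev k) + edge (lev i) (lev k) (lev i) + edge (lev k) (lev i) (lev i)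
   - 1 / 2 * (rest_sum M (lev i) (lev i) (lev k) + rest_sum M (lev i) (lev k) (lev i)
              + rest_sum M (lev k) (lev i) (lev i))).
  by rewrite /F; ring.
apply: ler_wpM2l; first exact: vvv.
apply: le_trans h _.
exact: halves_iik.
Qed.

Let box_sumC (I J : nat) : @box_sum R I J = box_sum J I.
Proof.
by rewrite /box_sum exchange_big/=; apply: eq_bigr => a _; apply: eq_bigr => b _; rewrite resC.
Qed.

Let F_ijj i j : (i < j)%N -> (j < n)%N ->
  (463 / 100 - (j - i)%:R * (61 / 88) - 351 / 100 * q ^+ (3 * (j - i)))
      * q ^+ (2 * (j - i)) * (u i * u j ^+ 2)
  <= F i j j + F j i j + F j j i.
Proof.
move=> ij jn; have ni := ltn_trans ij jn.
have li := lev_le _ ni; have lj := lev_le _ jn; have i2j := lev_lt _ _ ij.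
have lij := lev_mono _ _ (ltnW ij).
have R1 : rest_sum M (lev i) (lev j) (lev j) <= box_sum (lev i) (lev j).
  by apply: rest_sum_le_box.
have R2 : rest_sum M (lev j) (lev i) (lev j) <= box_sum (lev i) (lev j).
  by rewrite box_sumC; apply: rest_sum_le_box.
have R3 : rest_sum M (lev j) (lev j) (lev i) <= tri (lev i).
  by apply: rest_sum_le_tri.
have hl := harmonic_lev i (j - i); rewrite subnKC ?(ltnW ij)// in hl.
have := @coef_ijj R (lev i) (lev j) _ (lev_gt0 i) lij (large i) hl.
rewrite rt_ratio 1?ltnW//.
have := weights i j j (ltnW ij) (ltnW ij); rewrite addnn -mul2n => e.
set Z := 463 / 100 - _ - _ => h.
have -> : Z * q ^+ (2 * (j - i)) * (u i * u j ^+ 2) = v i * v j * v j * (rt (lev i) * Z).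
  by rewrite -e /v; ring.
have -> : F i j j + F j i j + F j j i = v i * v j * v j *
  (edge (lev i) (lev j) (lev j) + edge (lev j) (lev i) (lev j) + edge (lev j) (lev j) (lev i)
   - 1 / 2 * (rest_sum M (lev i) (lev j) (lev j) + rest_sum M (lev j) (lev i) (lev j)
              + rest_sum M (lev j) (lev j) (lev i))).
  by rewrite /F; ring.
apply: ler_wpM2l; first exact: vvv.
apply: le_trans h _.
exact: halves_ijj.
Qed.

Let F_ijk i j k : (i < j)%N -> (j < k)%N -> (k < n)%N ->
  (731 / 100 - 2 * ((j - i)%:R * (61 / 88)) - 316 / 100 * q ^+ (3 * (j - i))
        - 4 * q ^+ (3 * (k - i))) * q ^+ (2 * (j - i) + (k - j)) * (u i * u j * u k)
  <= F i j k + F i k j + F j i k + F j k i + F k i j + F k j i.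
Proof.
move=> ij jk kn; have nj := ltn_trans jk kn; have ni := ltn_trans ij nj.
have ik := ltn_trans ij jk.
have li := lev_le _ ni; have lj := lev_le _ nj; have lk := lev_le _ kn.
have i2j := lev_lt _ _ ij; have j2k := lev_lt _ _ jk.
have lij := lev_mono _ _ (ltnW ij); have ljk := lev_mono _ _ (ltnW jk).
have R1 : rest_sum M (lev i) (lev j) (lev k) <= box_sum (lev i) (lev j).
  by apply: rest_sum_le_box.
have R2 : rest_sum M (lev j) (lev i) (lev k) <= box_sum (lev i) (lev j).
  by rewrite box_sumC; apply: rest_sum_le_box.
have R3 : rest_sum M (lev i) (lev k) (lev j) <= box_sum (lev i) (lev j).
  by apply: rest_sum_le_box => // a b; lia.
have R4 : rest_sum M (lev k) (lev i) (lev j) <= box_sum (lev i) (lev j).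
  by rewrite box_sumC; apply: rest_sum_le_box => // a b; lia.
have R5 : rest_sum M (lev j) (lev k) (lev i) <= tri (lev i).
  by apply: rest_sum_le_tri.
have R6 : rest_sum M (lev k) (lev j) (lev i) <= tri (lev i).
  by apply: rest_sum_le_tri.
have E1 := @edge_ge0 R (lev i) (lev j) (lev k).
have E2 := @edge_ge0 R (lev j) (lev i) (lev k).
have hl := harmonic_lev i (j - i); rewrite subnKC ?(ltnW ij)// in hl.
have := @coef_ijk R (lev i) (lev j) (lev k) _ (lev_gt0 i) lij ljk (large i) hl.
rewrite !rt_ratio 1?ltnW//.
have := weights i j k (ltnW ij) (ltnW ik).
rewrite (addn_gap _ _ _ ij jk).
move=> e; set Z := 731 / 100 - _ - _ - _ => h.
have -> : Z * q ^+ (2 * (j - i) + (k - j)) * (u i * u j * u k)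
    = v i * v j * v k * (rt (lev i) * Z).
  by rewrite -e /v; ring.
have -> : F i j k + F i k j + F j i k + F j k i + F k i j + F k j i = v i * v j * v k *
  (edge (lev i) (lev j) (lev k) + edge (lev j) (lev i) (lev k)
   + edge (lev i) (lev k) (lev j) + edge (lev k) (lev i) (lev j)
   + edge (lev j) (lev k) (lev i) + edge (lev k) (lev j) (lev i)
   - 1 / 2 * (rest_sum M (lev i) (lev j) (lev k) + rest_sum M (lev j) (lev i) (lev k)
   + rest_sum M (lev i) (lev k) (lev j) + rest_sum M (lev k) (lev i) (lev j)
   + rest_sum M (lev j) (lev k) (lev i) + rest_sum M (lev k) (lev j) (lev i))).
  by rewrite /F; ring.
apply: ler_wpM2l; first exact: vvv.
apply: le_trans h _.
exact: halves_ijk.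
Qed.

Lemma dyadic_deficit_ge :
  1 / 20 * \sum_(0 <= j < n) u j ^+ 3 <=
  (\sum_(1 <= a < M.+1) rt a ^- 3 * ladder v lev n a) * (\sum_(1 <= b < M.+1) ladder v lev n b ^+ 2)
  - 1 / 2 * \sum_(1 <= b < M.+1) \sum_(1 <= a < M.+1)
      (rt a ^- 3 + rt b ^- 3 + res a b) * (ladder v lev n a * ladder v lev n b * ladder v lev n (a + b)%N).
Proof.
rewrite (@deficit_trilinear R v lev n M lev_le) (sum3_chains F).
apply: le_trans (chain_density_ge q u n q0 q6 u0) _.
apply: ler_sum_nat => j /andP[_ jn]; rewrite chain_densityE.
apply: lerD; [apply: lerD; [apply: lerD|]|]; first exact: F_iii.
- by apply: ler_sum_nat => k /andP[jk kn]; exact: F_iik.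
- by apply: ler_sum_nat => i /andP[_ ij]; exact: F_ijj.
- apply: ler_sum_nat => i /andP[_ ij]; apply: ler_sum_nat => k /andP[jk kn].
  exact: F_ijk.
Qed.

End dyadic_levels.

(** * Bounds for the coefficients of the limiting form *)

Section bounds.
Context {R : realType}.
Implicit Types t x : R.

Lemma ge0_is_derive_le (f f' : R -> R) x :
  (forall t, 0 <= t -> is_derive t 1 f (f' t)) ->
  (forall t, 0 <= t -> 0 <= f' t) -> 0 <= x -> f 0 <= f x.
Proof.
move=> df f'0 x0.
apply: (@ger0_derive1_ndecry R f 0) => //.
- by move=> t; rewrite in_itv/= andbT => /ltW/df[].
- move=> t; rewrite in_itv/= andbT => /ltW t0.
  by rewrite derive1E; have [_ ->] := df t t0; exact: f'0.
- apply: derivable_within_continuous => t; rewrite in_itv/= andbT => /df[].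
  by [].
Qed.

Lemma is_derive_inv (f : R -> R) x df : f x != 0 -> is_derive x 1 f df ->
  is_derive x 1 (fun y => (f y)^-1) (- df / f x ^+ 2).
Proof.
move=> fx [dfx dfE]; apply: DeriveDef; first exact: derivableV.
by rewrite deriveV// dfE /GRing.scale/= mulNr mulNr mulrC.
Qed.

Lemma sqrt1D_gt0 t : 0 < Num.sqrt (1 + t ^+ 2).
Proof. by rewrite sqrtr_gt0 ltr_pwDl// sqr_ge0. Qed.

Lemma sqrt1D_sqr t : Num.sqrt (1 + t ^+ 2) ^+ 2 = 1 + t ^+ 2.
Proof. by rewrite sqr_sqrtr// addr_ge0// sqr_ge0. Qed.

Lemma is_derive_sqrt1D t :
  is_derive t 1 (fun t => Num.sqrt (1 + t ^+ 2)) (t / Num.sqrt (1 + t ^+ 2)).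
Proof.
have p : 0 < 1 + t ^+ 2 by rewrite ltr_pwDl// sqr_ge0.
have d1 : is_derive t 1 (fun t : R => 1 + t ^+ 2) (2 * t).
  by apply: is_derive_eq; rewrite /GRing.scale/=; ring.
have d2 := @is_derive1_sqrt R _ p.
have := @is_derive1_comp R Num.sqrt (fun t : R => 1 + t ^+ 2) t _ _ d2 d1.
move=> h; apply: is_derive_eq; rewrite /=.
by field; rewrite gt_eqF// sqrt1D_gt0.
Qed.

(** Shafer's inequality. The derivative of the difference is a perfect square over a square. *)
Lemma atan_ge t : 0 <= t -> 3 * t / (1 + 2 * Num.sqrt (1 + t ^+ 2)) <= atan t.
Proof.
move=> t0; rewrite -subr_ge0.
pose f x : R := atan x - 3 * x / (1 + 2 * Num.sqrt (1 + x ^+ 2)).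
pose f' x : R := (Num.sqrt (1 + x ^+ 2) - 1) ^+ 2 /
  (Num.sqrt (1 + x ^+ 2) ^+ 2 * (1 + 2 * Num.sqrt (1 + x ^+ 2)) ^+ 2).
have -> : 0 = f 0 by rewrite /f atan0 mulr0 mul0r subrr.
have f'0 x : 0 <= f' x by exact: divr_ge0 (sqr_ge0 _) (mulr_ge0 (sqr_ge0 _) (sqr_ge0 _)).
apply: (ge0_is_derive_le f f' t _ (fun x _ => f'0 x) t0) => x x0.
have s0 := sqrt1D_gt0 x.
have ds := is_derive_sqrt1D x.
have nz : 1 + 2 * Num.sqrt (1 + x ^+ 2) != 0 by rewrite gt_eqF// addr_gt0// mulr_gt0.
have dd : is_derive x 1 (fun x : R => 1 + 2 * Num.sqrt (1 + x ^+ 2))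
    (2 * (x / Num.sqrt (1 + x ^+ 2))).
  by apply: is_derive_eq; rewrite /GRing.scale/=; ring.
have dv := is_derive_inv (fun x : R => 1 + 2 * Num.sqrt (1 + x ^+ 2)) x _ nz dd.
have dn : is_derive x 1 (fun x : R => 3 * x) 3.
  by apply: is_derive_eq; rewrite /GRing.scale/=; ring.
have h := is_deriveB (is_derive1_atan x) (is_deriveM dn dv).
apply: (@is_derive_eq _ _ _ _ _ _ _ _ h).
rewrite /f' /GRing.scale/=.
have := sqrt1D_sqr x; move: (Num.sqrt (1 + x ^+ 2)) s0 nz => s s0 nz sE.
rewrite -sE.
rewrite (_ : 3 * x * _ = - 6 * (s ^+ 2 - 1) / (s * (1 + 2 * s) ^+ 2)).
  by field; rewrite nz gt_eqF.
have -> : s ^+ 2 - 1 = x ^+ 2 by rewrite sE; ring.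
by field; rewrite nz gt_eqF.
Qed.

(** Taylor polynomial at 0; the derivatives compare because (1 - w/2 + 3 w^2 / 8)^2 (1 + w) >= 1 for
    w = t^2 >= 0. *)
Lemma asinh_le t : 0 <= t ->
  ln (t + Num.sqrt (1 + t ^+ 2)) <= t - t ^+ 3 / 6 + 3 / 40 * t ^+ 5.
Proof.
move=> t0; rewrite -subr_ge0.
pose f x : R := x - x ^+ 3 / 6 + 3 / 40 * x ^+ 5 - ln (x + Num.sqrt (1 + x ^+ 2)).
pose f' x : R := 1 - x ^+ 2 / 2 + 3 / 8 * x ^+ 4 - (Num.sqrt (1 + x ^+ 2))^-1.
have -> : 0 = f 0.
  have e : 0 + Num.sqrt (1 + 0 ^+ 2) = 1 :> R by rewrite expr0n/= addr0 sqrtr1 add0r.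
  by rewrite /f e ln1; ring.
apply: (ge0_is_derive_le f f' t _ _ t0) => x x0; last first.
  rewrite /f' subr_ge0 -[X in X <= _]mul1r ler_pdivrMr ?sqrt1D_gt0//.
  set p := 1 - _ + _.
  have w0 := sqr_ge0 x.
  have p0 : 0 <= p by rewrite /p (exprM x 2 2); nra.
  have : 1 ^+ 2 <= (p * Num.sqrt (1 + x ^+ 2)) ^+ 2.
    rewrite exprMn sqrt1D_sqr /p (exprM x 2 2); move: (x ^+ 2) w0 => w w0.
    by have := sqr_ge0 (w - 1); nra.
  by rewrite ler_pXn2r ?nnegrE ?mulr_ge0 ?sqrtr_ge0.
have s0 := sqrt1D_gt0 x.
have ds := is_derive_sqrt1D x.
have xs0 : 0 < x + Num.sqrt (1 + x ^+ 2) by rewrite ltr_wpDl.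
have d1 : is_derive x 1 (fun x : R => x + Num.sqrt (1 + x ^+ 2)) (1 + x / Num.sqrt (1 + x ^+ 2)).
  exact: is_deriveD.
have d2 := @is_derive1_comp R (@ln R) (fun x : R => x + Num.sqrt (1 + x ^+ 2)) x _ _ (is_derive1_ln xs0) d1.
have d3 : is_derive x 1 (fun x : R => x - x ^+ 3 / 6 + 3 / 40 * x ^+ 5) (1 - x ^+ 2 / 2 + 3 / 8 * x ^+ 4).
  by apply: is_derive_eq; rewrite /GRing.scale/=; field.
apply: (@is_derive_eq _ _ _ _ _ _ _ _ (is_deriveB d3 d2)).
rewrite /f'; congr (_ - _); move: (Num.sqrt (1 + x ^+ 2)) s0 xs0 => s s0 xs0.
by field; rewrite !gt_eqF.
Qed.

Lemma sqrt2_le : Num.sqrt 2 <= 99 / 70 :> R.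
Proof.
have q0 : 0 <= 99 / 70 :> R by lra.
have : Num.sqrt 2 ^+ 2 <= (99 / 70) ^+ 2 :> R by rewrite sqr_sqrtr//; lra.
by rewrite ler_pXn2r ?nnegrE ?sqrtr_ge0.
Qed.

Lemma sqrt2_ge : 140 / 99 <= Num.sqrt 2 :> R.
Proof.
have q0 : 0 <= 140 / 99 :> R by lra.
have : (140 / 99) ^+ 2 <= Num.sqrt 2 ^+ 2 :> R by rewrite sqr_sqrtr//; lra.
by rewrite ler_pXn2r ?nnegrE ?sqrtr_ge0.
Qed.

Lemma pi_ge : 1567 / 500 <= pi :> R.
Proof.
(* Shafer's inequality at 1 gives pi >= 12 / (1 + 2 sqrt 2). *)
have h := atan_ge 1 ler01; have s2 := sqrt2_le; have p0 := pi_ge0 R.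
have s0 : 0 <= Num.sqrt 2 :> R by exact: sqrtr_ge0.
move: h; rewrite atan1 expr1n -[1 + 1]/2; move: s2 s0 p0.
move: (pi) (Num.sqrt _) => p s s2 s0 p0 h.
have d0 : 0 < 1 + 2 * s by lra.
move: h; rewrite (ler_pdivrMr _ _ d0) => h.
have := ler_wpM2l p0 s2; lra.
Qed.

Lemma ln2_le : ln 2 <= 61 / 88 :> R.
Proof.
have e : expR (ln 2) = 2 :> R by rewrite lnK// posrE.
rewrite -ler_expR e.
pose x : R := 61 / 88; rewrite -/x.
have x0 : 0 <= x by rewrite /x; lra.
(* Seven terms of the exponential series at 61/88 already exceed 2. *)
have h : \sum_(0 <= i < 7) exp_coeff x i <= expR x.
  rewrite /expR; apply: nondecreasing_cvgn_le; last exact: is_cvg_series_exp_coeff.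
  apply: nondecreasing_series => i _ _.
  by rewrite /exp_coeff/= divr_ge0// exprn_ge0.
apply: le_trans h; rewrite /exp_coeff/= unlock/= !factS fact0.
rewrite /x; lra.
Qed.
End bounds.

(** * Closed forms of U and V, bounds for the coefficients *)

Section closed_forms.
Context {R : realType}.
Implicit Types r x z : R.

Lemma atan_le x : 0 <= x -> atan x <= x.
Proof.
move=> x0; rewrite -subr_ge0.
have e : 0 = 0 - atan 0 :> R by rewrite atan0 subrr.
rewrite e; apply: (ge0_is_derive_le (fun x => x - atan x) (fun x => 1 - (1 + x ^+ 2)^-1) x _ _ x0).
move=> t _; rewrite subr_ge0 invf_le1 ?lerDl ?sqr_ge0//.
by rewrite ltr_pwDl// sqr_ge0.
Qed.

Section at_ratio.
Variable r : R.
Hypothesis r2 : 2 <= r.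
(** In the coordinates z = r^(-1/2) and k = sqrt (1 - z^2) one has t_2 = z, t_1 = z / k and s(t_1) =
    1 / k, so apart from logarithms and the arctangent everything is rational in z, k and [sz]. *)
Let z : R := (Num.sqrt r)^-1.
Let k : R := Num.sqrt (1 - z ^+ 2).
Let sz : R := Num.sqrt (1 + z ^+ 2).

Let r0 : 0 < r. Proof. exact: lt_le_trans r2. Qed.

Let z0 : 0 < z. Proof. by rewrite invr_gt0 sqrtr_gt0. Qed.

Let zr : z ^+ 2 = r^-1. Proof. by rewrite exprVn sqr_sqrtr// ltW. Qed.

Let w_le : z ^+ 2 <= 1 / 2.
Proof. by rewrite zr div1r lef_pV2// posrE. Qed.

Let z_le1 : z <= 1.
Proof.
have w1 : z ^+ 2 <= 1 ^+ 2 by rewrite expr1n; move: w_le; lra.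
by move: w1; rewrite ler_pXn2r ?nnegrE ?(ltW z0).
Qed.

Let kE : k ^+ 2 = 1 - z ^+ 2.
Proof. by rewrite sqr_sqrtr// subr_ge0 expr_le1// ltW. Qed.

Let k0 : 0 < k.
Proof. by rewrite sqrtr_gt0 subr_gt0; move: w_le; lra. Qed.

Let k_le1 : k <= 1.
Proof.
have w1 : k ^+ 2 <= 1 ^+ 2 by rewrite expr1n kE lerBlDr lerDl sqr_ge0.
by move: w1; rewrite ler_pXn2r ?nnegrE ?(ltW k0).
Qed.

Let szE : sz ^+ 2 = 1 + z ^+ 2. Proof. exact: sqrt1D_sqr. Qed.
Let sz0 : 0 < sz. Proof. exact: sqrt1D_gt0. Qed.

Let rz : Num.sqrt r = z^-1. Proof. by rewrite invrK. Qed.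

Let r1z : Num.sqrt (r - 1) = k / z.
Proof.
have -> : r - 1 = (k / z) ^+ 2.
  by rewrite expr_div_n kE zr invrK mulrBl mul1r mulVf// gt_eqF.
by rewrite sqrtr_sqr ger0_norm// divr_ge0// ltW.
Qed.

Let t2E : t2 r = z.
Proof. by rewrite /t2 powRN div1r powR12_sqrt ?(ltW r0). Qed.

Let t1E : t1 r = z / k.
Proof.
rewrite /t1 powRN div1r powR12_sqrt ?subr_ge0 ?(le_trans _ r2) ?ler1n//.
by rewrite r1z invf_div.
Qed.

Let sk : s (z / k) = k^-1.
Proof.
rewrite /s (_ : 1 + _ = k^-1 ^+ 2) ?sqrtr_sqr ?ger0_norm ?invr_ge0 ?(ltW k0)//.
rewrite expr_div_n exprVn (_ : z ^+ 2 = 1 - k ^+ 2); last by rewrite kE; ring.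
by field; rewrite gt_eqF.
Qed.

Lemma U_closed : U r = 2 * ((2 * z + 2 + k) / (1 + k) - 2 * atan (z / k) / z
  + ln (1 + k) - ln z).
Proof.
have k10 : 0 < 1 + k by rewrite addr_gt0.
rewrite /U /Astar /Bstar t1E sk rz; congr (2 * _).
have -> : z / k / (k^-1 + 1) = z / (1 + k).
  by field; rewrite !gt_eqF.
rewrite ln_div ?posrE//; apply/eqP; rewrite -subr_eq0; apply/eqP.
move: (atan (z / k)) (ln z) (ln (1 + k)) => th lz lk.
rewrite (_ : _ - _ = - 2 * (1 - k ^+ 2 - z ^+ 2) / (z * k * (1 + k))); last first.
  by field; rewrite !gt_eqF// addr_gt0// invr_gt0.
by rewrite kE opprB addrCA subrr addr0 subrr mulr0 mul0r.
Qed.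

Lemma V_closed : V r = 2 * (z - sz + ln (z + sz) / z - 1 / (sz + 1)
  + ln (sz + 1) - ln z).
Proof.
rewrite /V /Cstar /Bstar t2E rz /s -/sz /arsinh -/sz; congr (2 * _).
rewrite ln_div ?posrE ?addr_gt0//.
by field; rewrite !gt_eqF// addr_gt0.
Qed.

(** The arctangent enters U negatively, so Shafer's lower bound, which is [6 / (2 + k)] after
    scaling, serves the upper bound of U. The right side is the expansion to first order in z^2. *)
Let h_upper : (2 + k) / (1 + k) - 6 / (2 + k) <= - (1 / 2) - 5 / 24 * z ^+ 2.
Proof.
have k1 : 0 < 1 + k by rewrite addr_gt0.
have k2 : 0 < 2 + k by rewrite addr_gt0.
have k3 : 1 - z ^+ 2 / 2 - z ^+ 2 ^+ 2 / 2 <= k.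
  have c : 0 <= 1 - z ^+ 2 / 2 - z ^+ 2 ^+ 2 / 2.
    by have := sqr_ge0 z; move: w_le; move: (z ^+ 2) => w; nra.
  have : (1 - z ^+ 2 / 2 - z ^+ 2 ^+ 2 / 2) ^+ 2 <= k ^+ 2.
    rewrite kE; have := sqr_ge0 z; move: w_le; move: (z ^+ 2) => w w2 w0.
    by rewrite -subr_ge0 (_ : _ - _ = w ^+ 2 * (3 / 4 - w / 2 - w ^+ 2 / 4));
      [apply: mulr_ge0; [exact: sqr_ge0|nra]|field].
  by rewrite ler_pXn2r ?nnegrE// ltW.
rewrite -subr_ge0 (_ : _ - _ = (2 * (1 + z ^+ 2 + 2 * k) - (1 + 5 / 12 * z ^+ 2) * (3 + 3 * k - z ^+ 2)
   + (k ^+ 2 - (1 - z ^+ 2)) * (- 2 - (1 + 5 / 12 * z ^+ 2))) / (2 * ((1 + k) * (2 + k)))); last first.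
  by field; rewrite !gt_eqF.
rewrite kE subrr mul0r addr0 divr_ge0// ?mulr_ge0 ?(ltW k1) ?(ltW k2)//.
by have := sqr_ge0 z; move: w_le k3; move: (z ^+ 2) => w w2 k3 w0; nra.
Qed.

Let sz_ge : 1 + z ^+ 2 / 2 - z ^+ 2 ^+ 2 / 8 <= sz.
Proof.
have c : 0 <= 1 + z ^+ 2 / 2 - z ^+ 2 ^+ 2 / 8.
  by have := sqr_ge0 z; move: w_le; move: (z ^+ 2) => w; nra.
have : (1 + z ^+ 2 / 2 - z ^+ 2 ^+ 2 / 8) ^+ 2 <= sz ^+ 2.
  rewrite szE; have := sqr_ge0 z; move: w_le; move: (z ^+ 2) => w w2 w0.
  by rewrite -subr_ge0 (_ : _ - _ = w ^+ 3 * (1 / 8 - w / 64));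
    [apply: mulr_ge0; [exact: exprn_ge0|lra]|field].
by rewrite ler_pXn2r ?nnegrE// ltW.
Qed.

Let sz_le : sz <= 1 + z ^+ 2 / 2.
Proof.
have c : 0 <= 1 + z ^+ 2 / 2 by have := sqr_ge0 z; lra.
have : sz ^+ 2 <= (1 + z ^+ 2 / 2) ^+ 2.
  rewrite szE; have := sqr_ge0 (z ^+ 2); nra.
by rewrite ler_pXn2r ?nnegrE// ltW.
Qed.

Let szV_ge : 1 / 2 - z ^+ 2 / 8 <= 1 / (sz + 1).
Proof.
rewrite ler_pdivlMr ?addr_gt0//.
have := sqr_ge0 z; move: w_le sz_le sz0; move: (z ^+ 2) sz => w x w2 h x0 w0; nra.
Qed.

Let lnz : 2 * ln z = - ln r.
Proof.
have -> : ln r = ln (z ^- 2) by rewrite -exprVn -rz sqr_sqrtr// ltW.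
by rewrite lnV ?posrE ?exprn_gt0// lnXn// opprK mulr_natl.
Qed.

Let asinh_ratio : ln (z + sz) / z <= 1 - z ^+ 2 / 6 + 3 / 40 * z ^+ 2 ^+ 2.
Proof.
rewrite ler_pdivrMr//; apply: le_trans (asinh_le z (ltW z0)) _.
by rewrite le_eqVlt; apply/orP; left; apply/eqP; field.
Qed.

Let atan_ratio : 6 / (2 + k) <= 2 * atan (z / k) / z.
Proof.
have h := atan_ge (z / k) (divr_ge0 (ltW z0) (ltW k0)).
rewrite -/(s (z / k)) sk in h.
rewrite ler_pdivlMr// -(ler_pM2l (ltr0n R 2)) in h *.
apply: le_trans h; rewrite le_eqVlt; apply/orP; left; apply/eqP.
by field; rewrite !gt_eqF// addr_gt0// invr_gt0.
Qed.

Lemma U_le : U r <= 2 * (2 * z / (1 + k) + ln (1 + k)) + ln r - 1 - 5 / 12 * z ^+ 2.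
Proof.
rewrite U_closed -[ln r]opprK -lnz.
have -> : (2 * z + 2 + k) / (1 + k) = 2 * z / (1 + k) + (2 + k) / (1 + k).
  by rewrite -[RHS]mulrDl; congr (_ / _); ring.
have := atan_ratio; have := h_upper; lra.
Qed.

Lemma V_le : V r <= ln r + 2 * (z + ln (1 + sz) - 1 / 2 - 13 / 24 * z ^+ 2 + 1 / 5 * z ^+ 2 ^+ 2).
Proof.
rewrite V_closed -[ln r]opprK -lnz (addrC sz 1).
have := asinh_ratio; have := szV_ge; have := sz_ge; rewrite (addrC sz 1).
have := sqr_ge0 (z ^+ 2); lra.
Qed.

Let root_sum c : c / (Num.sqrt r + Num.sqrt (r - 1)) = c * z / (1 + k).
Proof. by rewrite rz r1z; field; rewrite !gt_eqF// addr_gt0// divr_gt0. Qed.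

Let logs_le : ln (1 + k) + ln (1 + sz) <= 61 / 44.
Proof.
have k1 : 0 < 1 + k by rewrite addr_gt0.
have s1 : 0 < 1 + sz by rewrite addr_gt0.
(* The product (1 + k)(1 + sz) is at most 4, because k + sz <= 2 and k sz <= 1. *)
rewrite -lnM ?posrE//; apply: (@le_trans _ _ (ln (2 * 2))); last first.
  by rewrite lnM ?posrE//; have := @ln2_le R; lra.
rewrite ler_ln ?posrE ?mulr_gt0//.
have ks : k * sz <= 1.
  have : (k * sz) ^+ 2 <= 1 ^+ 2.
    rewrite exprMn kE szE expr1n.
    rewrite (_ : _ * _ = 1 - z ^+ 2 ^+ 2); last by ring.
    rewrite lerBlDr lerDl.
    by rewrite exprn_ge0// sqr_ge0.
  by rewrite ler_pXn2r ?nnegrE ?mulr_ge0// ltW.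
have k2 : k <= 1 - z ^+ 2 / 2.
  have c : 0 <= 1 - z ^+ 2 / 2 by move: w_le; lra.
  have : k ^+ 2 <= (1 - z ^+ 2 / 2) ^+ 2 by rewrite kE; have := sqr_ge0 (z ^+ 2); nra.
  by rewrite ler_pXn2r ?nnegrE// ltW.
rewrite (_ : (1 + k) * (1 + sz) = 1 + k + sz + k * sz); last by ring.
by move: ks k2 sz_le; lra.
Qed.

(** The terms in z / (1 + k) cancel between [U_le] and the third summand of [Ginfty]. With the
    bounds for pi and the logarithms, what remains after moving the linear form over is at least
    [P], whose minimum lies near z = 0.3. *)
Lemma Ginfty_ge : 731 / 100 - 2 * ln r - 316 / 100 * z <= Ginfty r.
Proof.
rewrite /Ginfty root_sum /I0 rz invrK.
have := U_le; have := V_le; have := logs_le; have := @pi_ge R.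
have P : 0 <= 18 / 100 - 84 / 100 * z + 15 / 10 * z ^+ 2 - 4 / 10 * z ^+ 2 ^+ 2.
  have h : 0 <= z ^+ 2 * (1 / 2 - z ^+ 2) by rewrite mulr_ge0 ?sqr_ge0// subr_ge0.
  by have := sqr_ge0 (z - 323 / 1000); move: h z_le1; lra.
rewrite -(mulrA 2 z) -(mulrA 4 z); move: P.
move: (z / (1 + k)) (ln (1 + k)) (ln (1 + sz)) (ln r) (pi) (U r) (V r).
move: (z ^+ 2) => w y lk ls lr p u v.
by lra.
Qed.

Lemma Grep_ge : 463 / 50 - 2 * ln r - 351 / 50 * z <= Grep r.
Proof.
rewrite /Grep root_sum rz invrK.
have lk : ln (1 + k) <= 61 / 88.
  apply: le_trans (@ln2_le R); rewrite ler_ln ?posrE ?addr_gt0//.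
  by move: k_le1; lra.
have := U_le; have := @pi_ge R; move: lk (ltW z0) (sqr_ge0 z).
rewrite -(mulrA 2 z) -(mulrA 8 z).
move: (z / (1 + k)) (ln (1 + k)) (ln r) (pi) (U r) (z ^+ 2) => y lk lr p u w.
by lra.
Qed.

Let k_ge : 7 / 10 <= k.
Proof.
have c : 0 <= 7 / 10 :> R by lra.
have : (7 / 10) ^+ 2 <= k ^+ 2 by rewrite kE; move: w_le; lra.
by rewrite ler_pXn2r ?nnegrE// ltW.
Qed.

Let lnz_le0 : ln z <= 0. Proof. exact: ln_le0. Qed.

(** Crude, like the next three bounds: they only serve to control the size of the coefficients for
    absolute convergence. *)
Lemma U_ge : - 6 <= U r.
Proof.
rewrite U_closed.
have a : 2 * atan (z / k) / z <= 20 / 7.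
  have h := @atan_le (z / k) (divr_ge0 (ltW z0) (ltW k0)).
  rewrite ler_pdivrMr//; apply: le_trans (ler_wpM2l (ler0n R 2) h) _.
  rewrite mulrA ler_pdivrMr//; have := mulr_ge0 (ltW z0) (ltW k0).
  have : 0 <= z * (k - 7 / 10) by rewrite mulr_ge0 ?subr_ge0// ltW.
  by lra.
have b : 0 <= (2 * z + 2 + k) / (1 + k).
  by rewrite divr_ge0 ?addr_ge0 ?mulr_ge0 ?(ltW z0) ?(ltW k0).
have c : 0 <= ln (1 + k) by rewrite ln_ge0// lerDl ltW.
by move: a b c lnz_le0; lra.
Qed.

Lemma V_ge : - 4 <= V r.
Proof.
rewrite V_closed.
have a : 0 <= ln (z + sz) / z.
  rewrite divr_ge0 ?(ltW z0)// ln_ge0//.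
  have : 1 ^+ 2 <= sz ^+ 2 by rewrite szE expr1n lerDl sqr_ge0.
  rewrite ler_pXn2r ?nnegrE ?(ltW sz0)// => s1.
  by rewrite -[X in X <= _]add0r lerD// ltW.
have b : 0 <= ln (sz + 1) by rewrite ln_ge0// lerDr ltW.
have c : 1 / (sz + 1) <= 1 / 2.
  rewrite !div1r lef_pV2 ?posrE ?addr_gt0//.
  have : 1 ^+ 2 <= sz ^+ 2 by rewrite szE expr1n lerDl sqr_ge0.
  by rewrite ler_pXn2r ?nnegrE ?(ltW sz0)// => s1; lra.
by move: a b c lnz_le0 sz_le w_le (ltW z0); lra.
Qed.

Let y_le : z / (1 + k) <= 1.
Proof.
rewrite ler_pdivrMr ?addr_gt0// mul1r; apply: le_trans z_le1 _.
by rewrite lerDl ltW.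
Qed.

Lemma Ginfty_le : Ginfty r <= 32.
Proof.
rewrite /Ginfty root_sum /I0 rz invrK -(mulrA 4 z).
have := U_ge; have := V_ge; have := pihalf_lt2 R; move: y_le (ltW z0).
by move: (z / _) (U r) (V r) (pi) => y u v p; lra.
Qed.

Lemma Grep_le : Grep r <= 32.
Proof.
rewrite /Grep root_sum rz invrK -(mulrA 8 z).
have := U_ge; have := pihalf_lt2 R; move: y_le (ltW z0).
by move: (z / _) (U r) (pi) => y u p; lra.
Qed.

End at_ratio.

Lemma d0_ge : 111 / 100 <= d0 R.
Proof. by rewrite /d0; have := @pi_ge R; lra. Qed.

Lemma g0_ge : 329 / 50 <= g0 R.
Proof.
have s1 := @sqrt2_ge R; have s2 := @sqrt2_le R.
have l : ln (1 + Num.sqrt 2) <= 61 / 88 + 29 / 140 :> R.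
  (* Splitting off log 2 leaves log (1 + x) <= x at x = (sqrt 2 - 1) / 2, and 29/140 = (99/70 - 1) /
     2. *)
  rewrite (_ : 1 + Num.sqrt 2 = 2 * (1 + (Num.sqrt 2 - 1) / 2)); last by field.
  have p : 0 < 1 + (Num.sqrt 2 - 1) / 2 :> R by lra.
  rewrite lnM ?posrE// lerD ?ln2_le//.
  by apply: le_trans (le_ln1Dx _) _; lra.
by rewrite /g0; have := @pi_ge R; lra.
Qed.
End closed_forms.

(** * The limiting form on the integers *)

Section exhaustion.
Context {R : realType} {T : choiceType} (D : set T) (L : nat -> seq T).
Hypothesis Luniq : forall n, uniq (L n).
Hypothesis LD : forall n x, x \in L n -> D x.
Hypothesis Lall : forall x, D x -> exists N, forall n, (N <= n)%N -> x \in L n.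

Lemma exhaustion_finite n : finite_set [set` L n].
Proof. by apply/finite_seqP; exists (L n). Qed.

Lemma exhaustion_absorbs (A : set T) : finite_set A -> A `<=` D ->
  exists N, forall n, (N <= n)%N -> A `<=` [set` L n].
Proof.
move=> finA AD.
have [h hP] : {h : T -> nat & forall x, D x -> forall n, (h x <= n)%N -> x \in L n}.
  have /choice[h hP] : forall x, exists N, D x -> forall n, (N <= n)%N -> x \in L n.
    move=> x; case: (pselect (D x)) => [/Lall[N NP]|nD]; first by exists N.
    by exists 0%N.
  by exists h.
case/finite_seqP: finA => r rE; exists (\max_(x <- r) h x)%N => n hn x Ax /=.
apply: hP; first exact: AD.
by apply: leq_trans hn; apply: leq_bigmax_seq => //; move: Ax; rewrite rE.
Qed.

Lemma exhaustion_sum_le (f : T -> R) n : (forall x, 0 <= f x) ->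
  ((\sum_(x <- L n) f x)%:E <= \esum_(x in D) (f x)%:E)%E.
Proof.
move=> f0; apply: esum_ge; exists [set` L n].
  by split; [exact: exhaustion_finite|move=> x /=; exact: LD].
by rewrite -fsbig_seq// -sumEFin.
Qed.

Lemma exhaustion_esum_le (f : T -> R) (C : \bar R) : (forall x, 0 <= f x) ->
  (\forall n \near \oo, ((\sum_(x <- L n) f x)%:E <= C)%E) ->
  (\esum_(x in D) (f x)%:E <= C)%E.
Proof.
move=> f0 [N0 _ hC]; apply: ge_ereal_sup => _ [A [finA AD] <-].
have [N hN] := exhaustion_absorbs A finA AD.
apply: (@le_trans _ _ (\sum_(x \in [set` L (maxn N N0)]) (f x)%:E)%E).
  apply: lee_fsum_nneg_subset => //.
  - by apply/subsetP; apply: hN; rewrite leq_maxl.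
  - by move=> x _; rewrite lee_fin.
by rewrite -fsbig_seq// sumEFin; apply: hC; rewrite /= leq_maxr.
Qed.

Lemma exhaustion_cvg_nneg (f : T -> R) : (forall x, 0 <= f x) ->
  (\esum_(x in D) (f x)%:E < +oo)%E ->
  exists2 S, (\esum_(x in D) (f x)%:E = S%:E)%E &
    (fun n => \sum_(x <- L n) f x) @ \oo --> S.
Proof.
move=> f0 fin.
have fnum : \esum_(x in D) (f x)%:E \is a fin_num.
  by rewrite ge0_fin_numE//; apply: esum_ge0 => x _; rewrite lee_fin.
exists (fine (\esum_(x in D) (f x)%:E)); first by rewrite fineK.
set S := fine _; have SE : (\esum_(x in D) (f x)%:E = S%:E)%E by rewrite fineK.
apply/cvgrPdist_le => e e0.
have : ((S - e)%:E < \esum_(x in D) (f x)%:E)%E by rewrite SE lte_fin gtrBl.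
move=> /ereal_sup_gt[_ [A [finA AD] <-] hA].
have [N hN] := exhaustion_absorbs A finA AD.
exists N => // n /= Nn.
have h1 : \sum_(x <- L n) f x <= S by rewrite -lee_fin -SE; exact: exhaustion_sum_le.
have h2 : S - e <= \sum_(x <- L n) f x.
  rewrite -lee_fin; apply: le_trans (ltW hA) _.
  apply: (@le_trans _ _ (\sum_(x \in [set` L n]) (f x)%:E)%E).
    apply: lee_fsum_nneg_subset => //.
    - by apply/subsetP; apply: hN.
    - by move=> x _; rewrite lee_fin.
  by rewrite -fsbig_seq// sumEFin.
by rewrite ger0_norm ?subr_ge0//; lra.
Qed.

(** Identifies [abs_sum], defined by positive and negative parts, with the limit of plain finite
    sums, the form in which the chain inequality is available. *)
Lemma exhaustion_cvg (f : T -> R) : summable D (EFin \o f) ->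
  exists2 S, abs_sum D f = S%:E & (fun n => \sum_(x <- L n) f x) @ \oo --> S.
Proof.
move=> sf.
have pos0 x : 0 <= f^\+ x by rewrite le_max lexx orbT.
have neg0 x : 0 <= f^\- x by rewrite le_max lexx orbT.
have pfin : (\esum_(x in D) (f^\+ x)%:E < +oo)%E.
  apply: le_lt_trans sf; apply: le_esum => x _; rewrite lee_fin.
  by rewrite ge_max ler_norm normr_ge0.
have nfin : (\esum_(x in D) (f^\- x)%:E < +oo)%E.
  apply: le_lt_trans sf; apply: le_esum => x _; rewrite lee_fin.
  by rewrite ge_max ler_normr lexx orbT normr_ge0.
have [P PE cP] := exhaustion_cvg_nneg _ pos0 pfin.
have [N NE cN] := exhaustion_cvg_nneg _ neg0 nfin.
exists (P - N); first by rewrite /abs_sum PE NE.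
rewrite (_ : (fun n => _) = (fun n => \sum_(x <- L n) f^\+ x) \- (fun n => \sum_(x <- L n) f^\- x)).
  exact: cvgB.
apply/funext => n /=; rewrite -sumrB; apply: eq_bigr => x _.
by have /(congr1 (@^~ x)) := funrposBneg f.
Qed.
End exhaustion.

(** * Geometric weights, for absolute convergence *)

Section geometric_weights.
Context {R : realFieldType}.
Variables (q : R) (m : nat).
Hypotheses (q0 : 0 <= q) (q1 : q < 1).
Let kappa := q / (1 - q).

Lemma exchange_triangle (f : nat -> nat -> R) :
  \sum_(0 <= j < m) \sum_(j.+1 <= k < m) f j k =
  \sum_(0 <= k < m) \sum_(0 <= j < k) f j k.
Proof.
elim: m => [|n IH]; first by rewrite !big_geq.
rewrite big_nat_recr//= [X in _ + X]big_geq// addr0 [RHS]big_nat_recr//= -IH.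
rewrite -big_split/=; apply: eq_big_nat => j /andP[_ jn].
by rewrite big_nat_recr.
Qed.

Lemma geometric_ratio : q * (kappa + 1) = kappa.
Proof. by rewrite /kappa; field; rewrite subr_eq0 eq_sym lt_eqF. Qed.

Lemma geometric_ratio_ge0 : 0 <= kappa.
Proof. by rewrite divr_ge0// subr_ge0 ltW. Qed.

Lemma geometric_past_le j : \sum_(0 <= i < j) q ^+ (j - i) <= kappa.
Proof.
rewrite (_ : \sum_(_ <= _ < _) _ = past q (fun=> 1) (fun=> 1) j); last first.
  by apply: eq_bigr => i _; rewrite mul1r mulr1.
elim: j => [|j IH]; first by rewrite past0 geometric_ratio_ge0.
by rewrite pastS -[leRHS]geometric_ratio ler_wpM2l// lerD2r.
Qed.

Lemma geometric_future_le j : \sum_(j.+1 <= k < m) q ^+ (k - j) <= kappa.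
Proof.
have -> : \sum_(j.+1 <= k < m) q ^+ (k - j) = \sum_(0 <= i < m - j.+1) q ^+ (m - j.+1 - i).
  rewrite -{1}[j.+1]add0n big_addn big_nat_rev/= add0n; apply: eq_big_nat => i /andP[_ hi].
  by congr (_ ^+ _); lia.
exact: geometric_past_le.
Qed.

Lemma weighted_past_le (a : nat -> R) : (forall i, 0 <= a i) ->
  \sum_(0 <= j < m) \sum_(0 <= i < j) q ^+ (j - i) * a i <= kappa * \sum_(0 <= j < m) a j.
Proof.
move=> a0.
rewrite (eq_bigr (fun j => past q (fun=> 1) a j)); last first.
  by move=> j _; apply: eq_bigr => i _; rewrite mul1r.
rewrite /kappa mulrAC ler_pdivlMr ?subr_gt0//.
(* Summing the recursion past_(j+1) = q (past_j + a_j) gives an exact identity whose boundary term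
   has the good sign. *)
suff <- : \sum_(0 <= j < m) past q (fun=> 1) a j * (1 - q) + past q (fun=> 1) a m
    = q * \sum_(0 <= j < m) a j.
  by rewrite mulr_suml lerDl past_ge0.
elim: m => [|n IH]; first by rewrite !big_geq// past0 mulr0 addr0.
by rewrite !big_nat_recr//= [RHS]mulrDr -IH pastS; ring.
Qed.

Lemma weighted_self_past_le (a : nat -> R) : (forall i, 0 <= a i) ->
  \sum_(0 <= j < m) \sum_(0 <= i < j) q ^+ (j - i) * a j <= kappa * \sum_(0 <= j < m) a j.
Proof.
move=> a0; rewrite mulr_sumr; apply: ler_sum => j _.
by rewrite -mulr_suml ler_wpM2r// geometric_past_le.
Qed.

Lemma weighted_pairs_le (a : nat -> R) : (forall i, 0 <= a i) ->
  \sum_(0 <= j < m) \sum_(0 <= i < j) q ^+ (j - i) * (a i + a j)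
  <= 2 * kappa * \sum_(0 <= j < m) a j.
Proof.
move=> a0.
rewrite (eq_bigr (fun j => \sum_(0 <= i < j) q ^+ (j - i) * a i
    + \sum_(0 <= i < j) q ^+ (j - i) * a j)); last first.
  by move=> j _; rewrite -big_split; apply: eq_bigr => i _; rewrite mulrDr.
rewrite big_split/= -mulrA mulr_natl mulr2n lerD//.
  exact: weighted_past_le.
exact: weighted_self_past_le.
Qed.

Lemma weighted_triples_le (a : nat -> R) : (forall i, 0 <= a i) ->
  \sum_(0 <= j < m) \sum_(0 <= i < j) \sum_(j.+1 <= k < m)
     q ^+ (j - i) * q ^+ (k - j) * (a i + a j + a k)
  <= 3 * kappa ^+ 2 * \sum_(0 <= j < m) a j.
Proof.
move=> a0.
have S0 i j : 0 <= \sum_(0 <= l < j | true) q ^+ (i - l) by rewrite sumr_ge0// => k _; rewrite exprn_ge0.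
have Sa i j (p q' : nat -> nat) : 0 <= \sum_(i <= l < j | true) q ^+ (p l) * a (q' l).
  by rewrite sumr_ge0// => k _; rewrite mulr_ge0// exprn_ge0.
rewrite (eq_bigr (fun j =>
    (\sum_(0 <= i < j) q ^+ (j - i) * a i) * (\sum_(j.+1 <= k < m) q ^+ (k - j))
  + (\sum_(0 <= i < j) q ^+ (j - i) * a j) * (\sum_(j.+1 <= k < m) q ^+ (k - j))
  + (\sum_(0 <= i < j) q ^+ (j - i)) * (\sum_(j.+1 <= k < m) q ^+ (k - j) * a k))); last first.
  move=> j _; rewrite !mulr_suml -!big_split; apply: eq_bigr => i _ /=.
  by rewrite !mulr_sumr -!big_split; apply: eq_bigr => k _ /=; ring.
rewrite !big_split/= (_ : 3 * kappa ^+ 2 * _ = kappa * (kappa * \sum_(0 <= j < m) a j)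
   + kappa * (kappa * \sum_(0 <= j < m) a j) + kappa * (kappa * \sum_(0 <= j < m) a j)); last by ring.
have k0 := geometric_ratio_ge0.
apply: lerD; [apply: lerD|].
- apply: (@le_trans _ _ (\sum_(0 <= j < m) kappa * \sum_(0 <= i < j) q ^+ (j - i) * a i)).
    by apply: ler_sum => j _; rewrite mulrC ler_wpM2r// geometric_future_le.
  by rewrite -mulr_sumr ler_wpM2l// weighted_past_le.
- apply: (@le_trans _ _ (\sum_(0 <= j < m) kappa * \sum_(0 <= i < j) q ^+ (j - i) * a j)).
    by apply: ler_sum => j _; rewrite mulrC ler_wpM2r// geometric_future_le.
  by rewrite -mulr_sumr ler_wpM2l// weighted_self_past_le.
- apply: (@le_trans _ _ (\sum_(0 <= j < m) kappa * \sum_(j.+1 <= k < m) q ^+ (k - j) * a k)).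
    by apply: ler_sum => j _; rewrite ler_wpM2r// geometric_past_le.
  by rewrite -mulr_sumr ler_wpM2l// exchange_triangle weighted_self_past_le.
Qed.

End geometric_weights.

Lemma prod3_le_cubes {R : realFieldType} (x y z : R) : 0 <= x -> 0 <= y -> 0 <= z ->
  x * y * z <= x ^+ 3 + y ^+ 3 + z ^+ 3.
Proof.
have top (a b c : R) : 0 <= a -> 0 <= b -> 0 <= c -> b <= a -> c <= a ->
    a * b * c <= a ^+ 3.
  by move=> a0 b0 c0 ba ca; rewrite !exprS expr0 mulr1 mulrA !ler_pM// mulr_ge0.
move=> x0 y0 z0.
have x30 := exprn_ge0 3 x0; have y30 := exprn_ge0 3 y0; have z30 := exprn_ge0 3 z0.
case: (leP x y) => [xy|/ltW yx].
  case: (leP y z) => [yz|/ltW zy].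
    by have := top z y x z0 y0 x0 yz (le_trans xy yz); lra.
  by have := top y x z y0 x0 z0 xy zy; lra.
case: (leP x z) => [xz|/ltW zx].
  by have := top z y x z0 y0 x0 (le_trans yx xz) xz; lra.
by have := top x y z x0 y0 z0 yx zx; lra.
Qed.

Lemma prod2_le_cubes {R : realFieldType} (x y : R) : 0 <= x -> 0 <= y ->
  x ^+ 2 * y <= 2 * (x ^+ 3 + y ^+ 3).
Proof.
move=> x0 y0; have := prod3_le_cubes x x y x0 x0 y0; rewrite -expr2.
by have := exprn_ge0 3 y0; lra.
Qed.

(** Moves the integers from -n to n onto the indices 0 to 2n, so that the chain inequality for
    natural indices applies to a symmetric window of length [n.*2.+1]. *)
Definition shift (n i : nat) : int := i%:Z - n%:Z.

Definition window (n : nat) : seq int := [seq shift n i | i <- index_iota 0 n.*2.+1].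

Definition pair_window (n : nat) : seq (int * int) :=
  [seq p <- [seq (x, y) | x <- window n, y <- window n] | p.1 < p.2].

Definition triple_window (n : nat) : seq (int * int * int) :=
  [seq p <- [seq (p, z) | p <- [seq (x, y) | x <- window n, y <- window n], z <- window n]
         | (p.1.1 < p.1.2) && (p.1.2 < p.2)].

Lemma shift_inj n : injective (shift n).
Proof. by move=> i j; rewrite /shift; lia. Qed.

Lemma shift_lt n i j : (shift n i < shift n j) = (i < j)%N.
Proof. by rewrite /shift; lia. Qed.

Lemma shiftB n i j : (i <= j)%N -> shift n j - shift n i = (j - i)%N.
Proof. by rewrite /shift; lia. Qed.

Lemma mem_window n x : (x \in window n) = (`|x|%N <= n)%N.
Proof.
apply/mapP/idP => [[i]|xn].
  by rewrite mem_index_iota /shift => /andP[_ hi] ->; lia.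
exists (absz (x + n%:Z)); last by rewrite /shift; lia.
by rewrite mem_index_iota; lia.
Qed.

Lemma window_uniq n : uniq (window n).
Proof. by rewrite map_inj_uniq ?iota_uniq//; exact: shift_inj. Qed.

Lemma mem_pairs {S T : eqType} (s : seq S) (t : seq T) p :
  (p \in [seq (x, y) | x <- s, y <- t]) = (p.1 \in s) && (p.2 \in t).
Proof.
apply/allpairsP/andP => [[[a b] [/= ha hb ->]]//|].
by case: p => a b [ha hb]; exists (a, b).
Qed.

Lemma mem_pair_window n p :
  (p \in pair_window n) = (p.1 < p.2) && (p.1 \in window n) && (p.2 \in window n).
Proof. by rewrite mem_filter mem_pairs andbA. Qed.

Lemma mem_triple_window n p :
  (p \in triple_window n) =
  (p.1.1 < p.1.2) && (p.1.2 < p.2) && [&& p.1.1 \in window n, p.1.2 \in window n & p.2 \in window n].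
Proof. by rewrite mem_filter !mem_pairs !andbA. Qed.

Lemma pair_window_uniq n : uniq (pair_window n).
Proof.
by apply: filter_uniq; apply: allpairs_uniq; rewrite ?window_uniq// => -[a b] [c d].
Qed.

Lemma triple_window_uniq n : uniq (triple_window n).
Proof.
apply: filter_uniq; apply: allpairs_uniq; rewrite ?window_uniq//; last by move=> -[a b] [c d].
by apply: allpairs_uniq; rewrite ?window_uniq// => -[a b] [c d].
Qed.

Section window_sums.
Context {R : realType}.
Variable n : nat.
Let m := n.*2.+1.
Let c := shift n.

Lemma window_sum (f : int -> R) :
  \sum_(x <- window n) f x = \sum_(0 <= i < m) f (c i).
Proof. by rewrite big_map. Qed.

Lemma sum_lt (f : nat -> R) k : (k <= m)%N ->
  \sum_(0 <= i < m) (if (i < k)%N then f i else 0) = \sum_(0 <= i < k) f i.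
Proof.
move=> km; rewrite -big_mkcond/= (big_nat_widen 0 k m)//.
Qed.

Lemma sum_gt (f : nat -> R) k :
  \sum_(0 <= i < m) (if (k < i)%N then f i else 0) = \sum_(k.+1 <= i < m) f i.
Proof.
rewrite -big_mkcond/= (big_nat_widenl k.+1 0)//.
Qed.

Lemma pair_window_sum (f : int * int -> R) :
  \sum_(p <- pair_window n) f p = \sum_(0 <= k < m) \sum_(0 <= i < k) f (c i, c k).
Proof.
rewrite big_filter big_mkcond big_allpairs/= big_map exchange_big/= big_map.
apply: eq_big_nat => k /andP[_ km].
rewrite -(@sum_lt _ k (ltnW km)); apply: eq_bigr => i _.
by rewrite shift_lt.
Qed.

Lemma triple_window_sum (f : int * int * int -> R) :
  \sum_(p <- triple_window n) f p =
  \sum_(0 <= j < m) \sum_(0 <= i < j) \sum_(j.+1 <= k < m) f (c i, c j, c k).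
Proof.
rewrite big_filter big_mkcond !big_allpairs/= big_map exchange_big/= big_map.
apply: eq_big_nat => j /andP[_ jm].
rewrite -(@sum_lt _ j (ltnW jm)); apply: eq_bigr => i _.
rewrite big_map shift_lt; case: ifP => ij; last by rewrite big1.
rewrite -(sum_gt _ j); apply: eq_bigr => k _.
by rewrite shift_lt.
Qed.

End window_sums.

Lemma pair_window_exhausts p : lt_pairs p ->
  exists N, forall n, (N <= n)%N -> p \in pair_window n.
Proof.
move=> p12; exists (maxn `|p.1| `|p.2|)%N => n; rewrite geq_max => /andP[h1 h2].
by rewrite mem_pair_window !mem_window h1 h2 !andbT.
Qed.

Lemma triple_window_exhausts p : lt_triples p ->
  exists N, forall n, (N <= n)%N -> p \in triple_window n.
Proof.
move=> [p12 p23]; exists (maxn (maxn `|p.1.1| `|p.1.2|) `|p.2|)%N => n.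
rewrite !geq_max => /andP[/andP[h1 h2] h3].
by rewrite mem_triple_window !mem_window h1 h2 h3 p12 p23.
Qed.

Section energy_coefficients.
Context {R : realType}.
Local Notation q := (q R).

Lemma q_gt0 : 0 < q.
Proof. exact: powR_gt0. Qed.

Lemma q_expr6 : q ^+ 6 = 1 / 2.
Proof.
rewrite -powR_mulrn ?powR_ge0// -powRrM (_ : - (1 / 6) * 6%:R = - 1); last by field.
by rewrite powRN powRr1// mul1r.
Qed.

Lemma q_lt1 : q < 1.
Proof.
rewrite ltNge; apply/negP => q1; have := exprn_ege1 6 q1.
by rewrite q_expr6; lra.
Qed.

Lemma sqrt_pow2V d : (Num.sqrt (2 ^+ d))^-1 = q ^+ (3 * d).
Proof.
have q3d : 0 < q ^+ (3 * d) by rewrite exprn_gt0// q_gt0.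
rewrite -[RHS]invrK; congr (_^-1).
rewrite (_ : 2 ^+ d = (q ^+ (3 * d))^-1 ^+ 2).
  by rewrite sqrtr_sqr gtr0_norm// invr_gt0.
rewrite exprVn -exprM (_ : (3 * d * 2 = 6 * d)%N); last by lia.
by rewrite exprM q_expr6 mul1r exprVn invrK.
Qed.

Lemma pow2_ge2 d : (0 < d)%N -> 2 <= 2 ^+ d :> R.
Proof. by case: d => // d _; rewrite exprS ler_peMr// exprn_ege1// ler1n. Qed.

Lemma ln_pow2_le d : ln (2 ^+ d) <= d%:R * (61 / 88) :> R.
Proof. by rewrite lnXn// -[_ *+ d]mulr_natl ler_wpM2l// ln2_le. Qed.

Lemma g_ge d : (0 < d)%N ->
  731 / 100 - 2 * (d%:R * (61 / 88)) - 316 / 100 * q ^+ (3 * d) <= g R d.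
Proof.
move=> d0; apply: le_trans (Ginfty_ge _ (pow2_ge2 d d0)).
by rewrite sqrt_pow2V; have := ln_pow2_le d; lra.
Qed.

Lemma h_ge d : (0 < d)%N ->
  463 / 50 - 2 * (d%:R * (61 / 88)) - 351 / 50 * q ^+ (3 * d) <= h R d.
Proof.
move=> d0; apply: le_trans (Grep_ge _ (pow2_ge2 d d0)).
by rewrite sqrt_pow2V; have := ln_pow2_le d; lra.
Qed.

Lemma q_expr_le1 d : q ^+ d <= 1.
Proof. by rewrite exprn_ile1 ?(ltW q_gt0) ?(ltW q_lt1). Qed.

Lemma g_norm_le d : (0 < d)%N -> `|g R d| <= 32 + 2 * d%:R.
Proof.
move=> d0; have := g_ge d d0; have := Ginfty_le _ (pow2_ge2 d d0).
rewrite -[Ginfty _]/(g R d) ler_norml; have := q_expr_le1 (3 * d).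
by have := ler0n R d; move=> h1 h2 h3 h4; apply/andP; split; lra.
Qed.

Lemma h_norm_le d : (0 < d)%N -> `|h R d| <= 32 + 2 * d%:R.
Proof.
move=> d0; have := h_ge d d0; have := Grep_le _ (pow2_ge2 d d0).
rewrite -[Grep _]/(h R d) ler_norml; have := q_expr_le1 (3 * d).
by have := ler0n R d; move=> h1 h2 h3 h4; apply/andP; split; lra.
Qed.

Definition coef_bound : R := 32 + 2 * (q / (1 - q)).

(** Half of the decay pays for the linear growth: d q^d is at most q + ... + q^d, since each of
    these d terms is at least q^d. *)
Lemma linear_decay d (x : R) : `|x| <= 32 + 2 * d%:R ->
  `|x| * q ^+ (2 * d) <= coef_bound * q ^+ d.
Proof.
move=> hx; have qd0 := exprn_ge0 d (ltW q_gt0).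
rewrite mul2n -addnn exprD mulrA ler_wpM2r//.
apply: le_trans (ler_wpM2r qd0 hx) _.
have h : d%:R * q ^+ d <= q / (1 - q).
  apply: le_trans (geometric_past_le _ (ltW q_gt0) q_lt1 d).
  rewrite mulr_natl -[X in _ *+ X]subn0 -[X in X <= _]sumr_const_nat.
  apply: ler_sum_nat => i /andP[_ hi].
  by rewrite ler_wiXn2l ?(ltW q_gt0) ?(ltW q_lt1)// leq_subr.
by rewrite /coef_bound mulrDl -mulrA lerD// ?ler_wpM2l// ler_piMr// q_expr_le1.
Qed.

Lemma coef_bound_ge0 : 0 <= coef_bound.
Proof. by rewrite addr_ge0// mulr_ge0// (geometric_ratio_ge0 _ (ltW q_gt0) q_lt1). Qed.

End energy_coefficients.

Lemma exhaustion_summable {R : realType} {T : choiceType} (D : set T) (L : nat -> seq T)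
    (f : T -> R) (C : R) : (forall n, uniq (L n)) ->
  (forall x, D x -> exists N, forall n, (N <= n)%N -> x \in L n) ->
  (forall n, \sum_(x <- L n) `|f x| <= C) -> summable D (EFin \o f).
Proof.
move=> Lu La h; apply: (@le_lt_trans _ _ C%:E); last exact: ltry.
rewrite (eq_esum (fun x _ => erefl : `|(EFin \o f) x|%E = (`|f x|)%:E)).
apply: (exhaustion_esum_le D L Lu La (fun x => `|f x|)) => //.
by exists 0%N => // n _; rewrite lee_fin.
Qed.

(** * The cubic form: absolute convergence and lower bound *)

Section cubic_energy.
Context {R : realType}.
Variable u : int -> R.
Hypotheses (u0 : forall j, 0 <= u j) (ul3 : in_ell3 u).
Local Notation q := (q R).
Let q0 := @q_gt0 R.
Let q00 := ltW q0.
Let q1 := @q_lt1 R.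

Lemma term_iik_shift n i k : (i <= k)%N ->
  term_iik u (shift n i, shift n k) = q ^+ (k - i) * u (shift n i) ^+ 2 * u (shift n k).
Proof. by move=> ik; rewrite /term_iik shiftB. Qed.

Lemma term_ijj_shift n i j : (i <= j)%N ->
  term_ijj u (shift n i, shift n j) =
  h R (j - i)%N * q ^+ (2 * (j - i)) * u (shift n i) * u (shift n j) ^+ 2.
Proof. by move=> ij; rewrite /term_ijj shiftB. Qed.

Lemma term_ijk_shift n i j k : (i <= j)%N -> (j <= k)%N ->
  term_ijk u (shift n i, shift n j, shift n k) =
  g R (j - i)%N * q ^+ (2 * (j - i) + (k - j))
    * u (shift n i) * u (shift n j) * u (shift n k).
Proof.
move=> ij jk; rewrite /term_ijk !shiftB ?(leq_trans ij)//.
rewrite (_ : (j - i)%N%:Z + (k - i)%N%:Z = (2 * (j - i) + (k - j))%N)//.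
by lia.
Qed.

Lemma cubes_summable : summable setT (fun i => (u i ^+ 3)%:E).
Proof.
have := ul3; rewrite /in_ell3 (_ : (fun i => _) = (fun i => (u i ^+ 3)%:E))//.
by apply/funext => i; rewrite ger0_norm.
Qed.

Lemma window_exhausts x : [set: int] x ->
  exists N, forall n, (N <= n)%N -> x \in window n.
Proof. by move=> _; exists `|x|%N => n; rewrite mem_window. Qed.

Let S := fine (\esum_(i in [set: int]) (u i ^+ 3)%:E)%E.

Lemma cubes_sum : (\esum_(i in [set: int]) (u i ^+ 3)%:E = S%:E)%E.
Proof.
rewrite fineK// ge0_fin_numE ?esum_ge0//; last first.
  by move=> i _; rewrite lee_fin exprn_ge0.
apply: le_lt_trans cubes_summable; apply: le_esum => i _ /=.
by rewrite lee_fin ler_norm.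
Qed.

Lemma window_cubes_le n : \sum_(x <- window n) u x ^+ 3 <= S.
Proof.
rewrite -lee_fin -cubes_sum; apply: (exhaustion_sum_le _ _ window_uniq _ (fun x => u x ^+ 3)) => // x.
exact: exprn_ge0.
Qed.

Lemma shift_cubes_le n : \sum_(0 <= j < n.*2.+1) u (shift n j) ^+ 3 <= S.
Proof. by rewrite -(window_sum n (fun x => u x ^+ 3)) window_cubes_le. Qed.

Let kappa := q / (1 - q).
Let kappa0 : 0 <= kappa := geometric_ratio_ge0 q q00 q1.
Let cube0 n j : 0 <= u (shift n j) ^+ 3 := exprn_ge0 3 (u0 (shift n j)).
Let B0 := @coef_bound_ge0 R.

Lemma iik_summable : summable lt_pairs (EFin \o term_iik u).
Proof.
apply: (exhaustion_summable _ _ _ (2 * (2 * kappa * S)) pair_window_uniq pair_window_exhausts) => n.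
rewrite (pair_window_sum n (fun p => `|term_iik u p|)).
apply: (@le_trans _ _ (2 * (2 * kappa * \sum_(0 <= j < n.*2.+1) u (shift n j) ^+ 3))); last first.
  by rewrite ler_wpM2l// ler_wpM2l ?shift_cubes_le// mulr_ge0.
apply: le_trans (ler_wpM2l _ (weighted_pairs_le q n.*2.+1 q00 q1 (fun j => u (shift n j) ^+ 3) (cube0 n))) => //.
rewrite mulr_sumr; apply: ler_sum => k _; rewrite mulr_sumr; apply: ler_sum_nat => i /andP[_ ik].
rewrite term_iik_shift ?(ltnW ik)// -mulrA ger0_norm; last by rewrite !mulr_ge0// exprn_ge0.
by rewrite [leRHS]mulrCA ler_wpM2l ?exprn_ge0// prod2_le_cubes.
Qed.

Lemma ijj_summable : summable lt_pairs (EFin \o term_ijj u).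
Proof.
apply: (exhaustion_summable _ _ _ (2 * coef_bound * (2 * kappa * S)) pair_window_uniq pair_window_exhausts) => n.
rewrite (pair_window_sum n (fun p => `|term_ijj u p|)).
apply: (@le_trans _ _ (2 * coef_bound * (2 * kappa * \sum_(0 <= j < n.*2.+1) u (shift n j) ^+ 3))); last first.
  by rewrite ler_wpM2l ?mulr_ge0// ler_wpM2l ?shift_cubes_le// mulr_ge0.
apply: le_trans (ler_wpM2l _ (weighted_pairs_le q n.*2.+1 q00 q1 (fun j => u (shift n j) ^+ 3) (cube0 n))) => //; last by rewrite mulr_ge0.
rewrite mulr_sumr; apply: ler_sum => k _; rewrite mulr_sumr; apply: ler_sum_nat => i /andP[_ ik].
rewrite term_ijj_shift ?(ltnW ik)// -mulrA normrM normrM (ger0_norm (exprn_ge0 _ q00)).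
rewrite (ger0_norm (mulr_ge0 (u0 _) (exprn_ge0 2 (u0 _)))).
rewrite (_ : 2 * coef_bound * (q ^+ (k - i) * (u (shift n i) ^+ 3 + u (shift n k) ^+ 3))
  = coef_bound * q ^+ (k - i) * (2 * (u (shift n k) ^+ 3 + u (shift n i) ^+ 3))); last by ring.
apply: ler_pM.
- by rewrite mulr_ge0 ?exprn_ge0.
- by rewrite mulr_ge0 ?exprn_ge0.
- by apply: linear_decay; rewrite h_norm_le// subn_gt0.
- by rewrite mulrC prod2_le_cubes.
Qed.

Lemma ijk_summable : summable lt_triples (EFin \o term_ijk u).
Proof.
apply: (exhaustion_summable _ _ _ (coef_bound * (3 * kappa ^+ 2 * S)) triple_window_uniq triple_window_exhausts) => n.
rewrite (triple_window_sum n (fun p => `|term_ijk u p|)).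
apply: (@le_trans _ _ (coef_bound * (3 * kappa ^+ 2 * \sum_(0 <= j < n.*2.+1) u (shift n j) ^+ 3))); last first.
  by rewrite ler_wpM2l ?mulr_ge0// ler_wpM2l ?shift_cubes_le// mulr_ge0 ?sqr_ge0.
apply: le_trans (ler_wpM2l B0 (weighted_triples_le q n.*2.+1 q00 q1 (fun j => u (shift n j) ^+ 3) (cube0 n))) => //.
rewrite mulr_sumr; apply: ler_sum => j _; rewrite mulr_sumr; apply: ler_sum_nat => i /andP[_ ij].
rewrite mulr_sumr; apply: ler_sum_nat => k /andP[jk _].
rewrite term_ijk_shift ?(ltnW ij) ?(ltnW jk)//.
rewrite (_ : g R (j - i)%N * q ^+ _ * _ * _ * _
  = (g R (j - i)%N * q ^+ (2 * (j - i))) * (q ^+ (k - j) * (u (shift n i) * u (shift n j) * u (shift n k)))); last first.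
  by rewrite exprD; ring.
rewrite normrM normrM (ger0_norm (exprn_ge0 _ q00)).
rewrite [X in _ * X <= _]ger0_norm; last by rewrite !mulr_ge0// exprn_ge0.
rewrite -[q ^+ (j - i) * _ * _]mulrA [leRHS]mulrA.
apply: ler_pM.
- by rewrite mulr_ge0 ?exprn_ge0.
- by rewrite !mulr_ge0 ?exprn_ge0.
- by apply: linear_decay; rewrite g_norm_le// subn_gt0.
- by rewrite ler_wpM2l ?exprn_ge0// prod3_le_cubes.
Qed.

(** A comparison of coefficients with the chain density; its losses 2 q^(3(k-j)) and 4 q^(3(k-i)),
    designed for the ladder, are simply given away here. *)
Lemma window_energy_ge n :
  1 / 20 * \sum_(x <- window n) u x ^+ 3 <=
  d0 R * (\sum_(x <- window n) u x ^+ 3)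
  + g0 R / 2 * (\sum_(p <- pair_window n) term_iik u p)
  + 1 / 2 * (\sum_(p <- pair_window n) term_ijj u p)
  + \sum_(p <- triple_window n) term_ijk u p.
Proof.
rewrite !window_sum !pair_window_sum triple_window_sum.
set m := n.*2.+1; pose v j := u (shift n j).
have v0 j : 0 <= v j by exact: u0.
apply: le_trans (chain_density_ge q v m q0 q_expr6 v0) _.
rewrite -(exchange_triangle m (fun i k => term_iik u (shift n i, shift n k))).
rewrite !mulr_sumr -!big_split; apply: ler_sum => j _; rewrite chain_densityE.
have qd0 d : 0 <= q ^+ d by exact: exprn_ge0.
apply: lerD; [apply: lerD; [apply: lerD|]|].
- by rewrite ler_wpM2r ?exprn_ge0// d0_ge.
- rewrite mulr_sumr; apply: ler_sum_nat => k /andP[jk _]; rewrite term_iik_shift ?(ltnW jk)//.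
  rewrite (_ : g0 R / 2 * _ = g0 R / 2 * q ^+ (k - j) * (v j ^+ 2 * v k)); last by rewrite /v; ring.
  apply: ler_wpM2r; first by rewrite mulr_ge0// exprn_ge0.
  apply: ler_wpM2r; first exact: qd0.
  by have := @g0_ge R; have := qd0 (3 * (k - j))%N; lra.
- rewrite mulr_sumr; apply: ler_sum_nat => i /andP[_ ij]; rewrite term_ijj_shift ?(ltnW ij)//.
  rewrite (_ : 1 / 2 * _ = 1 / 2 * h R (j - i)%N * q ^+ (2 * (j - i)) * (v i * v j ^+ 2)); last by rewrite /v; ring.
  apply: ler_wpM2r; first by rewrite mulr_ge0// exprn_ge0.
  apply: ler_wpM2r; first exact: qd0.
  by have := @h_ge R (j - i); rewrite subn_gt0 => /(_ ij); lra.
- apply: ler_sum_nat => i /andP[_ ij]; apply: ler_sum_nat => k /andP[jk _].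
  rewrite term_ijk_shift ?(ltnW ij) ?(ltnW jk)//.
  rewrite (_ : g R _ * _ * _ * _ * _ = g R (j - i)%N * q ^+ (2 * (j - i) + (k - j)) * (v i * v j * v k)); last by rewrite /v; ring.
  apply: ler_wpM2r; first by rewrite !mulr_ge0.
  apply: ler_wpM2r; first exact: qd0.
  have := @g_ge R (j - i); rewrite subn_gt0 => /(_ ij).
  by have := qd0 (3 * (k - i))%N; lra.
Qed.

(** As the available lower bounds of the coefficients change sign, window sums are not treated as
    monotone: the inequality passes to the limit of convergent sums rather than to a supremum. *)
Lemma cubic_energy_ge :
  ((1 / 20)%:E * (\esum_(j in [set: int]) (u j ^+ 3)%:E) <= cubic_energy u)%E.
Proof.
have [P PE cP] := exhaustion_cvg _ _ window_uniq (fun _ _ _ => I) window_exhausts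
  (fun i => u i ^+ 3) cubes_summable.
have pwD n p : p \in pair_window n -> lt_pairs p.
  by rewrite mem_pair_window => /andP[/andP[]].
have twD n p : p \in triple_window n -> lt_triples p.
  by rewrite mem_triple_window => /andP[/andP[]].
have [Q QE cQ] := exhaustion_cvg _ _ pair_window_uniq pwD pair_window_exhausts
  (term_iik u) iik_summable.
have [X XE cX] := exhaustion_cvg _ _ pair_window_uniq pwD pair_window_exhausts
  (term_ijj u) ijj_summable.
have [Y YE cY] := exhaustion_cvg _ _ triple_window_uniq twD triple_window_exhausts
  (term_ijk u) ijk_summable.
have PS : P%:E = (\esum_(j in [set: int]) (u j ^+ 3)%:E)%E.
  rewrite -PE /abs_sum [X in (_ - X)%E]esum1 ?sube0; last first.
    move=> i _; congr (_%:E); rewrite /funrneg; apply/max_idPr.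
    by rewrite oppr_le0 exprn_ge0.
  apply: eq_esum => i _; congr (_%:E); rewrite /funrpos; apply/max_idPl.
  by rewrite exprn_ge0.
rewrite -PS /cubic_energy PE QE XE YE -!EFinM -!EFinD lee_fin.
pose F n := d0 R * (\sum_(x <- window n) u x ^+ 3)
  + g0 R / 2 * (\sum_(p <- pair_window n) term_iik u p)
  + 1 / 2 * (\sum_(p <- pair_window n) term_ijj u p)
  + \sum_(p <- triple_window n) term_ijk u p.
have cF : F @ \oo --> d0 R * P + g0 R / 2 * Q + 1 / 2 * X + Y.
  apply: cvgD cY; apply: cvgD; first apply: cvgD.
  - exact: cvgMr.
  - exact: cvgMr.
  - exact: cvgMr.
have cG : (fun n => 1 / 20 * \sum_(x <- window n) u x ^+ 3) @ \oo --> 1 / 20 * P.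
  exact: cvgMr.
apply: ler_cvg_to cG cF _.
by near=> n; exact: window_energy_ge.
Unshelve. all: by end_near.
Qed.

Lemma cubic_energy_cvg : cubic_energy_abs_cvg u.
Proof.
by split; [exact: cubes_summable|exact: iik_summable|exact: ijj_summable|exact: ijk_summable].
Qed.

End cubic_energy.

(** * Infinite ladders *)

Section powers.
Context {R : realType}.
Local Notation rt := (@rt R).
Local Notation q := (q R).

Lemma harmonic_block m : (0 < m)%N ->
  \sum_(m.+1 <= b < (2 * m).+1) rt b ^- 2 <= 61 / 88.
Proof.
move=> m0; apply: le_trans (@ln2_le R).
(* Each 1/b is at most ln b - ln (b - 1), so the block telescopes to exactly ln (2m) - ln m. The
   predecessor aligns this with an increment from b to b + 1. *)
rewrite (_ : ln 2 = ln (2 * m).+1.-1%:R - ln m.+1.-1%:R); last first.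
  by rewrite /= natrM lnM ?posrE ?ltr0n// addrK.
apply: (sum_telescope_le _ (fun b => ln b.-1%:R)); first by lia.
move=> b /andP[mb _] /=; have b1 : (1 < b)%N by lia.
have b0 : 0 < b%:R :> R by rewrite ltr0n ltnW.
have p0 : 0 < b.-1%:R :> R by rewrite ltr0n; lia.
have pE : b.-1%:R = b%:R - 1 :> R by rewrite -(subn1 b) natrB// ltnW.
suff h : ln b.-1%:R - ln b%:R <= - b%:R^-1 :> R by rewrite rt_sqr; lra.
rewrite -ln_div ?posrE// (_ : b.-1%:R / b%:R = 1 + - b%:R^-1); last by rewrite pE mulrBl mul1r divff ?gt_eqF.
by apply: le_ln1Dx; rewrite ltrN2 invf_lt1 ?ltr1n.
Qed.

Lemma powR_rt3 n : n%:R `^ (3 / 2) = rt n ^+ 3.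
Proof. by rewrite mulrC powRrM powR12_sqrt// powR_mulrn// sqrtr_ge0. Qed.

Lemma powR_rt3V n : n%:R `^ (- (3 / 2)) = rt n ^- 3.
Proof. by rewrite powRN powR_rt3. Qed.

Lemma kernelK_rt a b : kernelK R a b =
  ((a + b) * (a ^ 2 + a * b + b ^ 2))%N%:R * (rt a ^- 3 * rt b ^- 3 * rt (a + b) ^- 3).
Proof. by rewrite /kernelK powR_rt3 !rtM !exprMn !invfM. Qed.

Lemma kernelK_res a b : (0 < a)%N -> (0 < b)%N ->
  kernelK R a b = rt a ^- 3 + rt b ^- 3 + res a b.
Proof.
move=> a0 b0; have A := @rt_gt0 R a a0; have B := @rt_gt0 R b b0.
have C : 0 < rt (a + b) by rewrite rt_gt0// addn_gt0 a0.
rewrite kernelK_rt.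
have -> : ((a + b) * (a ^ 2 + a * b + b ^ 2))%N%:R = rt (a + b) ^+ 2 *
    (rt a ^+ 4 + rt a ^+ 2 * rt b ^+ 2 + rt b ^+ 4) :> R.
  by rewrite (exprM _ 2 2) (exprM (rt b) 2 2) !rt_sqr -!mulnn !(natrM, natrD); ring.
rewrite /res /rest.
by field; rewrite !gt_eqF.
Qed.

Lemma kernelK_ge0 a b : 0 <= kernelK R a b.
Proof. by rewrite divr_ge0// powR_ge0. Qed.

Definition base_weight (N : nat) : R := N%:R `^ (- (1 / 6)).

Lemma base_weight_ge0 N : 0 <= base_weight N.
Proof. exact: powR_ge0. Qed.

Lemma base_weight_rt N : (0 < N)%N -> base_weight N ^+ 3 * rt N = 1.
Proof.
move=> N0; rewrite /base_weight -powR_mulrn ?powR_ge0// -powRrM.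
rewrite (_ : - (1 / 6) * 3%:R = - 2^-1); last by field.
by rewrite powRN powR12_sqrt// mulVf// gt_eqF// rt_gt0.
Qed.

Lemma dyadic_weight N j :
  (N * 2 ^ j)%N%:R `^ (- (1 / 6)) = base_weight N * q ^+ j.
Proof.
rewrite natrM powRM// natrX; congr (_ * _).
by rewrite -powR_mulrn// powRAC powR_mulrn// powR_ge0.
Qed.

End powers.

Lemma nneseries_le {R : realType} (f : nat -> \bar R) m (B : \bar R) :
  (forall i, 0 <= f i)%E -> (forall k, \sum_(m <= i < k) f i <= B)%E ->
  (\sum_(m <= i <oo) f i <= B)%E.
Proof.
move=> f0 fB; apply: lime_le; first by apply: is_cvg_nneseries.
exact: nearW.
Qed.

Lemma nneseries_finite_support {R : realType} (f : nat -> R) M : (forall i, 0 <= f i) ->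
  (forall i, (M < i)%N -> f i = 0) -> (\sum_(1 <= i <oo) (f i)%:E < +oo)%E.
Proof.
move=> f0 fM; apply: (@le_lt_trans _ _ (\sum_(1 <= i < M.+1) (f i)%:E)%E); last first.
  by rewrite sumEFin ltry.
apply: nneseries_le => [i|k]; first by rewrite lee_fin.
rewrite !sumEFin lee_fin.
have [kM|Mk] := leqP k M.+1.
  have [k0|k0] := leqP 1 k; last by rewrite big_geq ?sumr_ge0// ltnW.
  by rewrite [leRHS](big_cat_nat (n := k))//= lerDl sumr_ge0.
rewrite (big_cat_nat (n := M.+1))//=; last exact: ltnW.
by rewrite gerDl big_nat big1// => i /andP[Mi _]; exact: fM.
Qed.

Lemma ler_sum_subset {R : realDomainType} {T : eqType} (s s' : seq T) (f : T -> R) :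
  uniq s -> uniq s' -> {subset s <= s'} -> (forall x, 0 <= f x) ->
  \sum_(x <- s) f x <= \sum_(x <- s') f x.
Proof.
move=> us us' ss' f0; rewrite [leRHS](bigID (mem s))/= -[X in _ <= X + _]big_filter.
rewrite (@perm_big _ _ _ _ [seq x <- s' | x \in s] s) ?lerDl ?sumr_ge0//.
apply: uniq_perm => //; first exact: filter_uniq.
by move=> x; rewrite mem_filter; case: (boolP (x \in s)) => // /ss'.
Qed.

Lemma scale_sq {R : realType} (k p : R) (A : \bar R) :
  (k%:E * ((p%:E * A) * (p%:E * A)) = (k * (p * p))%:E * (A * A))%E.
Proof. by rewrite (muleACA p%:E A) !EFinM !muleA. Qed.

Lemma scale_prod3 {R : realType} (k a b c : R) (A B C : \bar R) :
  (k%:E * (a%:E * A) * (b%:E * B) * (c%:E * C) = (k * (a * b * c))%:E * A * B * C)%E.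
Proof.
by rewrite !EFinM !muleA [LHS](ACl (1*2*4*6*3*5*7)%AC)/=.
Qed.

(** * From truncated ladders to infinite ones *)

Section wrap_up.
Context {R : realType}.
Local Notation rt := (@rt R).
Local Notation q := (q R).
Variables (N : nat) (u : nat -> R).
Hypothesis u0 : forall j, 0 <= u j.
Local Notation Y := (yseq N u).

Let c j n : R := (N * 2 ^ j)%N%:R `^ (- (1 / 6)) * u j * plateau R (N * 2 ^ j) n.

Let c_ge0 j n : 0 <= c j n.
Proof. by rewrite mulr_ge0 ?ler0n// mulr_ge0// powR_ge0. Qed.

Lemma yseq_ge0 n : (0 <= Y n)%E.
Proof. by apply: nneseries_ge0 => j _ _; rewrite lee_fin; exact: c_ge0. Qed.

Lemma totalA_xseq : totalA (xseq N u) = (\sum_(1 <= n <oo) (n%:R `^ (- (3 / 2)))%:E * Y n)%E.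
Proof. by []. Qed.

Lemma momentE3_xseq : momentE3 (xseq N u) = (\sum_(1 <= n <oo) Y n ^+ 2)%E.
Proof.
congr (limn _); apply/funext => k; apply: eq_big_nat => n /andP[n0 _].
have p1 : (n ^ 3)%:R * (n%:R `^ (- (3 / 2)) * n%:R `^ (- (3 / 2))) = 1 :> R.
  rewrite powR_rt3V natrX -rt_sqr.
  by have A := @rt_gt0 R n n0; field; rewrite gt_eqF.
by rewrite /xseq !expe2 scale_sq p1 mul1e.
Qed.

Lemma cubicC_xseq : cubicC (xseq N u) =
  (\esum_(p in pos_pairs) ((kernelK R p.1 p.2)%:E * Y p.1 * Y p.2 * Y (p.1 + p.2)%N))%E.
Proof.
apply: eq_esum => -[a b] [/= a0 b0].
by rewrite /xseq scale_prod3 kernelK_rt !powR_rt3V.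
Qed.

Lemma deficit_xseq : (totalA (xseq N u) * momentE3 (xseq N u)
  - (1 / 2)%:E * cubicC (xseq N u) = deficitD Y)%E.
Proof. by rewrite totalA_xseq momentE3_xseq cubicC_xseq. Qed.

Let lev i := (N * 2 ^ i)%N.
Let v i : R := base_weight N * q ^+ i * u i.

Let y n m := ladder v lev n m.

Lemma yseq_partial n m : (0 < m)%N ->
  (\sum_(0 <= j < n) (c j m)%:E = (y n m)%:E)%E.
Proof.
move=> m0; rewrite sumEFin; congr (_%:E); apply: eq_bigr => j _.
by rewrite /c dyadic_weight /plateau m0.
Qed.

Lemma yseq_cvg m : (0 < m)%N -> (fun n => (y n m)%:E) @ \oo --> Y m.
Proof.
move=> m0; rewrite (_ : (fun n => _) = (fun n => \sum_(0 <= j < n) (c j m)%:E)%E).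
  by apply: is_cvg_nneseries => j _ _; rewrite lee_fin.
by apply/funext => n; rewrite yseq_partial.
Qed.

Lemma ladder_le_yseq n m : (0 < m)%N -> ((y n m)%:E <= Y m)%E.
Proof.
move=> m0; rewrite -yseq_partial//; apply: nneseries_lim_ge => j _ _.
by rewrite lee_fin.
Qed.

Lemma ladder_ge0 n m : 0 <= y n m.
Proof.
apply: sumr_ge0 => j _; rewrite mulr_ge0// mulr_ge0// mulr_ge0 ?base_weight_ge0//.
exact/exprn_ge0/ltW/q_gt0.
Qed.

Hypotheses (N0 : (0 < N)%N) (N_large : 40 <= 3 / 1000 * rt N).

(** The kernel sum is kept on the left so that all terms are nonnegative and both sides can be
    compared with the infinite ladder by monotonicity. *)
Lemma ladder_deficit_ge n (M := (N * 2 ^ n)%N) :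
  1 / 20 * \sum_(0 <= j < n) u j ^+ 3 + 1 / 2 * \sum_(1 <= b < M.+1) \sum_(1 <= a < M.+1)
      kernelK R a b * (y n a * y n b * y n (a + b)%N) <=
  (\sum_(1 <= a < M.+1) rt a ^- 3 * y n a) * (\sum_(1 <= b < M.+1) y n b ^+ 2).
Proof.
have := @dyadic_deficit_ge R q (base_weight N) u N n (@q_gt0 R) (@q_expr6 R)
  (base_weight_ge0 N) N0 (base_weight_rt N N0) u0 N_large harmonic_block.
rewrite -lerBrDr => h; apply: le_trans h _; rewrite lerD2l lerN2 ler_wpM2l//.
rewrite le_eqVlt; apply/orP; left; apply/eqP.
apply: eq_big_nat => b /andP[b0 _]; apply: eq_big_nat => a /andP[a0 _].
by rewrite kernelK_res.
Qed.

Let box k : seq (nat * nat) :=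
  [seq (a, b) | a <- index_iota 1 (N * 2 ^ k).+1, b <- index_iota 1 (N * 2 ^ k).+1].

Let box_uniq k : uniq (box k).
Proof. by apply: allpairs_uniq; rewrite ?iota_uniq// => -[a b] [? ?]. Qed.

Let mem_box k p : (p \in box k) =
  [&& 0 < p.1, p.1 <= N * 2 ^ k, 0 < p.2 & p.2 <= N * 2 ^ k]%N.
Proof. by rewrite mem_pairs !mem_index_iota !ltnS -andbA. Qed.

Let box_exhausts p : pos_pairs p -> exists n0, forall n, (n0 <= n)%N -> p \in box n.
Proof.
move=> [p1 p2]; exists (p.1 + p.2)%N => n pn; rewrite mem_box p1 p2/=.
have h : (p.1 + p.2 <= N * 2 ^ n)%N.
  apply: leq_trans pn _; apply: leq_trans (leq_pmull _ N0).
  exact/ltnW/ltn_expl.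
by apply/andP; split; apply: leq_trans h; rewrite ?leq_addr ?leq_addl.
Qed.

Let box_sub k n : (k <= n)%N -> {subset box k <= box n}.
Proof.
move=> kn p; rewrite !mem_box => /and4P[-> h1 -> h2] /=.
have h : (N * 2 ^ k <= N * 2 ^ n)%N by rewrite leq_mul2l leq_pexp2l ?orbT.
by rewrite (leq_trans h1 h) (leq_trans h2 h).
Qed.

Lemma term_le_nneseries (f : nat -> \bar R) m : (forall i, 0 <= f i)%E -> (0 < m)%N ->
  (f m <= \sum_(1 <= i <oo) f i)%E.
Proof.
move=> f0 m0; apply: (@le_trans _ _ (\sum_(1 <= i < m.+1) f i)%E); last first.
  by apply: nneseries_lim_ge => i _ _.
by rewrite big_nat_recr//= leeDr// sume_ge0.
Qed.

(** Ensures that [fine (Y m)] below is the true value and not the default for an infinite one. *)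
Lemma yseq_fin_num (e : R) m : momentE3 (xseq N u) = e%:E -> (0 < m)%N ->
  Y m \is a fin_num.
Proof.
rewrite momentE3_xseq => EE m0; rewrite ge0_fin_numE ?yseq_ge0// ltey; apply/eqP => Yoo.
have := term_le_nneseries (fun i => Y i ^+ 2)%E m (fun i => expe_ge0 2 (yseq_ge0 i)) m0.
by rewrite EE Yoo expe2 mulyy leye_eq.
Qed.

(** The cubes up to [n0] and the box [k] are frozen while the truncation n of the ladder tends to
    infinity; the right side of the truncated inequality is bounded by [a * e] throughout. *)
Lemma partial_deficit_le (a e : R) n0 k :
  totalA (xseq N u) = a%:E -> momentE3 (xseq N u) = e%:E ->
  1 / 20 * \sum_(0 <= j < n0) u j ^+ 3
    + 1 / 2 * \sum_(p <- box k) kernelK R p.1 p.2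
        * (fine (Y p.1) * fine (Y p.2) * fine (Y (p.1 + p.2)%N))
  <= a * e.
Proof.
move=> AE EE; have Yfin m := yseq_fin_num e m EE.
move: AE EE; rewrite totalA_xseq momentE3_xseq => AE EE.
have ycvg m : (0 < m)%N -> (fun n => y n m) @ \oo --> fine (Y m).
  move=> m0; apply: (fine_cvg (f := fun n => (y n m)%:E)).
  by rewrite fineK ?Yfin//; exact: yseq_cvg.
have bound n : (k <= n)%N -> (n0 <= n)%N ->
    1 / 20 * \sum_(0 <= j < n0) u j ^+ 3 + 1 / 2 * \sum_(p <- box k) kernelK R p.1 p.2
      * (y n p.1 * y n p.2 * y n (p.1 + p.2)%N) <= a * e.
  move=> kn n0n.
  have Ka p : 0 <= kernelK R p.1 p.2 * (y n p.1 * y n p.2 * y n (p.1 + p.2)%N).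
    by rewrite mulr_ge0 ?kernelK_ge0// mulr_ge0 ?ladder_ge0// mulr_ge0 ?ladder_ge0.
  apply: (@le_trans _ _ (1 / 20 * \sum_(0 <= j < n) u j ^+ 3
     + 1 / 2 * \sum_(p <- box n) kernelK R p.1 p.2 * (y n p.1 * y n p.2 * y n (p.1 + p.2)%N))).
    apply: lerD; apply: ler_wpM2l => //.
      rewrite [leRHS](big_cat_nat (n := n0))//= lerDl sumr_ge0// => i _.
      by rewrite exprn_ge0.
    exact: ler_sum_subset (box_uniq k) (box_uniq n) (box_sub k n kn) Ka.
  rewrite big_allpairs/=.
  rewrite exchange_big/=.
  apply: le_trans (ladder_deficit_ge n) _.
  have r0 i : 0 <= rt i ^- 3 by rewrite invr_ge0 exprn_ge0// rt_ge0.
  apply: ler_pM.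
  - by apply: sumr_ge0 => i _; rewrite mulr_ge0// ladder_ge0.
  - by apply: sumr_ge0 => i _; rewrite exprn_ge0// ladder_ge0.
  - rewrite -lee_fin -AE -sumEFin; apply: le_trans (nneseries_lim_ge (N * 2 ^ n).+1 _); last first.
      by move=> i _ _; rewrite mule_ge0 ?yseq_ge0// lee_fin powR_ge0.
    rewrite big_nat [leRHS]big_nat; apply: lee_sum => i /andP[i0 _].
    by rewrite EFinM powR_rt3V lee_pmul ?lee_fin ?ladder_ge0// ladder_le_yseq.
  - rewrite -lee_fin -EE -sumEFin; apply: le_trans (nneseries_lim_ge (N * 2 ^ n).+1 _); last first.
      by move=> i _ _; rewrite expe_ge0// yseq_ge0.
    rewrite big_nat [leRHS]big_nat; apply: lee_sum => i /andP[i0 _].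
    by rewrite expr2 EFinM expe2 lee_pmul ?lee_fin ?ladder_ge0// ladder_le_yseq.
pose G n := 1 / 20 * \sum_(0 <= j < n0) u j ^+ 3 + 1 / 2 * \sum_(p <- box k) kernelK R p.1 p.2
      * (y n p.1 * y n p.2 * y n (p.1 + p.2)%N).
have cG : G @ \oo --> 1 / 20 * \sum_(0 <= j < n0) u j ^+ 3
    + 1 / 2 * \sum_(p <- box k) kernelK R p.1 p.2
        * (fine (Y p.1) * fine (Y p.2) * fine (Y (p.1 + p.2)%N)).
  apply: cvgD; first exact: cvg_cst.
  apply: cvgMr; rewrite big_seq.
  rewrite (_ : (fun n => _) = (fun n => \sum_(p <- box k | p \in box k) kernelK R p.1 p.2
      * (y n p.1 * y n p.2 * y n (p.1 + p.2)%N))); last first.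
    by apply/funext => n; rewrite big_seq.
  apply: (cvg_big (op := +%R)) => [|[i j]]; last first.
    rewrite mem_box => /= /and4P[i0 _ j0 _]; apply: cvgMr.
    by apply: cvgM; [apply: cvgM|]; apply: ycvg; rewrite ?addn_gt0 ?i0.
  by apply: add_continuous.
apply: ler_cvg_to cG (cvg_cst (a * e)) _.
by near=> n; apply: bound; near: n; exact: nbhs_infty_ge.
Unshelve. all: by end_near.
Qed.

Lemma deficit_ge : (totalA (xseq N u) < +oo)%E -> (momentE3 (xseq N u) < +oo)%E ->
  ((1 / 20)%:E * (\sum_(0 <= j <oo) (u j ^+ 3)%:E) <= deficitD Y)%E.
Proof.
move=> Afin Efin; rewrite -deficit_xseq.
have A0 : (0 <= totalA (xseq N u))%E.
  by apply: nneseries_ge0 => i _ _; rewrite mule_ge0 ?yseq_ge0// lee_fin powR_ge0.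
have E0 : (0 <= momentE3 (xseq N u))%E.
  by rewrite momentE3_xseq; apply: nneseries_ge0 => i _ _; rewrite expe_ge0// yseq_ge0.
have [a AE] : exists a, totalA (xseq N u) = a%:E.
  by exists (fine (totalA (xseq N u))); rewrite fineK// ge0_fin_numE.
have [e EE] : exists e, momentE3 (xseq N u) = e%:E.
  by exists (fine (momentE3 (xseq N u))); rewrite fineK// ge0_fin_numE.
pose K (p : nat * nat) := kernelK R p.1 p.2 * (fine (Y p.1) * fine (Y p.2) * fine (Y (p.1 + p.2)%N)).
have K0 p : 0 <= K p.
  by rewrite mulr_ge0 ?kernelK_ge0// !mulr_ge0// fine_ge0// yseq_ge0.
have Yfin m : (0 < m)%N -> Y m = (fine (Y m))%:E by move=> m0; rewrite fineK// (yseq_fin_num e).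
have CE : cubicC (xseq N u) = (\esum_(p in pos_pairs) (K p)%:E)%E.
  rewrite cubicC_xseq; apply: eq_esum => -[i j] [/= i0 j0].
  rewrite /K/= !EFinM -!Yfin ?addn_gt0 ?i0//.
  by rewrite !muleA.
(* Already with [n0] = 0 this makes the cubic sum finite, so the subtraction in the deficit is one
   of real numbers. Then [n0] grows. *)
have Cle n0 : (cubicC (xseq N u) <= (2 * (a * e - 1 / 20 * \sum_(0 <= j < n0) u j ^+ 3))%:E)%E.
  rewrite CE; apply: (exhaustion_esum_le pos_pairs box box_uniq box_exhausts K) => //.
  exists 0%N => // k _; rewrite lee_fin.
  by have := partial_deficit_le a e n0 k AE EE; rewrite -/(K _); lra.
have C0 : (0 <= cubicC (xseq N u))%E by rewrite CE; apply: esum_ge0 => p _; rewrite lee_fin.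
have [C CR] : exists C, cubicC (xseq N u) = C%:E.
  exists (fine (cubicC (xseq N u))); rewrite fineK// ge0_fin_numE//.
  exact: le_lt_trans (Cle 0%N) (ltry _).
rewrite AE EE CR -!EFinM -EFinB.
have S_le : (\sum_(0 <= j <oo) (u j ^+ 3)%:E <= (20 * (a * e - 1 / 2 * C))%:E)%E.
  apply: nneseries_le => [i|k]; first by rewrite lee_fin exprn_ge0.
  by rewrite sumEFin lee_fin; have := Cle k; rewrite CR lee_fin; lra.
apply: (@le_trans _ _ ((1 / 20)%:E * (20 * (a * e - 1 / 2 * C))%:E)%E).
  by rewrite lee_wpmul2l// lee_fin.
by rewrite -EFinM lee_fin; lra.
Qed.

End wrap_up.

Section finite_support.
Context {R : realType}.
Variables (N : nat) (u : nat -> R) (n : nat).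
Hypotheses (u0 : forall j, 0 <= u j) (un : forall j, (n <= j)%N -> u j = 0).
Let y := ladder (fun i => base_weight N * q R ^+ i * u i) (fun i => N * 2 ^ i)%N n.

Lemma yseq_finite_support m : (0 < m)%N -> yseq N u m = (y m)%:E.
Proof.
move=> m0; apply/eqP; rewrite eq_le ladder_le_yseq// andbT.
have c0 j : 0 <= (N * 2 ^ j)%N%:R `^ (- (1 / 6)) * u j * plateau R (N * 2 ^ j) m.
  by rewrite mulr_ge0 ?ler0n// mulr_ge0// powR_ge0.
apply: nneseries_le => [j|k]; first by rewrite lee_fin.
rewrite -(yseq_partial N u n m m0) !sumEFin lee_fin.
have [kn|nk] := leqP k n.
  by rewrite [leRHS](big_cat_nat (n := k))//= lerDl sumr_ge0.
rewrite (big_cat_nat (n := n))//=; last exact: ltnW.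
by rewrite gerDl big_nat big1// => i /andP[ni _]; rewrite un// mulr0 mul0r.
Qed.

Lemma ladder_vanishes m : (N * 2 ^ n < m)%N -> y m = 0.
Proof.
move=> hm; rewrite /y /ladder big_nat big1// => i /andP[_ ik].
rewrite (_ : (m <= _)%N = false) ?mulr0//; apply/negbTE; rewrite -ltnNge.
by apply: leq_ltn_trans hm; rewrite leq_mul2l leq_pexp2l ?orbT// ltnW.
Qed.

Lemma totalA_finite_support : (totalA (xseq N u) < +oo)%E.
Proof.
rewrite totalA_xseq (_ : (\sum_(1 <= i <oo) _)%E = (\sum_(1 <= i <oo) (i%:R `^ (- (3 / 2)) * y i)%:E)%E); last first.
  congr (limn _); apply/funext => k; apply: eq_big_nat => i /andP[i0 _].
  by rewrite yseq_finite_support.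
apply: (@nneseries_finite_support _ _ (N * 2 ^ n)) => i.
  by rewrite mulr_ge0 ?powR_ge0 ?ladder_ge0.
by move=> hi; rewrite ladder_vanishes ?mulr0.
Qed.

Lemma momentE3_finite_support : (momentE3 (xseq N u) < +oo)%E.
Proof.
rewrite momentE3_xseq (_ : (\sum_(1 <= i <oo) _)%E = (\sum_(1 <= i <oo) (y i ^+ 2)%:E)%E); last first.
  congr (limn _); apply/funext => k; apply: eq_big_nat => i /andP[i0 _].
  by rewrite yseq_finite_support.
apply: (@nneseries_finite_support _ _ (N * 2 ^ n)) => i.
  by rewrite sqr_ge0.
by move=> hi; rewrite ladder_vanishes ?expr0n.
Qed.

End finite_support.

Lemma finite_support_bound {R : realType} (u : nat -> R) : finite_set [set j | u j != 0] ->
  exists n, forall j, (n <= j)%N -> u j = 0.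
Proof.
case/finite_seqP => s sE; exists (\max_(i <- s) i).+1 => j hj.
apply/eqP; apply: contraTT hj => uj; rewrite -ltnNge ltnS.
have : [set` s] j by rewrite -sE.
by move=> /= js; exact: leq_bigmax_seq.
Qed.

Theorem theorem3p33 (R : realType) :
  exists delta : R, 0 < delta /\
    (forall u : int -> R,
       (forall j, 0 <= u j) -> in_ell3 u ->
       cubic_energy_abs_cvg u /\
       (delta%:E * (\esum_(j in [set: int]) (u j ^+ 3)%:E)
          <= cubic_energy u)%E) /\
    exists N0 : nat, (0 < N0)%N /\
      forall N : nat, (N0 <= N)%N ->
      forall u : nat -> R, (forall j, 0 <= u j) ->
        (finite_set [set j | u j != 0] \/
         ((totalA (xseq N u) < +oo)%E /\ (momentE3 (xseq N u) < +oo)%E)) ->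
        (totalA (xseq N u) * momentE3 (xseq N u)
           - (1 / 2)%:E * cubicC (xseq N u) = deficitD (yseq N u))%E /\
        ((delta / 2)%:E * (\sum_(0 <= j <oo) (u j ^+ 3)%:E)
           <= deficitD (yseq N u))%E.
Proof.
exists (1 / 20); split; first by rewrite divr_gt0.
split=> [u u0 ul3|]; first by split; [exact: cubic_energy_cvg|exact: cubic_energy_ge].
(* Any N >= K^2 gives 3/1000 sqrt N >= 40, enough for the additive constants of all coefficient
   bounds. *)
pose K := 40 * (1000 / 3) : R.
have [m hm] : exists m : nat, K ^+ 2 <= m%:R.
  by exists (Num.trunc (K ^+ 2)).+1; apply/ltW/truncnS_gt.
exists m.+1; split=> // N mN u u0 fin.
have N0 : (0 < N)%N by apply: leq_trans mN.
have N_large : 40 <= 3 / 1000 * rt N :> R.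
  have K0 : 0 <= K by rewrite mulr_ge0 ?divr_ge0 ?ler0n.
  have : K <= rt N :> R.
    rewrite -(@ler_pXn2r _ 2) ?nnegrE ?rt_ge0// rt_sqr; apply: le_trans hm _.
    by rewrite ler_nat ltnW.
  by rewrite /K; lra.
have [Afin Efin] : (totalA (xseq N u) < +oo)%E /\ (momentE3 (xseq N u) < +oo)%E.
  case: fin => // /finite_support_bound[n un].
  split; [exact: totalA_finite_support un|exact: momentE3_finite_support un].
split; first exact: deficit_xseq.
apply: le_trans (deficit_ge N u u0 N0 N_large Afin Efin).
(* The ladder bound was obtained with the full constant 1/20; passing to half of it needs the sum of
   cubes to be nonnegative. *)
apply: lee_wpmul2r; last by rewrite lee_fin; lra.
by apply: nneseries_ge0 => j _ _; rewrite lee_fin exprn_ge0.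
Qed.
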